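(* Let $G$ be a simple algebraic group defined and split over $F_q$ and let $c$ be a family of irreducible representations of its Weyl group. Let $\mathcal U_c$ be the corresponding set of unipotent representations of $G(F_q)$, identified with $M(\mathcal G_c)$. Consider the two partitions of $M(\mathcal G_c)=\mathcal U_c$ described in the context: $M(\mathcal G_c)=\bigsqcup_{\gamma}M(\mathcal G_c)^{\gamma}$ (Harish-Chandra series) and $M(\mathcal G_c)=\bigsqcup_{h\in\overline{\mathcal H}_c}{}^hM(\mathcal G_c)$, where ${}^hM(\mathcal G_c)=\alpha_c^{-1}(h)$ is the fibre at $h$ of the surjective map $\alpha_c:M(\mathcal G_c)\to\overline{\mathcal H}_c$. Then the two partitions are transversal: for every $\gamma$ and every $h\in\overline{\mathcal H}_c$ we have $|{}^hM(\mathcal G_c)\cap M(\mathcal G_c)^{\gamma}|\le1$.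
   Context: For a finite group $\Gamma$, $M(\Gamma)$ is the set of $\Gamma$-conjugacy classes of pairs $(x,\rho)$, $x\in\Gamma$, $\rho$ an irreducible complex representation of the centralizer of $x$. Lusztig attaches to $c$ a finite group $\mathcal G_c$ and a bijection $\mathcal U_c\leftrightarrow M(\mathcal G_c)$. The data $M(\mathcal G_c)$, its partition into Harish-Chandra series, the set $\overline{\mathcal H}_c$ of pairs of subgroups of $\mathcal G_c$, and $\alpha_c$ are as follows. **Type A.** Everything is a one element set. **Combinatorics for types B, C, D.** $\mathbb F=\mathbb Z/2$; $[a,b]=\{z\in\mathbb Z:a\le z\le b\}$. For $D\in\mathbb N$, $V_D$ is the $\mathbb F$-vector space with basis $e_1,\dots,e_D$; $V_{D'}\subset V_D$ for $D'\le D$. $\mathcal I_D$ is the set of intervals $[a,b]$, $1\le a\le b\le D$; $e_I=\sum_{i\in I}e_i$; $R_D$ is the set of subsets of $\mathcal I_D$. For $D\ge2$, $i\in[1,D]$: $\xi_i([a',b'])=[a'+2,b'+2]$ if $i\le a'$; $=[a',b']$ if $i\ge b'+2$; $=[a',b'+2]$ if $a'<i<b'+2$ (for $[a',b']\in\mathcal I_{D-2}$); $t_i(B')=\{\xi_i(I'):I'\in B'\}\sqcup\{[i,i]\}$ for $B'\in R_{D-2}$. $\mathbb S^{prim}_D$ consists of $\emptyset$ and: if $D$ is even, $\{[1,D],[2,D-1],\dots,[k,D+1-k]\}$, $k\in[1,D/2]$; if $D$ is odd, $\{[1,D-1],\dots,[k,D-k]\}$ and $\{[2,D],[3,D-1],\dots,[k+1,D+1-k]\}$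 for odd $k\in[1,(D-1)/2]$. $\mathbb S_0=\{\emptyset\}$, $\mathbb S_1=\{\emptyset,\{[1,1]\}\}$; for $D\ge2$, $B\in\mathbb S_D$ iff $B\in\mathbb S_D^{prim}$ or $B=t_i(B')$ for some $i\in[1,D]$, $B'\in\mathbb S_{D-2}$. $S_D=\{B\in\mathbb S_D:|I|\text{ odd }\forall I\in B\}$. $\mathbf E_B=\mathrm{span}\{e_I:I\in B\}$ for $B\in\mathbb S_D$; $\mathcal F(V_D)=\{\mathbf E_B:B\in S_D\}$. $(\,,)$ is the symplectic form on $V_D$ with $(e_i,e_j)=1$ iff $i-j=\pm1$. $V_D^\delta=\mathrm{span}\{e_i:i\equiv\delta\bmod2\}$; for $Z\subset V_D^{1-\delta}$, $Z^!=\{x\in V_D^\delta:(x,y)=0\ \forall y\in Z\}$; $E^\delta=E\cap V_D^\delta$. *The sets $B(k)$.* For $B\in S_D$ put $B(0)=B$. If $|B|<D/2$ ($D$ even) or $|B|<(D+1)/2$ ($D$ odd) let $\Delta=D-2|B|\ge1$; write $\bigcup_{I\in B}I=[a_1,b_1]\cup\dots\cup[a_s,b_s]$ with $a_i\le b_i$, $b_i+2\le a_{i+1}$; $b_0=-1$, $a_{s+1}=D+2$. Let $i_1<\dots<i_t$ be the $i\in[1,s+1]$ with $a_i-b_{i-1}\ge3$. The intervals $[a_{i_u}-1,b_{i_{u+1}-1}+1]$ ($u\in[1,t-1]$) and $[j,j]$ for $j\in[b_{i-1}+2,a_i-2]$, $i\in[1,s+1]$ with $a_i-b_{i-1}\ge4$,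 are $\Delta$ consecutive disjoint intervals, listed from left to right as $I_1,\dots,I_\Delta$; $I_{[c,d]}=I_c\cup\dots\cup I_d$. Put $B(k)=B\sqcup\{I_{[1,\Delta]},I_{[2,\Delta-1]},\dots,I_{[k,\Delta+1-k]}\}$ if $D$ even, $k\in[1,\Delta/2]$; $B(k)=B\sqcup\{I_{[1,\Delta-1]},\dots,I_{[k,\Delta-k]}\}$ if $D$ odd, $k\in[1,(\Delta-1)/2]$ odd. Then $B(k)\in\mathbb S_D$. *The vector $\epsilon_D$.* Let $\mathbf a$ be a symbol, $\overline{[1,D]}=[1,D]\sqcup\{\mathbf a\}$, $e_{\mathbf a}=e_{[1,D]}$. For $I\in\mathcal I_D$ let $I^*=I$ if $|I|$ is odd, $I^*=\overline{[1,D]}\setminus I$ if $|I|$ is even; for $C\in\mathbb S_D$ let $C^*=\{I^*:I\in C\}$ and let $n_j$ be the number of elements of $C^*$ containing $j$. Let $\epsilon_D(C^* )=\sum_{j\in\overline{[1,D]}}\epsilon^je_j\in V_D$ where $\epsilon^j=n_j(n_j+1)/2\bmod 2$, except in the following situation: $D$ is odd, $j\ne\mathbf a$, and $j$ lies in the union $[C^*]$ of all members of $C^*$ containing $\mathbf a$; then $[C^*]\setminus\{\mathbf a\}=[1,l]\sqcup[l',D]$ with $0\le l<D$, $1<l'\le D+1$, $l'\ge l+2$; put $u=l'$ if $j\in[l',D]$, $u=l$ if $j\in[1,l]$; if $u\equiv j\bmod2$ then $\epsilon^j=(n_j+1)(n_j+2)/2\bmod2$ (and otherwise $\epsilon^j=n_j(n_j+1)/2$).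 *The functions $\tilde u$.* Any $v\in V_D$ is uniquely $e_{[a_1,b_1]}+\dots+e_{[a_r,b_r]}$ with $a_s\le b_s$, $b_s+2\le a_{s+1}$; let $u(v)=\sum_{s:\,a_s\not\equiv b_s\bmod2}(-1)^{a_s}$. If $D$ is even: $\tilde u(v)=2u(v)$ if $u(v)\ge0$, $-2u(v)-1$ if $u(v)<0$. If $D$ is odd: $\tilde u(v)=2u(v)-1$ if $u(v)>0$, $-2u(v)+1$ if $u(v)<0$, $0$ if $u(v)=0$. **Types B, C.** $\mathcal G_c=V_D^\delta$ for some even $D$ and $\delta\in\{0,1\}$, and $M(\mathcal G_c)=V_D^\delta\oplus\mathrm{Hom}(V_D^\delta,\mathbb F)=V_D^\delta\oplus V_D^{1-\delta}=V_D$ via $(\,,)$. The sets $M(\mathcal G_c)^\gamma$ are the fibres of $\tilde u:V_D\to\mathbb N$. $\overline{\mathcal H}_c=\{(E^\delta,(E^{1-\delta})^!):E\in\mathcal F(V_D)\}$. Every $v\in V_D$ is $\epsilon_D(B(k)^* )$ for a unique pair $(B,k)$, $B\in S_D$, $k\in[0,D/2-|B|]$; $\alpha_c(v)=(E^\delta,(E^{1-\delta})^!)$ with $E=\mathbf E_B$. **Type D.** $D$ is odd, $\eta_D=e_1+e_3+\dots+e_D$, $V'_D=V_D/\mathbb F\eta_D$, $\pi:V_D\to V'_D$ the quotient map; $\mathcal G_c=\pi(V_D^1)$ and $M(\mathcal G_c)=\pi(V_D^1)\oplus\pi(V_D^0)=V'_D$ via the induced form. The sets $M(\mathcal G_c)^\gamma$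 are the fibres of $\tilde u':V'_D\to\mathbb N$, the composition of the inverse of $\pi|_{V_{D-1}}:V_{D-1}\to V'_D$ (an isomorphism), the inclusion $V_{D-1}\subset V_D$, and $\tilde u:V_D\to\mathbb N$ ($D$ odd). $\overline{\mathcal H}_c=\{(\pi(E^1),\pi((E^0)^!)):E\in\mathcal F(V_D)\}$. Every $v'\in V'_D$ is $\pi(\epsilon_D(B(k)^* ))$ for a unique pair $(B,k)$ such that either $B\in S_{D-1}$ (viewed as a subset of $S_D$) and $k$ is $0$ or an odd number in $[1,(D-2|B|-1)/2]$, or $B\in S_D\setminus S_{D-1}$, $|B|<(D-1)/2$ and $k\in[1,(D-2|B|-1)/2]$ is odd; $\alpha_c(v')=(\pi(E^1),\pi((E^0)^!))$ with $E=\mathbf E_B$. **Exceptional types.** $\mathcal G_c=S_n$, $n\in\{1,2,3,4,5\}$. $H_{k!}$ denotes a standard subgroup $S_k$; $H_{2!2!}=S_2\times S_2$, $H_{2!3!}=S_2\times S_3$, $H_8$ a dihedral subgroup of order 8 containing $H_{2!2!}$; $H_{1!}=1$. Elements of $M(S_n)$ are written in Lusztig's notation ($i$ a primitive 4th, $\theta$ a primitive cubic, $\zeta$ a primitive 5th root of 1). Below ''$(Y,X)$: list'' means that $(Y,X)\in\overline{\mathcal H}_c$ and $\alpha_c^{-1}(Y,X)$ is the list. - $S_1$: $(1,1)$: the unique element. One series. - $S_2$: $(1,H_{2!})$: $(1,1),(g_2,\epsilon)$; $(H_{2!},H_{2!})$: $(g_2,1)$; $(1,1)$: $(1,\epsilon)$.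 Series: if $|c|=3$, $\{(1,1),(g_2,1),(1,\epsilon)\}$, $\{(g_2,\epsilon)\}$; if $|c|=2$, $\{(1,1),(g_2,1)\}$, $\{(g_2,\epsilon)\}$, $\{(1,\epsilon)\}$. - $S_3$: $(1,H_{3!})$: $(1,1),(g_3,\theta),(g_3,\theta^2)$; $(H_{3!},H_{3!})$: $(g_3,1)$; $(1,H_{2!})$: $(1,r),(g_2,\epsilon)$; $(H_{2!},H_{2!})$: $(g_2,1)$; $(1,1)$: $(1,\epsilon)$. Series: each of $(g_3,\theta),(g_3,\theta^2),(g_2,\epsilon)$ alone; the remaining elements form one series if $|c|=5$; if $|c|=4$ (type $G_2$) $(1,\epsilon)$ is also alone and the remaining 4 elements form one series. - $S_4$ (type $F_4$): $(1,H_{4!})$: $(1,1),(g_4,i),(g_4,-i)$; $(H_{4!},H_{4!})$: $(g_4,1)$; $(H_{2!2!},H_8)$: $(g_2',1),(g_4,-1)$; $(H_8,H_8)$: $(g_2',\epsilon')$; $(1,H_{2!2!})$: $(1,\sigma),(g_2,\epsilon'),(g_2',\epsilon)$; $(H_{2!},H_{2!2!})$: $(g_2,1),(g_2',r)$; $(H_{2!2!},H_{2!2!})$: $(g_2',\epsilon'')$; $(1,H_{3!})$: $(1,\lambda^1),(g_3,\theta),(g_3,\theta^2)$; $(H_{3!},H_{3!})$: $(g_3,1)$; $(1,H_{2!})$: $(1,\lambda^2),(g_2,\epsilon)$; $(H_{2!},H_{2!})$: $(g_2,\epsilon'')$; $(1,1)$: $(1,\lambda^3)$. Series: each of $(g_4,\pm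 i),(g_3,\theta),(g_3,\theta^2),(g_2',\epsilon),(g_2,\epsilon),(1,\lambda^3)$ alone; $\{(g_2,\epsilon'),(g_2',r),(g_4,-1)\}$; the remaining 11 elements. - $S_5$ (type $E_8$): $(1,H_{5!})$: $(1,1),(g_5,\zeta^j)$ ($j=1,2,3,4$); $(H_{5!},H_{5!})$: $(g_5,1)$; $(1,H_{4!})$: $(1,\lambda^1),(g_4,i),(g_4,-i)$; $(H_{4!},H_{4!})$: $(g_4,1)$; $(1,H_{2!3!})$: $(1,\nu),(g_2,-1),(g_3,\theta),(g_3,\theta^2),(g_6,-\theta),(g_6,-\theta^2)$; $(H_{2!},H_{2!3!})$: $(g_2,1),(g_6,\theta),(g_6,\theta^2)$; $(H_{3!},H_{2!3!})$: $(g_3,1),(g_6,-1)$; $(H_{2!3!},H_{2!3!})$: $(g_6,1)$; $(H_{2!2!},H_8)$: $(g_2',1),(g_4,-1)$; $(H_8,H_8)$: $(g_2',\epsilon')$; $(1,H_{2!2!})$: $(1,\nu'),(g_2,-r),(g_2',\epsilon)$; $(H_{2!},H_{2!2!})$: $(g_2,r),(g_2',r)$; $(H_{2!2!},H_{2!2!})$: $(g_2',\epsilon'')$; $(1,H_{3!})$: $(1,\lambda^2),(g_3,\epsilon\theta),(g_3,\epsilon\theta^2)$; $(H_{3!},H_{3!})$: $(g_3,\epsilon)$; $(1,H_{2!})$: $(1,\lambda^3),(g_2,-\epsilon)$; $(H_{2!},H_{2!})$: $(g_2,\epsilon)$; $(1,1)$: $(1,\lambda^4)$. Series: each of $(g_5,\zeta^j)$,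 $(g_4,\pm i)$, $(g_6,-\theta^{j})$, $(g_3,\epsilon\theta^{j})$ ($j=1,2$ in the last two), $(g_2',\epsilon)$, $(g_2,-\epsilon)$, $(1,\lambda^4)$ alone; $\{(g_3,\theta^j),(g_6,\theta^j)\}$ for $j=1$ and for $j=2$; $\{(g_2,-1),(g_2,-r),(g_2',r),(g_4,-1),(g_6,-1)\}$; the remaining 17 elements. *)

(* Defs.v *)
From HB Require Import structures.
From mathcomp Require Import all_boot all_order all_algebra all_fingroup.
From mathcomp Require Import all_solvable all_field all_character.
From mathcomp Require Import finmap.

Set Implicit Arguments.
Unset Strict Implicit.
Unset Printing Implicit Defensive.

Import Order.TTheory GRing.Theory Num.Theory.

Local Open Scope nat_scope.

(** * The data attached to a family *)

(* [fd_HC g] is the set M(G_c)^g and [fd_Hbar] lists the pairs (Y, X) of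
   subgroups that form Hbar_c.  [fd_alpha] is the map alpha_c, given by the
   tables and constructions below; it is option-valued only because the
   definitions make sense before one knows that they define alpha_c on all of
   M(G_c) (so [None] is never a value of [fd_alpha] on [fd_M]). *)
Record family_data : Type := FamilyData {
  fd_group : finGroupType;
  fd_carrier : finType;
  fd_M : {set fd_carrier};
  fd_HC : nat -> {set fd_carrier};
  fd_Hbar : seq ({set fd_group} * {set fd_group});
  fd_alpha : fd_carrier -> option ({set fd_group} * {set fd_group})
}.

Definition fd_fibre (d : family_data) (h : {set fd_group d} * {set fd_group d})
    : {set fd_carrier d} :=
  [set m in fd_M d | fd_alpha m == Some h].

(** * Intervals and the sets S_D *)

(* The pair (a, b) with a <= b stands for the interval [a, b]. *)
Definition nitv : Type := (nat * nat)%type.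

Definition mem_nitv (J : nitv) (i : nat) : bool := J.1 <= i <= J.2.
Definition nitv_size (J : nitv) : nat := J.2.+1 - J.1.

Definition xi (i : nat) (J : nitv) : nitv :=
  if i <= J.1 then (J.1 + 2, J.2 + 2)
  else if J.2 + 2 <= i then J
  else (J.1, J.2 + 2).

Local Open Scope fset_scope.

Definition fset_of (s : seq nitv) : {fset nitv} := [fset J | J in s].

Definition t_ (i : nat) (B : {fset nitv}) : {fset nitv} :=
  (i, i) |` [fset xi i J | J in B].

Definition SS_prim (D : nat) : seq {fset nitv} :=
  fset0 ::
  (if ~~ odd D then
     [seq fset_of [seq (c, D.+1 - c) | c <- iota 1 k] | k <- iota 1 D./2]
   else
     let ks := [seq k <- iota 1 D.-1./2 | odd k] in
     [seq fset_of [seq (c, D - c) | c <- iota 1 k] | k <- ks] ++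
     [seq fset_of [seq (c.+1, D.+1 - c) | c <- iota 1 k] | k <- ks]).

Fixpoint SS (D : nat) : seq {fset nitv} :=
  match D with
  | 0 => [:: fset0]
  | 1 => [:: fset0; [fset (1, 1)]]
  | D'.+2 => SS_prim D'.+2 ++ [seq t_ i B | i <- iota 1 D'.+2, B <- SS D']
  end.

Definition S_ (D : nat) : seq {fset nitv} :=
  [seq B : {fset nitv} <- SS D | all (fun J => odd (nitv_size J)) B].

(* The maximal intervals of the subset P of [1, D], from left to right;
   P must be false outside [1, D]. *)
Definition runs (D : nat) (P : pred nat) : seq nitv :=
  [seq J <- [seq (a, b) | a <- iota 1 D, b <- iota 1 D] |
    [&& J.1 <= J.2, all P (index_iota J.1 J.2.+1), ~~ P J.1.-1 & ~~ P J.2.+1]].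

(** * The sets B(k) *)

Definition Delta (D : nat) (B : {fset nitv}) : nat := D - 2 * #|` B|.

(* The list of the pairs (b_{i-1} + 1, a_i), i in [1, s+1]; storing b + 1
   instead of b keeps b_0 = -1 inside nat. *)
Definition gaps (D : nat) (B : {fset nitv}) : seq (nat * nat) :=
  let cs := runs D (fun i => has (fun J => mem_nitv J i) B) in
  zip (0 :: [seq J.2.+1 | J <- cs]) (rcons [seq J.1 | J <- cs] D.+2).

Definition I_list (D : nat) (B : {fset nitv}) : seq nitv :=
  let wide := [seq g <- gaps D B | g.1 + 2 <= g.2] in
  let blocks := [seq (p.1.2.-1, p.2.1) | p <- zip wide (behead wide)] in
  let points := [seq (j, j) | g <- [seq g <- gaps D B | g.1 + 3 <= g.2],
                              j <- index_iota g.1.+1 g.2.-1] in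
  sort (fun J K : nitv => J.1 <= K.1) (blocks ++ points).

(* I_[c,d]; the members of the list are consecutive, so their union is an
   interval. *)
Definition I_union (D : nat) (B : {fset nitv}) (c d : nat) : nitv :=
  ((nth (0, 0) (I_list D B) c.-1).1, (nth (0, 0) (I_list D B) d.-1).2).

Definition Bk (D : nat) (B : {fset nitv}) (k : nat) : {fset nitv} :=
  let last_index c := if odd D then Delta D B - c else (Delta D B).+1 - c in
  B `|` fset_of [seq I_union D B c (last_index c) | c <- iota 1 k].

(** * The space V_D *)

Local Open Scope ring_scope.

(* Basis vectors are numbered from 1: e D i = 0 unless 1 <= i <= D. *)
Definition e (D i : nat) : 'rV['F_2]_D := \row_(j < D) (j.+1 == i)%:R.

Definition e_itv (D : nat) (J : nitv) : 'rV['F_2]_D :=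
  \sum_(J.1 <= i < J.2.+1) e D i.

Definition E_of (D : nat) (B : {fset nitv}) : {vspace 'rV['F_2]_D} :=
  <<[seq e_itv D J | J <- B]>>%VS.

Definition V_parity (D : nat) (delta : bool) : {vspace 'rV['F_2]_D} :=
  <<[seq e D i | i <- iota 1 D & odd i == delta]>>%VS.

Definition sform (D : nat) (x y : 'rV['F_2]_D) : 'F_2 :=
  \sum_(i < D) \sum_(j < D | (i.+1 == j)%N || (j.+1 == i)%N) x 0 i * y 0 j.

Definition E_parity (D : nat) (E : {vspace 'rV['F_2]_D}) (delta : bool)
    : {set 'rV['F_2]_D} :=
  [set x in (E :&: V_parity D delta)%VS].

(* Z^! inside V_D^delta, for Z a subset of V_D^(1 - delta). *)
Definition orth (D : nat) (delta : bool) (Z : {set 'rV['F_2]_D})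
    : {set 'rV['F_2]_D} :=
  [set x in V_parity D delta | [forall y in Z, sform x y == 0]].

Definition subgroup_pair (D : nat) (delta : bool) (E : {vspace 'rV['F_2]_D})
    : {set 'rV['F_2]_D} * {set 'rV['F_2]_D} :=
  (E_parity E delta, orth delta (E_parity E (~~ delta))).

Definition F_V (D : nat) : seq {vspace 'rV['F_2]_D} :=
  [seq E_of D B | B <- S_ D].

(** * The vector epsilon_D *)

(* The set [1, D] together with the symbol a is 'I_D.+1, where ord0 is a. *)
Definition e_bar (D : nat) (j : 'I_D.+1) : 'rV['F_2]_D :=
  if j == ord0 then e_itv D (1, D)%N else e D j.

Definition nitv_star (D : nat) (J : nitv) : {set 'I_D.+1} :=
  let X := [set j : 'I_D.+1 | mem_nitv J j] in
  if odd (nitv_size J) then X else ~: X.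

Definition star (D : nat) (C : {fset nitv}) : {set {set 'I_D.+1}} :=
  [set:: [seq nitv_star D J | J <- C]].

Section Epsilon.
Variables (D : nat) (C : {fset nitv}).

Definition n_mem (j : 'I_D.+1) : nat := #|[set X in star D C | j \in X]|.

Definition bracket : {set 'I_D.+1} := \bigcup_(X in star D C | ord0 \in X) X.

Definition in_bracket (i : nat) : bool := [exists j in bracket, val j == i].

(* The numbers l and l' such that the bracket, when nonempty, consists of a,
   [1, l] and [l', D]. *)
Definition bracket_l : nat :=
  (\max_(m < D.+1 | all in_bracket (index_iota 1 m.+1)) m)%N.
Definition bracket_l' : nat :=
  (D.+1 - \max_(m < D.+1 | all in_bracket (index_iota (D.+1 - m) D.+1)) m)%N.

Definition bracket_u (j : 'I_D.+1) : nat :=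
  if (bracket_l' <= j)%N then bracket_l' else bracket_l.

Definition eps_coef (j : 'I_D.+1) : nat :=
  let n := n_mem j in
  if [&& odd D, j != ord0, j \in bracket & odd (bracket_u j) == odd j]
  then (n.+1 * n.+2)%N./2 else (n * n.+1)%N./2.

Definition epsilon : 'rV['F_2]_D :=
  \sum_(j < D.+1) (eps_coef j)%:R *: e_bar j.

End Epsilon.

(** * The functions u and u~ *)

Section UTilde.
Variables (D : nat) (v : 'rV['F_2]_D).

Definition supp (i : nat) : bool :=
  [exists j : 'I_D, (j.+1 == i) && (v 0 j != 0)].

Definition u_fun : int :=
  \sum_(J <- runs D supp | odd J.1 != odd J.2) (-1) ^+ J.1.

Definition u_tilde : nat :=
  let u := u_fun in
  if ~~ odd D then (if 0 <= u then absz (2 * u)%R else absz (- 2 * u - 1)%R)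
  else if 0 < u then absz (2 * u - 1)%R
  else if u < 0 then absz (- 2 * u + 1)%R
  else 0%N.

End UTilde.

(** * Types B, C *)

Definition pairs_BC (D : nat) : seq ({fset nitv} * nat) :=
  [seq (B, k) | B <- S_ D, k <- iota 0 (D./2 - #|` B|).+1].

Definition alpha_BC (D : nat) (delta : bool) (v : 'rV['F_2]_D) :=
  omap (fun p => subgroup_pair delta (E_of D p.1))
    (ohead [seq p <- pairs_BC D | epsilon D (Bk D p.1 p.2) == v]).

Definition data_BC (D : nat) (delta : bool) : family_data :=
  @FamilyData 'rV['F_2]_D 'rV['F_2]_D
    [set: 'rV['F_2]_D]
    (fun gamma => [set v | u_tilde v == gamma])
    [seq subgroup_pair delta E | E <- F_V D]
    (@alpha_BC D delta).

(** * Type D *)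

Definition eta (D : nat) : 'rV['F_2]_D := \sum_(1 <= i < D.+1 | odd i) e D i.

(* V_D / F eta_D as a quotient of additive groups; [<[eta D]>] is the line
   spanned by eta_D. *)
Notation V' D := (coset_of <[eta D]>%g).

Definition pi_D (D : nat) (v : 'rV['F_2]_D) : V' D := coset <[eta D]>%g v.

Definition subgroup_pair_D (D : nat) (E : {vspace 'rV['F_2]_D})
    : {set V' D} * {set V' D} :=
  let h := subgroup_pair true E in (@pi_D D @: h.1, @pi_D D @: h.2).

(* The inverse of the restriction of pi_D to V_{D-1}, followed by the inclusion
   of V_{D-1} in V_D. *)
Definition pi_D_section (D : nat) (x : V' D) : 'rV['F_2]_D :=
  odflt 0 [pick w | (w \in <<[seq e D i | i <- iota 1 D.-1]>>%VS)
                    && (pi_D w == x)].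

Definition u_tilde' (D : nat) (x : V' D) : nat := u_tilde (pi_D_section x).

Definition pairs_D (D : nat) : seq ({fset nitv} * nat) :=
  let k_ok (B : {fset nitv}) k :=
    odd k && (k <= (D - 2 * #|` B| - 1)./2)%N in
  [seq p <- [seq (B, k) | B <- S_ D.-1, k <- iota 0 D.+1] |
     (p.2 == 0%N) || k_ok p.1 p.2] ++
  [seq p <- [seq (B, k) | B <- S_ D, k <- iota 0 D.+1] |
     [&& p.1 \notin S_ D.-1, (#|` p.1| < D.-1./2)%N & k_ok p.1 p.2]].

Definition alpha_D (D : nat) (x : V' D) :=
  omap (fun p => subgroup_pair_D (E_of D p.1))
    (ohead [seq p <- pairs_D D | pi_D (epsilon D (Bk D p.1 p.2)) == x]).

Definition data_D (D : nat) : family_data :=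
  @FamilyData (V' D) (V' D)
    [set: V' D]
    (fun gamma => [set x | u_tilde' x == gamma])
    [seq subgroup_pair_D E | E <- F_V D]
    (@alpha_D D).

(** * The set M(Gamma) of a finite group *)

Section MGamma.
Variables (gT : finGroupType) (G : {group gT}).
Local Open Scope group_scope.

(* An irreducible representation is given by the index of its character. *)
Definition Mpair : finType := {x : gT & Iirr 'C_G[x]}.

Definition Mpair_conj : rel Mpair := fun p q =>
  [exists g in G, (tag q == tag p ^ g) &&
    [forall y in 'C_G[tag p],
      'chi[_]_(tagged q) (y ^ g) == 'chi[_]_(tagged p) y]].

Definition MGamma : {set {set Mpair}} :=
  equivalence_partition Mpair_conj [set p | tag p \in G].

(* The elements of M(Gamma) that are the class of (x, rho), where rho is the
   irreducible representation of 'C_G[x] with character l.2 and x = l.1.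
   There is one if l.2 restricts to an irreducible character of 'C_G[x] and
   none otherwise. *)
Definition Mclass (l : gT * (gT -> algC)) : {set {set Mpair}} :=
  [set m in MGamma | [exists p in m, (tag p == l.1) &&
    [forall y in 'C_G[l.1], 'chi[_]_(tagged p) y == l.2 y]]].

Definition Mclasses (L : seq (gT * (gT -> algC))) : {set {set Mpair}} :=
  \bigcup_(l <- L) Mclass l.

End MGamma.

(** * Exceptional types *)

(* The symmetric group S_n, n = m + 1, acts on {0, ..., m}.  *)
Section SymmetricGroup.
Variable m : nat.
Local Notation Sn := 'S_m.+1.
Implicit Types y g : Sn.

Definition tr (i j : nat) : Sn := tperm (inord i) (inord j).

Definition g1 : Sn := 1%g.
Definition g2 : Sn := tr 0 1.
Definition g2' : Sn := (tr 0 1 * tr 2 3)%g.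
Definition g3 : Sn := (tr 0 1 * tr 1 2)%g.
Definition g4 : Sn := (g3 * tr 2 3)%g.
Definition g5 : Sn := (g4 * tr 3 4)%g.
Definition g6 : Sn := (g3 * tr 3 4)%g.

Definition points (s : seq nat) : {set 'I_m.+1} := [set:: map inord s].

Definition H_ (k : nat) : {set Sn} := perm.Sym [set i : 'I_m.+1 | (i < k)%N].
Definition H22 : {set Sn} :=
  (perm.Sym (points [:: 0; 1]%N) * perm.Sym (points [:: 2; 3]%N))%g.
Definition H23 : {set Sn} :=
  (perm.Sym (points [:: 0; 1]%N) * perm.Sym (points [:: 2; 3; 4]%N))%g.
Definition H8 : {set Sn} := <<H22 :|: [set (tr 0 2 * tr 1 3)%g]>>%g.
Definition H1 : {set Sn} := 1%g.

(* Characters of centralizers, as functions on S_n. *)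
Definition c1 y : algC := 1.
Definition c_sgn y : algC := (-1) ^+ odd_perm y.
(* The reflection representation, its exterior square, and the constituent
   other than 1 and itself of its symmetric square: this last one is sigma for
   S_4 and nu for S_5. *)
Definition c_refl y : algC := #|[set i | y i == i]|%:R - 1.
Definition c_ext2 y : algC := (c_refl y ^+ 2 - c_refl (y * y)%g) / 2.
Definition c_sym2 y : algC :=
  (c_refl y ^+ 2 + c_refl (y * y)%g) / 2 - 1 - c_refl y.

Definition c_mul (f g : Sn -> algC) y : algC := f y * g y.

(* On 'C[g2] = S_2 x S_{n-2}: the sign character of the factor S_2, the sign
   character of S_{n-2}, and (for n = 5) the reflection representation of
   S_3. *)
Definition c_s2 y : algC := if y (inord 0) == inord 0 then 1 else -1.
Definition c_sgn_rest y : algC := c_mul c_sgn c_s2 y.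
Definition c_r3 y : algC :=
  #|[set i in points [:: 2; 3; 4]%N | y i == i]|%:R - 1.

(* On the dihedral group 'C[g2']: its irreducible character of degree 2, and
   its linear character with kernel H22. *)
Definition c_r8 y : algC :=
  if y == 1%g then 2 else if y == g2' then -2 else 0.
Definition c_H22 y : algC :=
  if y (inord 0) \in points [:: 0; 1]%N then 1 else -1.

(* For g = g3, g4, g5 or g6: the linear character of 'C[g] sending y to a ^+ k
   when y acts as g ^+ k on the g-orbit of 0. *)
Definition c_rot (g : Sn) (a : algC) y : algC :=
  a ^+ findex g (inord 0) (y (inord 0)).

End SymmetricGroup.

Arguments c1 {m}.
Arguments c_sgn {m}.
Arguments c_refl {m}.
Arguments c_ext2 {m}.
Arguments c_sym2 {m}.
Arguments c_s2 {m}.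
Arguments c_sgn_rest {m}.
Arguments c_r3 {m}.
Arguments c_r8 {m}.
Arguments c_H22 {m}.
Arguments g1 {m}.
Arguments g2 {m}.
Arguments g2' {m}.
Arguments g3 {m}.
Arguments g4 {m}.
Arguments g5 {m}.
Arguments g6 {m}.
Arguments H_ {m}.
Arguments H22 {m}.
Arguments H23 {m}.
Arguments H8 {m}.
Arguments H1 {m}.

(* A label (x, f) of an element of M(S_n), see [Mclass]. *)
Definition label (m : nat) : Type := ('S_m.+1 * ('S_m.+1 -> algC))%type.

Definition table_row (m : nat) : Type :=
  (({set 'S_m.+1} * {set 'S_m.+1}) * seq (label m))%type.

Definition M_S (m : nat) := MGamma [set: 'S_m.+1]%G.
Definition classes_of (m : nat) (L : seq (label m)) :=
  Mclasses [set: 'S_m.+1]%G L.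

(* The set of elements of M(S_n) outside the given union of series. *)
Definition others (m : nat) (L : seq (label m)) := M_S m :\: classes_of L.

(* One singleton series for each label in the list. *)
Definition alone (m : nat) (L : seq (label m)) :=
  [seq classes_of [:: l] | l <- L].

Definition alpha_table (m : nat) (T : seq (table_row m))
    (x : {set Mpair [set: 'S_m.+1]%G}) :=
  omap fst (ohead [seq r <- T | x \in classes_of r.2]).

Definition data_exc (m : nat) (T : seq (table_row m))
    (series : seq {set {set Mpair [set: 'S_m.+1]%G}}) : family_data :=
  @FamilyData 'S_m.+1 {set Mpair [set: 'S_m.+1]%G}
    (M_S m)
    (nth set0 series)
    (unzip1 T)
    (alpha_table T).

Section S1.
Definition table_S1 : seq (table_row 0) := [:: ((H1, H1), [:: (g1, c1)])].
Definition series_S1 := [:: M_S 0].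
End S1.

Section S2.
Local Notation L := (label 1).
Let l11 : L := (g1, c1).
Let l1e : L := (g1, c_sgn).
Let g21 : L := (g2, c1).
Let g2e : L := (g2, c_sgn).

Definition table_S2 : seq (table_row 1) :=
  [:: ((H1, H_ 2), [:: l11; g2e]);
      ((H_ 2, H_ 2), [:: g21]);
      ((H1, H1), [:: l1e])].

Definition series_S2_card3 :=
  [:: classes_of [:: l11; g21; l1e]; classes_of [:: g2e]].
Definition series_S2_card2 :=
  [:: classes_of [:: l11; g21]; classes_of [:: g2e]; classes_of [:: l1e]].
End S2.

Section S3.
Variable theta : algC.
Local Notation L := (label 2).
Let l11 : L := (g1, c1).
Let l1r : L := (g1, c_refl).
Let l1e : L := (g1, c_sgn).
Let g21 : L := (g2, c1).
Let g2e : L := (g2, c_sgn).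
Let g31 : L := (g3, c1).
Let g3t (j : nat) : L := (g3, c_rot g3 (theta ^+ j)).

Definition table_S3 : seq (table_row 2) :=
  [:: ((H1, H_ 3), [:: l11; g3t 1; g3t 2]);
      ((H_ 3, H_ 3), [:: g31]);
      ((H1, H_ 2), [:: l1r; g2e]);
      ((H_ 2, H_ 2), [:: g21]);
      ((H1, H1), [:: l1e])].

Definition series_S3_card5 :=
  let s := [:: g3t 1; g3t 2; g2e] in others s :: alone s.
Definition series_S3_card4 :=
  let s := [:: g3t 1; g3t 2; g2e; l1e] in others s :: alone s.
End S3.

Section S4.
Variables im theta : algC.
Local Notation L := (label 3).
Let l11 : L := (g1, c1).
Let l1l1 : L := (g1, c_refl).
Let l1l2 : L := (g1, c_ext2).
Let l1l3 : L := (g1, c_sgn).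
Let l1s : L := (g1, c_sym2).
Let g21 : L := (g2, c1).
(* On 'C[g2] = <tr 0 1> x <tr 2 3>: epsilon' is trivial on the second factor
   only, epsilon'' on the first one only, epsilon on neither. *)
Let g2e' : L := (g2, c_s2).
Let g2e'' : L := (g2, c_sgn_rest).
Let g2e : L := (g2, c_mul c_s2 c_sgn_rest).
Let g2'1 : L := (g2', c1).
(* On 'C[g2']: epsilon' is the restriction of the sign of S_4, epsilon'' has
   kernel H22, and epsilon is their product. *)
Let g2'r : L := (g2', c_r8).
Let g2'e' : L := (g2', c_sgn).
Let g2'e'' : L := (g2', c_H22).
Let g2'e : L := (g2', c_mul c_sgn c_H22).
Let g31 : L := (g3, c1).
Let g3t (j : nat) : L := (g3, c_rot g3 (theta ^+ j)).
Let g4c (a : algC) : L := (g4, c_rot g4 a).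

Definition table_S4 : seq (table_row 3) :=
  [:: ((H1, H_ 4), [:: l11; g4c im; g4c (- im)]);
      ((H_ 4, H_ 4), [:: g4c 1]);
      ((H22, H8), [:: g2'1; g4c (-1)]);
      ((H8, H8), [:: g2'e']);
      ((H1, H22), [:: l1s; g2e'; g2'e]);
      ((H_ 2, H22), [:: g21; g2'r]);
      ((H22, H22), [:: g2'e'']);
      ((H1, H_ 3), [:: l1l1; g3t 1; g3t 2]);
      ((H_ 3, H_ 3), [:: g31]);
      ((H1, H_ 2), [:: l1l2; g2e]);
      ((H_ 2, H_ 2), [:: g2e'']);
      ((H1, H1), [:: l1l3])].

Definition series_S4 :=
  let s := [:: g4c im; g4c (- im); g3t 1; g3t 2; g2'e; g2e; l1l3] in
  let s' := [:: g2e'; g2'r; g4c (-1)] in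
  [:: others (s ++ s'), classes_of s' & alone s].
End S4.

Section S5.
Variables im theta zeta : algC.
Local Notation L := (label 4).
Let l11 : L := (g1, c1).
Let l1l1 : L := (g1, c_refl).
Let l1l2 : L := (g1, c_ext2).
Let l1l3 : L := (g1, c_mul c_sgn c_refl).
Let l1l4 : L := (g1, c_sgn).
Let l1n : L := (g1, c_sym2).
Let l1n' : L := (g1, c_mul c_sgn c_sym2).
(* On 'C[g2] = S_2 x S_3: 1, r, epsilon are the irreducible characters of S_3,
   and a minus sign is the sign of S_2. *)
Let g21 : L := (g2, c1).
Let g2N1 : L := (g2, c_s2).
Let g2r : L := (g2, c_r3).
Let g2Nr : L := (g2, c_mul c_s2 c_r3).
Let g2e : L := (g2, c_sgn_rest).
Let g2Ne : L := (g2, c_mul c_s2 c_sgn_rest).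
Let g2'1 : L := (g2', c1).
Let g2'r : L := (g2', c_r8).
Let g2'e' : L := (g2', c_sgn).
Let g2'e'' : L := (g2', c_H22).
Let g2'e : L := (g2', c_mul c_sgn c_H22).
Let g31 : L := (g3, c1).
Let g3t (j : nat) : L := (g3, c_rot g3 (theta ^+ j)).
(* On 'C[g3] = <g3> x S_2, epsilon is the sign of the factor S_2. *)
Let g3e : L := (g3, c_sgn).
Let g3et (j : nat) : L := (g3, c_mul c_sgn (c_rot g3 (theta ^+ j))).
Let g4c (a : algC) : L := (g4, c_rot g4 a).
Let g5z (j : nat) : L := (g5, c_rot g5 (zeta ^+ j)).
(* The characters of the cyclic group 'C[g6] are named by their value at g6;
   c_sgn g6 = -1. *)
Let g61 : L := (g6, c1).
Let g6N1 : L := (g6, c_sgn).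
Let g6t (j : nat) : L := (g6, c_rot g6 (theta ^+ j)).
Let g6Nt (j : nat) : L := (g6, c_mul c_sgn (c_rot g6 (theta ^+ j))).

Definition table_S5 : seq (table_row 4) :=
  [:: ((H1, H_ 5), [:: l11; g5z 1; g5z 2; g5z 3; g5z 4]);
      ((H_ 5, H_ 5), [:: g5z 0]);
      ((H1, H_ 4), [:: l1l1; g4c im; g4c (- im)]);
      ((H_ 4, H_ 4), [:: g4c 1]);
      ((H1, H23), [:: l1n; g2N1; g3t 1; g3t 2; g6Nt 1; g6Nt 2]);
      ((H_ 2, H23), [:: g21; g6t 1; g6t 2]);
      ((H_ 3, H23), [:: g31; g6N1]);
      ((H23, H23), [:: g61]);
      ((H22, H8), [:: g2'1; g4c (-1)]);
      ((H8, H8), [:: g2'e']);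
      ((H1, H22), [:: l1n'; g2Nr; g2'e]);
      ((H_ 2, H22), [:: g2r; g2'r]);
      ((H22, H22), [:: g2'e'']);
      ((H1, H_ 3), [:: l1l2; g3et 1; g3et 2]);
      ((H_ 3, H_ 3), [:: g3e]);
      ((H1, H_ 2), [:: l1l3; g2Ne]);
      ((H_ 2, H_ 2), [:: g2e]);
      ((H1, H1), [:: l1l4])].

Definition series_S5 :=
  let s := [:: g5z 1; g5z 2; g5z 3; g5z 4; g4c im; g4c (- im);
               g6Nt 1; g6Nt 2; g3et 1; g3et 2; g2'e; g2Ne; l1l4] in
  let s1 := [:: g3t 1; g6t 1] in
  let s2 := [:: g3t 2; g6t 2] in
  let s3 := [:: g2N1; g2Nr; g2'r; g4c (-1); g6N1] in
  [:: others (s ++ s1 ++ s2 ++ s3), classes_of s1, classes_of s2,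
      classes_of s3 & alone s].
End S5.

(** * All families *)

(* The possible data attached to a family c of the Weyl group of a split
   simple group.  The suffix of an exceptional family is the symmetric group
   G_c, followed where needed by the number |c| of irreducible representations
   in the family. *)
Inductive family_case : Type :=
  | FamA
  | FamBC (D : nat) (D_even : ~~ odd D) (delta : bool)
  | FamD (D : nat) (D_odd : odd D)
  | FamS1 | FamS2_3 | FamS2_2 | FamS3_5 | FamS3_4 | FamS4 | FamS5.

(* im, theta, zeta: primitive roots of 1 of order 4, 3, 5.  In type A the group
   G_c is trivial and everything is as for S_1. *)
Definition data_of (im theta zeta : algC) (c : family_case) : family_data :=
  match c with
  | FamA | FamS1 => data_exc table_S1 series_S1
  | FamBC D _ delta => data_BC D delta
  | FamD D _ => data_D D
  | FamS2_3 => data_exc table_S2 series_S2_card3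
  | FamS2_2 => data_exc table_S2 series_S2_card2
  | FamS3_5 => data_exc (table_S3 theta) (series_S3_card5 theta)
  | FamS3_4 => data_exc (table_S3 theta) (series_S3_card4 theta)
  | FamS4 => data_exc (table_S4 im theta) (series_S4 im theta)
  | FamS5 => data_exc (table_S5 im theta zeta) (series_S5 im theta zeta)
  end.

(* Main.v *)
Require Import Defs.
From mathcomp Require Import all_boot all_order all_algebra all_fingroup.
From mathcomp Require Import all_solvable all_field all_character.
From mathcomp Require Import finmap zify.

Set Implicit Arguments.
Unset Strict Implicit.
Unset Printing Implicit Defensive.

Import Order.TTheory GRing.Theory Num.Theory.

Local Open Scope fset_scope.
Local Open Scope nat_scope.

(** Types B, C, D.  For x in [1, D+1] let the edge x separate the positions
    x - 1 and x, and read an interval [a, b] as an arc joining the edges a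
    and b + 1.  Then a set B in S_D is a noncrossing arc diagram whose arcs join
    edges of opposite parity and cover no free (unmatched) edge: the map t_i
    inserts an arc joining two new consecutive edges ([S_arc_diagram]).  The
    intervals I_1, ..., I_Delta are the gaps between consecutive free edges
    x_0 < ... < x_Delta ([I_list_steps]), and B(k) adds to B nested arcs joining
    x_c to x_(Delta - c) (D even) or x_(Delta - 1 - c) (D odd), for c < k
    ([Bk_perm]).

    The point is that u depends only on where a vector jumps: 2 u(v) is the
    sum of (-1)^x over the edges x at which the coordinates v_(x-1) and v_x
    differ ([u_fun_jumps]).  For the vector v = epsilon_D attached to B(k), both
    ends of an arc of B are jumps or neither is ([jump_arc]), and their signs
    are opposite, so they cancel.  Next to a free edge n_j only depends on the
    number of free edges passed ([jump_free]), and the sum gives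
    u(v) = (-1)^k ceil(k/2) for every B ([u_fun_epsilon]).  So for D even
    u~(v) = k.  For D odd the representative of v in V_(D-1) is v or v + eta_D;
    adding eta_D changes the sign of u ([u_fun_eta]), and which of the two
    occurs depends on B alone ([supp_last]), so again u~' and B determine k.

    It remains to see that a pair of subgroups determines B.  A vector
    lies in E_B if and only if its jumps agree at the two ends of each arc and
    vanish at the free edges ([boundary_of_E], [mem_E_of_boundary]).  Hence E_B
    is the sum of its two parity parts, and B is the set of the intervals I
    with e_I in E_B ([arc_of_E]).  The parity part E^(1-delta) is recovered from
    its orthogonal because the form is nondegenerate where needed ([orth_sub]).
    In type D the pair is only known modulo eta_D, and an interval with
    e_I + eta_D in E_B would make all free edges ends of I ([free_of_eta]);
    comparing two diagrams that occur excludes this ([subgroup_pair_D_inj]).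

    Exceptional types.  A label describes at most one element of M(S_n)
    ([Mclass_eq]), and the pairs of subgroups that head the rows of a table
    are pairwise distinct ([heads_S4], [heads_S5]).  In the big series each
    row keeps at most its first label ([others_transversal]); the labels of a
    listed series lie in pairwise different rows, and alpha takes them to
    these rows since they differ from all labels of the rows above
    ([listed_transversal], [alpha_first]). *)

(** * Arc diagrams *)

(** The arcs of J and K have no common end and do not cross. *)
Definition apart (J K : nitv) : Prop :=
  [\/ J.2.+1 < K.1, K.2.+1 < J.1, J.1 < K.1 /\ K.2 < J.2 |
      K.1 < J.1 /\ J.2 < K.2].

Definition is_end (B : {fset nitv}) (x : nat) : bool :=
  has (fun J : nitv => (x == J.1) || (x == J.2.+1)) B.

(** [J.1, J.2] is the arc from the edge J.1 to the edge J.2 + 1, so that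
    [ad_parity] says that the ends of an arc have opposite parities, and
    [ad_covered] that no free edge lies strictly under an arc. *)
Record arc_diagram (D : nat) (B : {fset nitv}) : Prop := ArcDiagram {
  ad_bounds : forall J : nitv, J \in B -> [/\ 0 < J.1, J.1 <= J.2 & J.2 <= D];
  ad_parity : forall J : nitv, J \in B -> odd J.1 = odd J.2;
  ad_apart : forall J K : nitv, J \in B -> K \in B -> J <> K -> apart J K;
  ad_covered : forall (J : nitv) x, J \in B -> J.1 < x <= J.2 -> is_end B x
}.

Lemma is_endP (B : {fset nitv}) x :
  reflect (exists2 J : nitv, J \in B & x = J.1 \/ x = J.2.+1) (is_end B x).
Proof.
apply: (iffP hasP) => -[J JB H]; exists J => //.
- by case/orP: H => /eqP; [left|right].
- by apply/orP; case: H => /eqP; [left|right].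
Qed.

Lemma arc_diagram0 D : arc_diagram D fset0.
Proof. by split. Qed.

Lemma arc_diagram_widen D D' B :
  D <= D' -> arc_diagram D B -> arc_diagram D' B.
Proof.
move=> le [b p a c]; split=> // J JB.
by have [? ? ?] := b _ JB; split; lia.
Qed.

Lemma t_cases i B J :
  J \in t_ i B -> J = (i, i) \/ exists2 K : nitv, K \in B & J = xi i K.
Proof.
rewrite /t_ !inE => /orP[/eqP->|/imfsetP[K /= KB ->]]; first by left.
by right; exists K.
Qed.

Lemma xi_in_t i B K : K \in B -> xi i K \in t_ i B.
Proof. by move=> KB; rewrite !inE; apply/orP; right; apply/imfsetP; exists K. Qed.

(** On edges, xi_i is the increasing map that jumps over the edges i and i + 1,
    and these two are the ends of the new arc [i, i]. *)
Lemma arc_diagram_t D i B :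
  0 < i <= D.+2 -> arc_diagram D B -> arc_diagram D.+2 (t_ i B).
Proof.
move=> Hi [bd par ap cov]; split.
- move=> J /t_cases [->|[K /bd [] ? ? ? ->]]; rewrite /xi /=; first by split; lia.
  by case: ifP => ?; [|case: ifP => ?]; split=> /=; lia.
- move=> J /t_cases [->|[K /[dup] /bd [] ? ? ? /par ? ->]]; rewrite /xi //=.
  by case: ifP => ?; [|case: ifP => ?] => /=; lia.
- have new (K : nitv) : K \in B -> apart (i, i) (xi i K) /\ apart (xi i K) (i, i).
    move=> /bd [? ? ?]; rewrite /xi /apart.
    case: ifP => ?; [|case: ifP => ?] => /=.
    + by split; [apply: Or41|apply: Or42]; rewrite /=; lia.
    + by split; [apply: Or42|apply: Or41]; rewrite /=; lia.
    + by split; [apply: Or44|apply: Or43]; rewrite /=; lia.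
  move=> J K /t_cases [->|[J' J'B ->]] /t_cases [->|[K' K'B ->]] ne //.
  + by have [] := new _ K'B.
  + by have [] := new _ J'B.
  + have ne' : J' <> K' by move=> E; apply: ne; rewrite E.
    have [? ? ?] := bd _ J'B; have [? ? ?] := bd _ K'B.
    rewrite /apart; case: (ap _ _ J'B K'B ne') => H;
      [apply: Or41|apply: Or42|apply: Or43|apply: Or44]; rewrite /xi;
      repeat case: ifP => ? /=; lia.
- have hit (x y : nat) (K : nitv) : K \in B -> x = K.1 \/ x = K.2.+1 ->
      y = (if i <= x then x + 2 else x) -> is_end (t_ i B) y.
    move=> KB H ->; apply/is_endP; exists (xi i K); first exact: xi_in_t.
    have [? ? ?] := bd _ KB.
    by rewrite /xi; repeat case: ifP => ? /=; lia.
  move=> J x /t_cases [->|[K KB ->]] /=; first by lia.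
  have [? ? ?] := bd _ KB.
  have [xi1|xi1] := boolP ((x == i) || (x == i.+1)) => Hx.
    by apply/is_endP; exists (i, i); rewrite ?inE ?eqxx //=; lia.
  have : is_end B (if i <= x then x - 2 else x).
    apply: (cov K) => //; move: Hx; rewrite /xi.
    by repeat case: ifP => ? /=; lia.
  by case/is_endP => L LB HL; apply: (hit _ _ L LB HL); repeat case: ifP; lia.
Qed.

Lemma xi_parity i J : J.1 <= J.2 ->
  odd (nitv_size (xi i J)) = odd (nitv_size J).
Proof.
by rewrite /xi /nitv_size; case: ifP => ? ; [|case: ifP => ?] => /=; lia.
Qed.

Lemma mem_fset_of s J : (J \in fset_of s) = (J \in s).
Proof. by rewrite /fset_of inE. Qed.

(** The first interval of a nonempty primitive set has even size. *)
Lemma SS_prim_odd D B : B \in SS_prim D.+2 ->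
  {in B, forall J : nitv, odd (nitv_size J)} -> B = fset0.
Proof.
rewrite /SS_prim inE => /orP[/eqP -> //|].
have first_in k (f : nat -> nitv) :
    0 < k -> f 1 \in fset_of [seq f c | c <- iota 1 k].
  by case: k => // k _; rewrite mem_fset_of /= inE eqxx.
case: ifP => [ev|/negbFE od].
  case/mapP => k; rewrite mem_iota => Hk -> H.
  have /H := first_in k (fun c => (c, D.+3 - c)) ltac:(lia).
  by rewrite /nitv_size /=; lia.
rewrite mem_cat => /orP[] /mapP[k]; rewrite mem_filter mem_iota => Hk -> H.
- have /H := first_in k (fun c => (c, D.+2 - c)) ltac:(lia).
  by rewrite /nitv_size /=; lia.
- have /H := first_in k (fun c => (c.+1, D.+3 - c)) ltac:(lia).
  by rewrite /nitv_size /=; lia.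
Qed.

Lemma SS_step D : SS D.+2 =
  SS_prim D.+2 ++ [seq t_ i B | i <- iota 1 D.+2, B <- SS D].
Proof. by []. Qed.

Lemma SS_le_ends D (B : {fset nitv}) (J : nitv) :
  B \in SS D -> J \in B -> J.1 <= J.2.
Proof.
pose Q D := forall (B : {fset nitv}) (J : nitv),
  B \in SS D -> J \in B -> J.1 <= J.2.
(* SS is defined by a recursion of step two. *)
suff: Q D /\ Q D.+1 by case=> H _; exact: H.
elim: D {B J} => [|D [IH IH1]]; split=> //; try by move=> B J; rewrite inE => /eqP->.
- by move=> B J; rewrite !inE => /orP[] /eqP-> //; rewrite !inE => /eqP->.
- move=> B J; rewrite SS_step mem_cat => /orP[].
    rewrite /SS_prim inE => /orP[/eqP-> //|].
    case: ifP => [ev|/negbFE od].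
      case/mapP => k; rewrite mem_iota => Hk ->.
      by rewrite mem_fset_of => /mapP[c]; rewrite mem_iota => ? -> /=; lia.
    rewrite mem_cat => /orP[] /mapP[k]; rewrite mem_filter mem_iota => Hk ->;
    by rewrite mem_fset_of => /mapP[c]; rewrite mem_iota => ? -> /=; lia.
  case/allpairsP => -[i B'] [Hi /= B'S ->] /t_cases [-> //|[K KB ->]].
  have ? := IH _ _ B'S KB.
  by rewrite /xi; repeat case: ifP => ? /=; lia.
Qed.

Lemma SS_arc_diagram D B :
  B \in SS D -> {in B, forall J : nitv, odd (nitv_size J)} -> arc_diagram D B.
Proof.
pose Q D := forall B, B \in SS D ->
  {in B, forall J : nitv, odd (nitv_size J)} -> arc_diagram D B.
suff: Q D /\ Q D.+1 by case=> H _; exact: H.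
elim: D {B} => [|D [IH IH1]]; split=> //.
- by move=> B; rewrite inE => /eqP-> _; exact: arc_diagram0.
- move=> B; rewrite !inE => /orP[] /eqP-> _; first exact: arc_diagram0.
  split=> [J|J|J K|J x]; rewrite !inE => /eqP->; rewrite ?inE //=.
    by move=> /eqP->.
  by lia.
- move=> B; rewrite SS_step mem_cat => /orP[/SS_prim_odd H /H ->|].
    exact: arc_diagram0.
  case/allpairsP => -[i B'] [].
  rewrite mem_iota => Hi B'S -> od.
  apply: arc_diagram_t; first by lia.
  apply: IH => // J JB'; rewrite -(xi_parity i) ?(SS_le_ends B'S) //.
  exact/od/xi_in_t.
Qed.

Lemma S_arc_diagram D B : B \in S_ D -> arc_diagram D B.
Proof. by rewrite mem_filter => /andP[/allP od /SS_arc_diagram]; apply. Qed.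

Definition free_edges (D : nat) (B : {fset nitv}) : seq nat :=
  [seq x <- iota 1 D.+1 | ~~ is_end B x].

(** The number of arcs over the position j. *)
Definition depth (B : {fset nitv}) (j : nat) : nat :=
  count (fun J => mem_nitv J j) B.

(** The number of free edges to the left of the position j, edge j included. *)
Definition rank (D : nat) (B : {fset nitv}) (j : nat) : nat :=
  count (fun x => x <= j) (free_edges D B).

Lemma mem_free_edges D B x :
  (x \in free_edges D B) = (0 < x <= D.+1) && ~~ is_end B x.
Proof. by rewrite mem_filter mem_iota andbC; congr (_ && _); lia. Qed.

Lemma free_edges_sorted D B : sorted ltn (free_edges D B).
Proof. exact/(sorted_filter ltn_trans)/iota_ltn_sorted. Qed.

Lemma free_edges_uniq D B : uniq (free_edges D B).
Proof. exact/filter_uniq/iota_uniq. Qed.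

Lemma rank_end D B j : D < j -> rank D B j = size (free_edges D B).
Proof.
move=> Dj; apply/eqP; rewrite -all_count; apply/allP => x.
by rewrite mem_free_edges; lia.
Qed.

Lemma nth_le_count (s : seq nat) j i : sorted ltn s -> i < size s ->
  (nth 0 s i <= j) = (i < count (fun x => x <= j) s).
Proof.
elim: s i => //= x s IH i; rewrite (path_sortedE ltn_trans) => /andP[/allP gt st].
case: i => [|i] /= Hi.
  case: (leqP x j) => //= lt; rewrite add0n; apply/esym/negbTE; rewrite -leqNgt leqn0.
  by rewrite -leqn0 leqNgt -has_count; apply/hasPn => y /gt; lia.
rewrite IH //; case: (leqP x j) => //= lt; rewrite add0n.
have -> : count (fun x => x <= j) s = 0.
  by apply/eqP; rewrite -leqn0 leqNgt -has_count; apply/hasPn => y /gt; lia.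
by [].
Qed.

Section Diagram.
Variables (D : nat) (B : {fset nitv}).
Hypothesis dB : arc_diagram D B.

Lemma edge_inj (J K : nitv) : J \in B -> K \in B ->
  [\/ J.1 = K.1, J.2.+1 = K.2.+1, J.1 = K.2.+1 | J.2.+1 = K.1] -> J = K.
Proof.
move=> JB KB H; have [//|/eqP ne] := eqVneq J K.
have [? ? ?] := ad_bounds dB JB; have [? ? ?] := ad_bounds dB KB.
have := ad_apart dB JB KB ne.
by case: H => H -[]; lia.
Qed.

(** Each edge is free or is an end of exactly one arc. *)
Lemma edges_perm : perm_eq (iota 1 D.+1)
  (free_edges D B ++ [seq J.1 | J : nitv <- B] ++ [seq J.2.+1 | J : nitv <- B]).
Proof.
apply: uniq_perm; first exact: iota_uniq.
  rewrite !cat_uniq free_edges_uniq /= !map_inj_in_uniq ?fset_uniq /=.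
  - apply/and3P; split=> //.
      apply/hasPn => x; rewrite mem_cat /= mem_free_edges negb_and negbK.
      by move=> /orP[] /mapP[J JB ->]; apply/orP; right; apply/is_endP;
         exists J; auto.
    apply/hasPn => x /mapP[J JB ->]; apply/negP => /mapP[K KB E].
    have EJ : J = K by apply: edge_inj => //; apply: Or44.
    by have [] := ad_bounds dB JB; rewrite -EJ in E; lia.
  - by move=> J K JB KB /= E; apply: edge_inj => //; apply: Or42.
  - by move=> J K JB KB /= E; apply: edge_inj => //; apply: Or41.
move=> x; rewrite !mem_cat mem_free_edges mem_iota.
have -> : is_end B x =
    (x \in [seq J.1 | J : nitv <- B]) || (x \in [seq J.2.+1 | J : nitv <- B]).
  apply/is_endP/orP => [[J JB [->|->]]|[] /mapP[J JB ->]].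
  - by left; apply: map_f.
  - by right; apply: (map_f (fun J : nitv => J.2.+1)).
  - by exists J; auto.
  - by exists J; auto.
suff: forall y : nat, (0 < y < 1 + D.+1) = (0 < y <= D.+1) &&
    ~~ ((y \in [seq J.1 | J : nitv <- B]) || (y \in [seq J.2.+1 | J : nitv <- B]))
    || ((y \in [seq J.1 | J : nitv <- B]) || (y \in [seq J.2.+1 | J : nitv <- B])).
  by apply.
move=> y; case: (boolP ((y \in _) || (y \in _))) => [H|_]; last first.
  by rewrite andbT orbF; lia.
rewrite orbT; case/orP: H => /mapP[J /(ad_bounds dB)[? ? ?] ->]; lia.
Qed.

Lemma size_free_edges : size (free_edges D B) + 2 * #|` B| = D.+1.
Proof.
have /perm_size := edges_perm; rewrite !size_cat !size_map size_iota.
by rewrite mul2n -addnn => <-.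
Qed.

(** Among the edges 1, ..., j count the free edges, the left ends of arcs and
    the right ends: depth is the difference of the last two numbers. *)
Lemma depth_rank_parity j : j <= D.+1 ->
  odd (depth B j) = odd j (+) odd (rank D B j).
Proof.
move=> le; have /seq.permP /(_ (fun x => x <= j)) := edges_perm.
rewrite !count_cat !count_map.
have -> : count (leq^~ j) (iota 1 D.+1) = j.
  rewrite -[RHS]addn0.
  have -> : D.+1 = j + (D.+1 - j) by lia.
  rewrite iotaD count_cat; congr (_ + _).
    rewrite -[RHS](size_iota 1); apply/eqP; rewrite -all_count.
    by apply/allP => x; rewrite mem_iota; lia.
  apply/eqP; rewrite -leqn0 leqNgt -has_count; apply/hasPn => x.
  by rewrite mem_iota; lia.
have -> : count (preim (fun J : nitv => J.1) (fun x => x <= j)) B =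
    depth B j + count (preim (fun J : nitv => J.2.+1) (fun x => x <= j)) B.
  have: forall J : nitv, J \in enum_fset B -> J.1 <= J.2 by move=> J /(ad_bounds dB)[].
  rewrite /depth; elim: (enum_fset B) => //= J s IH H.
  rewrite IH; last by move=> K Ks; apply: H; rewrite inE Ks orbT.
  have := H J (mem_head _ _); rewrite /mem_nitv.
  by case: leqP => ? //=; case: leqP => ? //=; lia.
rewrite -/(rank D B j) => /(congr1 odd) ->; rewrite !oddD.
by case: (odd _); case: (odd _); case: (odd _).
Qed.

Lemma count_but_one (s : seq nitv) (P Q : pred nitv) (J : nitv) :
  uniq s -> J \in s -> (forall K : nitv, K \in s -> K <> J -> P K = Q K) ->
  count P s + Q J = count Q s + P J.
Proof.
move=> us Js H; have /seq.permP pe := perm_to_rem Js.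
rewrite !pe /=.
have -> : count P (rem J s) = count Q (rem J s).
  apply: eq_in_count => K; rewrite (mem_rem_uniq _ us) !inE => /andP[/eqP ? ?].
  exact: H.
by rewrite addnC addnA [RHS]addnAC.
Qed.

Lemma depth_change (J : nitv) i j : J \in B ->
  (forall K : nitv, K \in B -> K <> J -> mem_nitv K i = mem_nitv K j) ->
  depth B i + mem_nitv J j = depth B j + mem_nitv J i.
Proof. by move=> JB; apply: count_but_one (fset_uniq _) JB. Qed.

Lemma depth_left (J : nitv) : J \in B -> depth B J.1 = (depth B J.1.-1).+1.
Proof.
move=> JB; have [J0 J12 JD] := ad_bounds dB JB.
have := @depth_change J J.1 J.1.-1 JB; rewrite /mem_nitv => H.
suff: depth B J.1 + (J.1 <= J.1.-1 <= J.2) =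
      depth B J.1.-1 + (J.1 <= J.1 <= J.2) by lia.
apply: H => K KB ne; have [? ? ?] := ad_bounds dB KB.
by case: (ad_apart dB KB JB ne); lia.
Qed.

Lemma depth_right (J : nitv) : J \in B -> depth B J.2 = (depth B J.2.+1).+1.
Proof.
move=> JB; have [J0 J12 JD] := ad_bounds dB JB.
have := @depth_change J J.2 J.2.+1 JB; rewrite /mem_nitv => H.
suff: depth B J.2 + (J.1 <= J.2.+1 <= J.2) =
      depth B J.2.+1 + (J.1 <= J.2 <= J.2) by lia.
apply: H => K KB ne; have [? ? ?] := ad_bounds dB KB.
by case: (ad_apart dB KB JB ne); lia.
Qed.

(** The same arcs cover the two positions adjacent to an arc. *)
Lemma depth_outside (J : nitv) : J \in B -> depth B J.1.-1 = depth B J.2.+1.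
Proof.
move=> JB; have [J0 J12 JD] := ad_bounds dB JB.
have := @depth_change J J.1.-1 J.2.+1 JB; rewrite /mem_nitv => H.
suff: depth B J.1.-1 + (J.1 <= J.2.+1 <= J.2) =
      depth B J.2.+1 + (J.1 <= J.1.-1 <= J.2) by lia.
apply: H => K KB ne; have [? ? ?] := ad_bounds dB KB.
by case: (ad_apart dB KB JB ne); lia.
Qed.

Lemma free_edge_outside (J : nitv) x : J \in B -> x \in free_edges D B ->
  x < J.1 \/ J.2.+1 < x.
Proof.
move=> JB; rewrite mem_free_edges => /andP[_ /negP H].
have nH : ~~ (J.1 < x <= J.2) by apply/negP => /(ad_covered dB JB).
have n1 : x <> J.1 by move=> E; apply: H; apply/is_endP; exists J; auto.
have n2 : x <> J.2.+1 by move=> E; apply: H; apply/is_endP; exists J; auto.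
lia.
Qed.

Lemma depth0 j :
  (j \in free_edges D B) || (j.+1 \in free_edges D B) -> depth B j = 0.
Proof.
move=> H; apply/eqP; rewrite -leqn0 leqNgt -has_count; apply/hasPn => J JB.
rewrite /mem_nitv; case/orP: H => /(free_edge_outside JB); lia.
Qed.

Lemma rank_const (J : nitv) i j : J \in B -> J.1.-1 <= i <= J.2.+1 ->
  J.1.-1 <= j <= J.2.+1 -> rank D B i = rank D B j.
Proof.
move=> JB Hi Hj; apply: eq_in_count => x /(free_edge_outside JB).
by have [? ? ?] := ad_bounds dB JB; lia.
Qed.

Local Notation U := (free_edges D B).

Lemma nth_le_rank i j : i < size U -> (nth 0 U i <= j) = (i < rank D B j).
Proof. exact: nth_le_count (free_edges_sorted D B). Qed.

Lemma nth_free_bounds c : c < size U -> 0 < nth 0 U c <= D.+1.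
Proof. by move=> /(mem_nth 0); rewrite mem_free_edges => /andP[]. Qed.

Lemma nth_free_lt i j : i < j -> j < size U -> nth 0 U i < nth 0 U j.
Proof.
move=> ij Hj; apply: (sorted_ltn_nth ltn_trans 0 (free_edges_sorted D B)) => //.
by rewrite inE; lia.
Qed.

Lemma rank_le j : rank D B j <= size U.
Proof. exact: count_size. Qed.

Lemma rank_nth c : c < size U -> rank D B (nth 0 U c) = c.+1.
Proof.
move=> Hc; have := nth_le_rank (nth 0 U c) Hc; rewrite leqnn => /esym H1.
have := rank_le (nth 0 U c); rewrite leq_eqVlt => /orP[/eqP E|Hr].
  have := nth_le_rank (nth 0 U c) (i := (size U).-1) ltac:(lia).
  have [E'|ne] := eqVneq c (size U).-1; first lia.
  have := nth_free_lt (i := c) (j := (size U).-1) ltac:(lia) ltac:(lia).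
  lia.
have := nth_le_rank (nth 0 U c) Hr; rewrite ltnn.
have [E|ne] := eqVneq (rank D B (nth 0 U c)) c.+1 => //.
have := nth_le_rank (nth 0 U c) (i := c.+1) ltac:(lia).
have := nth_free_lt (i := c) (j := c.+1) ltac:(lia) ltac:(lia).
  lia.
Qed.

Lemma rank_nth_pred c : c < size U -> rank D B (nth 0 U c).-1 = c.
Proof.
move=> Hc; have := nth_free_bounds Hc => Hb.
have := nth_le_rank (nth 0 U c).-1 Hc => H1.
case: c Hc Hb H1 => [|c] Hc Hb H1; first lia.
have := nth_le_rank (nth 0 U c.+1).-1 (i := c) ltac:(lia).
have := nth_free_lt (i := c) (j := c.+1) ltac:(lia) ltac:(lia).
  lia.
Qed.

(** At a free edge the depth is zero, so the edges before it are free or paired. *)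
Lemma nth_free_parity c : c < size U -> odd (nth 0 U c) = ~~ odd c.
Proof.
move=> Hc; have /andP[_ le] := nth_free_bounds Hc.
have := depth_rank_parity le; rewrite (rank_nth Hc) depth0 ?mem_nth //=.
by case: (odd _); case: (odd _).
Qed.

End Diagram.

(** * Maximal intervals *)

Section Runs.
Variables (D : nat) (P : pred nat).

Lemma runsP (J : nitv) : reflect
  [/\ 0 < J.1, J.1 <= J.2, J.2 <= D, forall i, J.1 <= i <= J.2 -> P i &
      ~~ P J.1.-1 /\ ~~ P J.2.+1] (J \in runs D P).
Proof.
rewrite mem_filter; apply: (iffP andP).
  move=> [/and4P[le /allP al n1 n2] /allpairsP[[a b] /= [Ha Hb E]]].
  move: Ha Hb le al n1 n2; rewrite !mem_iota {}E /= => Ha Hb le al n1 n2.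
  by split=> // [|| i Hi]; [lia|lia|apply: al; rewrite mem_index_iota; lia].
move=> [H1 H2 H3 al [n1 n2]]; split.
  apply/and4P; split=> //; apply/allP => i; rewrite mem_index_iota => Hi.
  by apply: al; lia.
by case: J H1 H2 H3 {al n1 n2} => a b /= *; apply: allpairs_f; rewrite mem_iota; lia.
Qed.

Lemma runs_eq (J K : nitv) i : J \in runs D P -> K \in runs D P ->
  J.1 <= i <= J.2 -> K.1 <= i <= K.2 -> J = K.
Proof.
case: J K => a b [a' b'] /runsP[/= h1 h2 h3 h4 [h5 h6]].
move=> /runsP[/= k1 k2 k3 k4 [k5 k6]] Hi Hi'.
have n1 : ~ (a <= a'.-1 <= b) by move=> /h4 E; rewrite E in k5.
have n2 : ~ (a' <= a.-1 <= b') by move=> /k4 E; rewrite E in h5.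
have n3 : ~ (a <= b'.+1 <= b) by move=> /h4 E; rewrite E in k6.
have n4 : ~ (a' <= b.+1 <= b') by move=> /k4 E; rewrite E in h6.
by congr pair; lia.
Qed.

Lemma runs_uniq : uniq (runs D P).
Proof.
apply: filter_uniq; apply: allpairs_uniq; try exact: iota_uniq.
by move=> [? ?] [? ?] _ _ /= [-> ->].
Qed.

Lemma runs_inj1 (J K : nitv) :
  J \in runs D P -> K \in runs D P -> J.1 = K.1 -> J = K.
Proof.
move=> JR KR E; apply: (@runs_eq _ _ J.1 JR KR).
  by have [? ? ? _ _] := runsP _ JR; lia.
by have [? ? ? _ _] := runsP _ KR; lia.
Qed.

Lemma runs_inj2 (J K : nitv) :
  J \in runs D P -> K \in runs D P -> J.2.+1 = K.2.+1 -> J = K.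
Proof.
move=> JR KR E; apply: (@runs_eq _ _ J.2 JR KR).
  by have [? ? ? _ _] := runsP _ JR; lia.
by have [? ? ? _ _] := runsP _ KR; lia.
Qed.

Lemma allpairs_lex (s t : seq nat) : pairwise ltn s -> pairwise ltn t ->
  pairwise (fun J K : nitv => (J.1 < K.1) || (J.1 == K.1) && (J.2 < K.2))
    [seq (a, b) | a <- s, b <- t].
Proof.
move=> + pt; elim: s => //= a s IH /andP[/allP gt ps].
rewrite pairwise_cat IH // andbT; apply/andP; split.
  apply/allrelP => J K /mapP[b _ ->] /allpairsP[[a' b'] /= [/gt lt _ ->]] /=.
  by move: lt; rewrite /= => ->.
rewrite pairwise_map; apply: sub_pairwise pt => x y /= lt.
by rewrite eqxx lt orbT.
Qed.

Lemma runs_pairwise :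
  pairwise (fun J K : nitv => J.2.+1 < K.1) (runs D P).
Proof.
have pw : pairwise ltn (iota 1 D).
  by rewrite -(sorted_pairwise ltn_trans) iota_ltn_sorted.
have /(subseq_pairwise (filter_subseq _ _)) := allpairs_lex pw pw.
move=> /(_ _) H; apply: (sub_in_pairwise _ (allss (runs D P)) (H _)).
suff: forall J K : nitv, J \in runs D P -> K \in runs D P ->
    (J.1 < K.1) || (J.1 == K.1) && (J.2 < K.2) -> J.2.+1 < K.1.
  by move=> {}H J K; apply: H.
move=> {H} J K JR KR lex.
have [? ? ? hJ [? nJ]] := runsP _ JR; have [? ? ? hK [nK ?]] := runsP _ KR.
have ne : J <> K by move=> E; move: lex; rewrite E !ltnn eqxx.
have dis i : J.1 <= i <= J.2 -> K.1 <= i <= K.2 -> False.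
  by move=> HJ HK; apply: ne; apply: runs_eq HJ HK.
have := dis J.1; have := dis K.1.
have n1 : J.2.+1 <> K.1.
  by move=> E; move: nJ; rewrite E hK ?leqnn.
lia.
Qed.

Hypotheses (P0 : P 0 = false) (Pout : forall i, D < i -> P i = false).

(** The run of i ends at the first positions on its two sides where P fails. *)
Lemma run_at i : P i -> exists2 J : nitv, J \in runs D P & J.1 <= i <= J.2.
Proof.
move=> Pi.
have iD : i <= D by rewrite leqNgt; apply/negP => /Pout; rewrite Pi.
have exb : exists b, (i < b) && ~~ P b by exists D.+1; rewrite Pout //; lia.
have exa : exists m, (m <= i) && ~~ P (i - m).
  by exists i; rewrite subnn P0 leqnn.
case: (ex_minnP exb) => b /andP[ib nPb] bmin.
case: (ex_minnP exa) => m /andP[mi nPm] mmin.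
have m0 : m != 0 by apply: contraNneq nPm => ->; rewrite subn0.
have bD : b <= D.+1 by apply: bmin; rewrite Pout //; lia.
have Pin j : i - m < j < b -> P j.
  move=> Hj; apply/negPn/negP => nP; case: (leqP j i) => ji.
    have /mmin : (i - j <= i) && ~~ P (i - (i - j)).
      by rewrite subKn // nP andbT leq_subr.
    lia.
  have /bmin : (i < j) && ~~ P j by rewrite ji.
  lia.
exists ((i - m).+1, b.-1); last by rewrite /=; lia.
apply/runsP; split=> /=; try lia; first by move=> j Hj; apply: Pin; lia.
by split=> //; rewrite (_ : b.-1.+1 = b) //; lia.
Qed.

Lemma runs_starts : perm_eq [seq J.1 | J : nitv <- runs D P]
  [seq x <- iota 1 D.+1 | ~~ P x.-1 && P x].
Proof.
apply: uniq_perm; last 1 first.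
- move=> x; rewrite mem_filter mem_iota; apply/mapP/idP.
    move=> [J /runsP[? ? ? al [n1 n2]] ->].
    by rewrite n1 al ?leqnn //=; lia.
  move=> /andP[/andP[n1 Px] Hx]; have [J JR HJ] := run_at Px; exists J => //.
  have [J1 J2 JD al _] := runsP _ JR.
  apply/eqP; rewrite eqn_leq leqNgt; apply/andP; split; last by case/andP: HJ.
  by apply: contra n1 => lt; apply: al; lia.
- rewrite map_inj_in_uniq ?runs_uniq //; exact: runs_inj1.
- exact/filter_uniq/iota_uniq.
Qed.

Lemma runs_stops : perm_eq [seq J.2.+1 | J : nitv <- runs D P]
  [seq x <- iota 1 D.+1 | P x.-1 && ~~ P x].
Proof.
apply: uniq_perm; last 1 first.
- move=> x; rewrite mem_filter mem_iota; apply/mapP/idP.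
    move=> [J /runsP[? ? ? al [n1 n2]] ->].
    by rewrite n2 al ?leqnn //= ?andbT; lia.
  move=> /andP[/andP[Px n1] Hx]; have [J JR HJ] := run_at Px; exists J => //.
  have [J1 J2 JD al _] := runsP _ JR.
  have n : ~ (J.1 <= x <= J.2) by move=> /al E; rewrite E in n1.
  by apply/eqP; rewrite eqn_leq; lia.
- rewrite map_inj_in_uniq ?runs_uniq //; exact: runs_inj2.
- exact/filter_uniq/iota_uniq.
Qed.

End Runs.

(** * The sets B(k) *)

Definition gaps_between (lo : nat) (cs : seq nitv) (hi : nat) :=
  zip (lo :: [seq J.2.+1 | J <- cs]) (rcons [seq J.1 | J <- cs] hi).

(** The edges strictly inside the gaps.  A gap is stored as in [gaps], by its
    first position and the position after its last one. *)
Definition inner_edges (gs : seq (nat * nat)) : seq nat :=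
  flatten [seq index_iota g.1.+1 g.2 | g <- gs].

(** The intervals between consecutive edges of s. *)
Definition steps (s : seq nat) : seq nitv :=
  [seq (p.1, p.2.-1) | p <- zip s (behead s)].

Lemma gaps_between_cons lo (J : nitv) cs hi :
  gaps_between lo (J :: cs) hi = (lo, J.1) :: gaps_between J.2.+1 cs hi.
Proof. by []. Qed.

Lemma mem_inner_edges lo cs hi x :
  pairwise (fun J K : nitv => J.2.+1 < K.1) cs ->
  (forall J : nitv, J \in cs -> [/\ lo <= J.1, J.1 <= J.2 & J.2 < hi]) ->
  (x \in inner_edges (gaps_between lo cs hi)) =
  (lo < x < hi) && all (fun J : nitv => (x < J.1) || (J.2.+1 < x)) cs.
Proof.
elim: cs lo => [|J cs IH] lo /=.
  by move=> _ _; rewrite /inner_edges /= cats0 mem_index_iota andbT.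
move=> /andP[/allP gt pw] bd; rewrite gaps_between_cons.
have [b1 b2 b3] := bd J (mem_head _ _).
rewrite /inner_edges /= mem_cat mem_index_iota -/(inner_edges _) IH //; last first.
  move=> K Kcs; have := gt K Kcs; rewrite /= => lt.
  have [] := bd K; first by rewrite inE Kcs orbT.
  by move=> *; split=> //; lia.
case: (boolP (all _ cs)) => al; last first.
  rewrite !andbF orbF; apply/negbTE/negP => Hx; case/negP: al.
  by apply/allP => K /gt; rewrite /=; lia.
by rewrite !andbT; lia.
Qed.

Lemma inner_edges_sorted lo cs hi :
  pairwise (fun J K : nitv => J.2.+1 < K.1) cs ->
  (forall J : nitv, J \in cs -> [/\ lo <= J.1, J.1 <= J.2 & J.2 < hi]) ->
  sorted ltn (inner_edges (gaps_between lo cs hi)).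
Proof.
elim: cs lo => [|J cs IH] lo.
  by move=> _ _; rewrite /inner_edges /= cats0; apply: iota_ltn_sorted.
rewrite [pairwise _ _]/= => /andP[/allP gt pw] bd.
have [b1 b2 b3] := bd J (mem_head _ _).
have bd' : forall K : nitv, K \in cs -> [/\ J.2.+1 <= K.1, K.1 <= K.2 & K.2 < hi].
  move=> K Kcs; have := gt K Kcs; rewrite /= => lt.
  have [] := bd K; first by rewrite inE Kcs orbT.
  by move=> *; split=> //; lia.
rewrite gaps_between_cons /inner_edges [flatten _]/= -/(inner_edges _).
rewrite (sorted_pairwise ltn_trans) pairwise_cat -!(sorted_pairwise ltn_trans).
rewrite iota_ltn_sorted IH // !andbT; apply/allrelP => x y.
by rewrite mem_index_iota mem_inner_edges //=; lia.
Qed.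

Lemma steps_cat m n s : steps (iota m n.+1 ++ s) =
  [seq (j, j) | j <- iota m n] ++ steps (m + n :: s).
Proof.
elim: n m => [|n IH] m; first by rewrite addn0.
have -> : steps (iota m n.+2 ++ s) = (m, m) :: steps (iota m.+1 n.+1 ++ s).
  by [].
by rewrite IH addSnnS.
Qed.

(** Steps inside a gap are points, and the step from the last edge of a gap to
    the first edge of the next one is a block. *)
Lemma steps_gaps (W : seq (nat * nat)) : all (fun g => g.1 + 2 <= g.2) W ->
  perm_eq ([seq (p.1.2.-1, p.2.1) | p <- zip W (behead W)] ++
           [seq (j, j) | g <- W, j <- index_iota g.1.+1 g.2.-1])
          (steps (inner_edges W)).
Proof.
elim: W => // g W IH /= /andP[wg wW].
have {}IH := IH wW.
rewrite /inner_edges /= -/(inner_edges W).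
have -> : index_iota g.1.+1 g.2 = iota g.1.+1 (g.2 - g.1 - 2).+1.
  by rewrite /index_iota; congr iota; lia.
rewrite steps_cat.
have -> : index_iota g.1.+1 g.2.-1 = iota g.1.+1 (g.2 - g.1 - 2).
  by rewrite /index_iota; congr iota; lia.
rewrite perm_catCA perm_cat2l; case: W wW IH => [//|g' W] /= /andP[wg' _] IH.
suff -> : steps (g.1.+1 + (g.2 - g.1 - 2) :: inner_edges (g' :: W)) =
    (g.2.-1, g'.1) :: steps (inner_edges (g' :: W)) by rewrite /= perm_cons.
rewrite /inner_edges /=.
have -> : index_iota g'.1.+1 g'.2 = iota g'.1.+1 (g'.2 - g'.1 - 2).+1.
  by rewrite /index_iota; congr iota; lia.
by rewrite /steps /=; congr ((_, _) :: _); lia.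
Qed.

Lemma inner_edges_wide gs :
  inner_edges [seq g <- gs | g.1 + 2 <= g.2] = inner_edges gs.
Proof.
rewrite /inner_edges; elim: gs => //= g gs IH.
case: leqP => /= le; rewrite IH //.
by have -> : index_iota g.1.+1 g.2 = [::] by rewrite /index_iota (_ : _ - _ = 0) //; lia.
Qed.

(** Gaps with a single inner edge contribute no point. *)
Lemma flatten_points (gs : seq (nat * nat)) :
  [seq (j, j) | g <- [seq g <- gs | g.1 + 3 <= g.2], j <- index_iota g.1.+1 g.2.-1]
  = [seq (j, j) | g <- [seq g <- gs | g.1 + 2 <= g.2], j <- index_iota g.1.+1 g.2.-1].
Proof.
elim: gs => //= g gs IH.
case: (leqP (g.1 + 3) g.2) => h3 /=.
  by rewrite ifT /= ?IH //; lia.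
case: (leqP (g.1 + 2) g.2) => h2 //=.
by have -> : index_iota g.1.+1 g.2.-1 = [::]
  by rewrite /index_iota (_ : _ - _ = 0) //; lia.
Qed.

Section Steps.
Variables (D : nat) (B : {fset nitv}).
Hypothesis dB : arc_diagram D B.
Local Notation U := (free_edges D B).

Definition covered (B : {fset nitv}) (i : nat) : bool :=
  has (fun J => mem_nitv J i) B.

Lemma covered_in i : covered B i -> 0 < i <= D.
Proof. by case/hasP => J /(ad_bounds dB)[? ? ?]; rewrite /mem_nitv; lia. Qed.

Lemma covered0 : covered B 0 = false.
Proof. by apply/negP => /covered_in. Qed.

Lemma covered_out i : D < i -> covered B i = false.
Proof. by move=> lt; apply/negP => /covered_in; lia. Qed.

(** An edge is free if and only if both adjacent positions are uncovered. *)
Lemma mem_free_covered x :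
  (x \in U) = [&& 0 < x <= D.+1, ~~ covered B x.-1 & ~~ covered B x].
Proof.
apply/idP/idP => [xU|/and3P[Hx n1 n2]].
  have Hx : 0 < x <= D.+1 by move: xU; rewrite mem_free_edges => /andP[].
  rewrite Hx /covered !has_count -!leqNgt !leqn0.
  rewrite -!/(depth _ _) !(depth0 dB) ?xU ?orbT ?eqxx //.
  by rewrite prednK ?xU ?orbT; lia.
rewrite mem_free_edges Hx; apply/negP => /is_endP[J JB E].
have [? ? ?] := ad_bounds dB JB.
case: E => E; [case/negP: n2|case/negP: n1]; apply/hasP; exists J => //;
rewrite /mem_nitv; lia.
Qed.

Lemma inner_edges_gaps : inner_edges (gaps D B) = U.
Proof.
have pw := @runs_pairwise D (covered B).
have bd : forall J : nitv, J \in runs D (covered B) ->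
    [/\ 0 <= J.1, J.1 <= J.2 & J.2 < D.+2].
  by move=> J /runsP[? ? ? _ _]; split; lia.
rewrite -[gaps D B]/(gaps_between 0 (runs D (covered B)) D.+2).
apply: (irr_sorted_eq ltn_trans ltnn); first exact: inner_edges_sorted.
  exact: free_edges_sorted.
suff: forall x : nat,
    (x \in inner_edges (gaps_between 0 (runs D (covered B)) D.+2)) = (x \in U).
  by move=> H x; exact: H.
move=> x; rewrite mem_inner_edges // mem_free_covered.
have -> : (0 < x < D.+2) = (0 < x <= D.+1) by lia.
case: (boolP (0 < x <= D.+1)) => //= Hx; apply/allP/andP => [al|[n1 n2]].
  split; apply/negP => /(run_at covered0 covered_out)[J /al]; rewrite /=; lia.
suff: forall J : nitv, J \in runs D (covered B) -> (x < J.1) || (J.2.+1 < x).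
  by move=> H J; apply: H.
move=> J JR; have [? ? ? h _] := runsP _ _ _ JR.
have m1 : ~ (J.1 <= x <= J.2) by move=> /h E; rewrite E in n2.
have m2 : ~ (J.1 <= x.-1 <= J.2) by move=> /h E; rewrite E in n1.
by rewrite /=; lia.
Qed.

Lemma nth_steps s c : c.+1 < size s ->
  nth (0, 0) (steps s) c = (nth 0 s c, (nth 0 s c.+1).-1).
Proof.
move=> Hc; rewrite (nth_map (0, 0)) ?nth_zip_cond size_zip size_behead; last first.
  by lia.
by rewrite ifT ?nth_behead //=; lia.
Qed.

Lemma steps_sorted s : sorted ltn s -> sorted ltn [seq J.1 | J <- steps s].
Proof.
rewrite /steps -map_comp; case: s => // x s /=.
elim: s x => //= y s IH x /andP[xy p].
by have := IH y p; case: s {IH} p => //= z s p ->; rewrite xy.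
Qed.

(** Both sides are sorted by strictly increasing left ends, so a permutation
    between them is enough. *)
Lemma I_list_steps : I_list D B = steps U.
Proof.
rewrite -inner_edges_gaps /I_list.
have tr : transitive (fun J K : nitv => J.1 < K.1) by move=> ? ? ?; apply: ltn_trans.
have fsts (s : seq nitv) : sorted (fun J K : nitv => J.1 < K.1) s =
    sorted ltn [seq J.1 | J <- s] by rewrite sorted_map.
have pe : perm_eq (I_list D B) (steps (inner_edges (gaps D B))).
  rewrite /I_list perm_sort flatten_points -inner_edges_wide.
  by apply: steps_gaps; apply: filter_all.
have st : sorted ltn [seq J.1 | J <- steps (inner_edges (gaps D B))].
  by apply: steps_sorted; rewrite inner_edges_gaps free_edges_sorted.
apply: (irr_sorted_eq tr) => [J||| J]; first exact: ltnn.
- rewrite fsts ltn_sorted_uniq_leq.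
  apply/andP; split.
    rewrite (perm_uniq (perm_map _ pe)).
    by move: st; rewrite ltn_sorted_uniq_leq => /andP[].
  by rewrite sorted_map sort_sorted // => ? ?; apply: leq_total.
- by rewrite fsts.
- exact: perm_mem pe J.
Qed.

Lemma I_union_free c d : c < size U -> c < d < size U ->
  I_union D B c.+1 d = (nth 0 U c, (nth 0 U d).-1).
Proof.
move=> Hc Hd; rewrite /I_union I_list_steps /= !nth_steps ?prednK //; lia.
Qed.

(** The arcs added in B(k) join the free edges of indices c and
    [last_free] - c; this number is always even. *)
Definition last_free : nat := if odd D then (Delta D B).-1 else Delta D B.

Definition outer_arcs (k : nat) : seq nitv :=
  [seq (nth 0 U c, (nth 0 U (last_free - c)).-1) | c <- iota 0 k].

Lemma Delta_free : 0 < Delta D B -> size U = (Delta D B).+1.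
Proof. by have := size_free_edges dB; rewrite /Delta; lia. Qed.

Lemma odd_last_free : odd last_free = false.
Proof.
rewrite /last_free /Delta; case: ifP => oD; last by lia.
lia.
Qed.

Lemma last_free_lt k : 0 < k -> 2 * k <= last_free -> last_free < size U.
Proof.
move=> k0; rewrite /last_free => H; rewrite Delta_free; last by case: ifP H; lia.
by case: ifP H; lia.
Qed.

Lemma mem_Bk k J : 2 * k <= last_free ->
  (J \in Bk D B k) = (J \in B) || (J \in outer_arcs k).
Proof.
move=> Hk; rewrite /Bk in_fsetU mem_fset_of; congr (_ || _); congr (_ \in _).
rewrite /outer_arcs (iotaDl 1 0 k) -map_comp; apply/eq_in_map => c.
rewrite mem_iota /= add1n => Hc.
have lt := @last_free_lt k ltac:(lia) Hk.
rewrite I_union_free; try (by lia); last first.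
  by move: Hk lt; rewrite /last_free; case: ifP; lia.
congr (_, (nth 0 U _).-1).
by move: Hk lt; rewrite /last_free; case: ifP; lia.
Qed.

Lemma outer_arc_bounds k c : 2 * k <= last_free -> c < k ->
  nth 0 U c < nth 0 U (last_free - c).
Proof.
by move=> Hk Hc; have lt := @last_free_lt k ltac:(lia) Hk; apply: nth_free_lt; lia.
Qed.

(** The added arcs join edges of equal parity, that is, they are intervals of
    even size; this also separates them from the arcs of B. *)
Lemma outer_arc_parity k c : 2 * k <= last_free -> c < k ->
  odd (nth 0 U c) = odd (nth 0 U (last_free - c)).
Proof.
move=> Hk Hc; have lt := @last_free_lt k ltac:(lia) Hk.
by rewrite !(nth_free_parity dB); have := odd_last_free; lia.
Qed.

Lemma Bk_perm k : 2 * k <= last_free ->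
  perm_eq (Bk D B k) (B ++ outer_arcs k).
Proof.
move=> Hk; apply: uniq_perm; first exact: fset_uniq.
  rewrite cat_uniq fset_uniq /=; apply/andP; split.
    apply/hasPn => J /mapP[c]; rewrite mem_iota /= => Hc ->.
    apply/negP => /[dup] JB /(ad_parity dB) /=.
    have := outer_arc_bounds Hk Hc; have := outer_arc_parity Hk Hc; lia.
  have inj : forall c d : nat, c < k -> d < k -> nth 0 U c = nth 0 U d -> c = d.
    move=> c d Hc Hd E; have lt := @last_free_lt k ltac:(lia) Hk.
    have := @nth_free_lt D B c d; have := @nth_free_lt D B d c; lia.
  rewrite map_inj_in_uniq ?iota_uniq // => c d; rewrite !mem_iota => Hc Hd [E _].
  exact: inj E.
by move=> J; rewrite mem_cat mem_Bk.
Qed.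

End Steps.

(** * The coordinates of epsilon_D *)

Definition entry (D : nat) (v : 'rV['F_2]_D) (x : nat) : 'F_2 :=
  (\sum_(i < D | i.+1 == x) v 0 i)%R.

Lemma entry_ord D (v : 'rV['F_2]_D) (i : 'I_D) : entry v i.+1 = v 0%R i.
Proof. by rewrite /entry (big_pred1 i) // => j; rewrite /= eqSS. Qed.

Lemma entry_out D (v : 'rV['F_2]_D) x : ~~ (0 < x <= D) -> entry v x = 0%R.
Proof.
move=> H; rewrite /entry big_pred0 // => i; apply/negP => /eqP E.
by case/negP: H; rewrite -E /= ltn_ord.
Qed.

Lemma entryP D (v w : 'rV['F_2]_D) :
  (forall x, 0 < x <= D -> entry v x = entry w x) -> v = w.
Proof.
by move=> H; apply/rowP => i; rewrite -!entry_ord H //= ltn_ord.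
Qed.

Lemma entryD D (v w : 'rV['F_2]_D) x : entry (v + w)%R x = (entry v x + entry w x)%R.
Proof. by rewrite /entry -big_split; apply: eq_bigr => i _; rewrite mxE. Qed.

Lemma entryZ D a (v : 'rV['F_2]_D) x : entry (a *: v)%R x = (a * entry v x)%R.
Proof. by rewrite /entry big_distrr; apply: eq_bigr => i _; rewrite mxE. Qed.

Lemma entry0 D x : @entry D 0%R x = 0%R.
Proof. by rewrite /entry big1 // => i _; rewrite mxE. Qed.

Lemma entry_sum D I (r : seq I) (P : pred I) (F : I -> 'rV['F_2]_D) x :
  entry (\sum_(i <- r | P i) F i)%R x = (\sum_(i <- r | P i) entry (F i) x)%R.
Proof.
by elim/big_rec2: _ => [|i y z _ <-]; [exact: entry0|exact: entryD].
Qed.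

Lemma entry_e D i x : entry (e D i) x = (((0 < x <= D) && (x == i))%N%:R)%R.
Proof.
case: (boolP (0 < x <= D)) => H; last by rewrite entry_out.
case: x H => // x /= xD.
by rewrite -[x]/(nat_of_ord (Ordinal xD)) entry_ord mxE.
Qed.

Lemma entry_e_itv D J x :
  entry (e_itv D J) x = (((0 < x <= D) && mem_nitv J x)%N%:R)%R.
Proof.
rewrite entry_sum; case: (boolP (0 < x <= D)) => H /=; last first.
  by rewrite big1 // => i _; rewrite entry_out.
have [xJ|xJ] := boolP (mem_nitv J x).
  rewrite (bigD1_seq x) ?iota_uniq ?mem_index_iota //= entry_e H eqxx big1 ?addr0 //.
  by move=> i /negbTE ne; rewrite entry_e eq_sym ne andbF.
rewrite big_seq big1 // => i; rewrite mem_index_iota entry_e => Hi.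
have [E|] := eqVneq x i; last by rewrite andbF.
by case/negP: xJ; rewrite E /mem_nitv; lia.
Qed.

Lemma suppE D (v : 'rV['F_2]_D) x : supp v x = (entry v x != 0%R).
Proof.
apply/existsP/idP => [[j /andP[/eqP <-]]|]; first by rewrite entry_ord.
case: (boolP (0 < x <= D)) => H; last by rewrite entry_out ?eqxx.
case: x H => // x /= xD.
rewrite -[x]/(nat_of_ord (Ordinal xD)) entry_ord => ne.
by exists (Ordinal xD); rewrite ne eqxx.
Qed.

Lemma F2_natr_neq0 n : ((n%:R : 'F_2) != 0)%R = odd n.
Proof. by rewrite -(dvdn_pcharf (pchar_Fp (isT : prime 2))) dvdn2 negbK. Qed.

(** The symbol a belongs to J^* if and only if J has even size, so J^* gives J. *)
Lemma nitv_star_inj D (J K : nitv) : 0 < J.1 -> J.1 <= J.2 -> J.2 <= D ->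
  0 < K.1 -> K.1 <= K.2 -> K.2 <= D -> nitv_star D J = nitv_star D K -> J = K.
Proof.
case: J K => a b [a' b'] /= ? ? ? ? ? ? eqS.
have st (j : 'I_D.+1) : (j \in nitv_star D (a, b)) = (j \in nitv_star D (a', b')).
  by rewrite eqS.
have inS (L : nitv) (j : 'I_D.+1) : (j \in nitv_star D L) =
    ~~ odd (nitv_size L) (+) mem_nitv L j.
  by rewrite /nitv_star; case: ifP => /= oL; rewrite ?inE.
have E j : j <= D -> ~~ odd (b.+1 - a) (+) (a <= j <= b) =
                     ~~ odd (b'.+1 - a') (+) (a' <= j <= b').
  by move=> jD; have := st (Ordinal (jD : j < D.+1)); rewrite !inS.
have oE : odd (b.+1 - a) = odd (b'.+1 - a').
  have := E 0 isT; have -> : (a <= 0 <= b) = false by lia.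
  have -> : (a' <= 0 <= b') = false by lia.
  by rewrite !addbF => /negb_inj.
have {}E j : j <= D -> (a <= j <= b) = (a' <= j <= b').
  by move=> /E; rewrite oE => /addbI.
have Ea : a' <= a <= b' by rewrite -E; lia.
have Eb : a' <= b <= b' by rewrite -E; lia.
have Ea' : a <= a' <= b by rewrite E; lia.
have Eb' : a <= b' <= b by rewrite E; lia.
clear -Ea Eb Ea' Eb'; congr pair; lia.
Qed.

Lemma n_mem_count D (C : {fset nitv}) (j : 'I_D.+1) :
  (forall J : nitv, J \in C -> [/\ 0 < J.1, J.1 <= J.2 & J.2 <= D]) ->
  n_mem C j = count (fun J => j \in nitv_star D J) C.
Proof.
move=> bd; rewrite /n_mem /star.
have -> : [set X in [set:: [seq nitv_star D J | J <- C]] | j \in X] =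
    [set:: [seq X : {set 'I_D.+1} <- [seq nitv_star D J | J <- C] | j \in X]].
  by apply/setP => X; rewrite !inE mem_filter andbC.
rewrite cardsE; have /card_uniqP -> : uniq
    [seq X : {set 'I_D.+1} <- [seq nitv_star D J | J <- C] | j \in X].
  apply: filter_uniq; rewrite map_inj_in_uniq ?fset_uniq // => J K JC KC.
  have [? ? ?] := bd _ JC; have [? ? ?] := bd _ KC.
  exact: nitv_star_inj.
by rewrite size_filter count_map.
Qed.

(** The coefficient n(n+1)/2 in the definition of epsilon_D.  Its parity changes
    from n to n + 1 exactly when n is even. *)
Definition tri (n : nat) : nat := (n * n.+1)./2.

Arguments tri : simpl never.

Lemma triS n : tri n.+1 = tri n + n.+1.
Proof.
by rewrite /tri (_ : n.+1 * n.+2 = n * n.+1 + n.+1.*2) ?halfD ?odd_double ?andbF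
  ?doubleK //; nia.
Qed.

Lemma odd_triS n : odd (tri n.+1) = odd (tri n) (+) ~~ odd n.
Proof. by rewrite triS oddD. Qed.

Lemma entry_epsilon D C x (xD : x < D) : entry (epsilon D C) x.+1 =
  ((@eps_coef D C ord0 + @eps_coef D C (lift ord0 (Ordinal xD)))%N%:R)%R.
Proof.
rewrite entry_sum big_ord_recl natrD; congr (_ + _)%R.
  rewrite entryZ /e_bar eqxx entry_e_itv /mem_nitv /=.
  by rewrite xD mulr1.
rewrite (bigD1 (Ordinal xD)) //= big1 ?addr0 => [|i ne].
  by rewrite entryZ entry_e /= xD eqxx mulr1.
rewrite entryZ entry_e /= xD.
suff -> : (x.+1 == bump 0 i) = false by rewrite mulr0.
apply: contraNF ne => /eqP E; apply/eqP/val_inj => /=; move: E.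
by rewrite /bump /=; lia.
Qed.

Lemma count_lt_iota m k : count (fun c => c < m) (iota 0 k) = minn k m.
Proof.
elim: k => [|k IH]; first by rewrite min0n.
by rewrite -addn1 iotaD count_cat IH /=; lia.
Qed.

Section Epsilon.
Variables (D : nat) (B : {fset nitv}) (k : nat).
Hypothesis dB : arc_diagram D B.
Local Notation U := (free_edges D B).
Local Notation E := (last_free D B).
Local Notation r := (rank D B).
Lemma arc_odd (J : nitv) : J \in B -> odd (nitv_size J).
Proof.
move=> JB; rewrite /nitv_size; have [? ? ?] := ad_bounds dB JB.
by have := ad_parity dB JB; lia.
Qed.

Hypothesis Hk : 2 * k <= E.

(** The number of added arcs that do not cover a position with c free edges on
    its left: the arc of index i covers it when i < c <= last_free - i. *)
Definition level (c : nat) : nat := k - minn (minn k c) (E.+1 - c).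

(** The number n_j of members of B(k)^* containing j: an added arc has even
    size, so it counts when it does not cover j. *)
Definition multiplicity (j : nat) : nat := depth B j + level (r j).

Lemma last_free_size : 0 < k -> size U = E.+1 + odd D.
Proof.
move=> k0; have := @last_free_lt D B dB k k0 Hk.
have := size_free_edges dB; move: Hk; rewrite /last_free /Delta.
by case: ifP; lia.
Qed.

Lemma mem_outer_arc c j : c < k ->
  mem_nitv (nth 0 U c, (nth 0 U (E - c)).-1) j = (c < r j <= E - c).
Proof.
move=> Hc; have lt := @last_free_lt D B dB k ltac:(lia) Hk.
rewrite /mem_nitv /= nth_le_rank; last by lia.
have b := @nth_free_bounds D B (E - c) ltac:(lia).
have := @nth_le_rank D B (E - c) j ltac:(lia).
by lia.
Qed.

Lemma Bk_bounds (J : nitv) : J \in Bk D B k -> [/\ 0 < J.1, J.1 <= J.2 & J.2 <= D].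
Proof.
rewrite (mem_Bk dB _ Hk) => /orP[/(ad_bounds dB) //|/mapP[c]].
rewrite mem_iota add0n => /andP[_ Hc] -> /=.
have lt := @last_free_lt D B dB k ltac:(lia) Hk.
have := outer_arc_bounds dB Hk Hc.
have := @nth_free_bounds D B c ltac:(lia).
have := @nth_free_bounds D B (E - c) ltac:(lia).
by split; lia.
Qed.

Lemma outer_arc_even c : c < k ->
  odd (nitv_size (nth 0 U c, (nth 0 U (E - c)).-1)) = false.
Proof.
move=> Hc; rewrite /nitv_size /=.
have := outer_arc_bounds dB Hk Hc; have := outer_arc_parity dB Hk Hc; lia.
Qed.

Lemma n_memE (j : 'I_D.+1) : n_mem (Bk D B k) j = multiplicity j.
Proof.
rewrite n_mem_count; last exact: Bk_bounds.
have /seq.permP -> := Bk_perm dB Hk; rewrite count_cat; congr (_ + _).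
  by apply: eq_in_count => J JB; rewrite /nitv_star arc_odd // inE.
rewrite /outer_arcs count_map /level.
have -> : minn (minn k (r j)) (E.+1 - r j) =
    count (fun c => c < minn (r j) (E.+1 - r j)) (iota 0 k).
  by rewrite count_lt_iota minnA.
rewrite -[X in _ = X - _](size_iota 0).
rewrite -(count_predC (fun c => c < minn (r j) (E.+1 - r j)) (iota 0 k)) addKn.
apply: eq_in_count => c; rewrite mem_iota add0n => /andP[_ Hc] /=.
rewrite /nitv_star outer_arc_even // !inE mem_outer_arc //.
by lia.
Qed.

End Epsilon.

Lemma bigmax_prefix (n M : nat) (P : pred nat) :
  M <= n -> (forall m, m <= n -> P m = (m <= M)) -> \max_(m < n.+1 | P m) m = M.
Proof.
move=> Mn HP; apply/eqP; rewrite eqn_leq; apply/andP; split.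
  by apply/bigmax_leqP => i; rewrite HP //; have := ltn_ord i; lia.
have lt : M < n.+1 by [].
by apply: (@leq_bigmax_cond _ _ _ (Ordinal lt)); rewrite HP //=.
Qed.

Section Status.
Variables (D : nat) (B : {fset nitv}) (k : nat).
Hypothesis dB : arc_diagram D B.
Local Notation U := (free_edges D B).
Local Notation E := (last_free D B).
Local Notation r := (rank D B).
Local Notation C := (Bk D B k).
Hypothesis Hk : 2 * k <= E.

(** The bracket is the complement of the innermost added arc. *)
Lemma mem_bracket (j : 'I_D.+1) : (j \in @bracket D C) =
  (0 < k) && ~~ (k.-1 < r j <= E - k.-1).
Proof.
apply/bigcupP/andP => [[X /andP[]]|[k0 nj]].
  have notB (J : nitv) : J \in B -> (@ord0 D \in nitv_star D J) = false.
    move=> JB; rewrite /nitv_star (arc_odd dB JB) inE /mem_nitv /=.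
    by have [? ? ?] := ad_bounds dB JB; lia.
  rewrite inE => /mapP[J]; rewrite (mem_Bk dB _ Hk) => /orP[JB ->|].
    by rewrite notB.
  case/mapP => c; rewrite mem_iota add0n => /andP[_ Hc] -> -> _.
  rewrite /nitv_star (outer_arc_even dB Hk Hc) !inE (mem_outer_arc dB Hk) //.
  by lia.
have Hc : k.-1 < k by lia.
exists (nitv_star D (nth 0 U k.-1, (nth 0 U (E - k.-1)).-1)).
  apply/andP; split.
    rewrite inE; apply/mapP; eexists; last by [].
    rewrite (mem_Bk dB _ Hk); apply/orP; right.
    by apply/mapP; exists k.-1; rewrite ?mem_iota.
  rewrite /nitv_star (outer_arc_even dB Hk Hc) !inE /=.
  have lt := @last_free_lt D B dB k ltac:(lia) Hk.
  by have := @nth_free_bounds D B k.-1 ltac:(lia); rewrite /mem_nitv /=; lia.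
by rewrite /nitv_star (outer_arc_even dB Hk Hc) !inE (mem_outer_arc dB Hk).
Qed.

Lemma in_bracketE i : i <= D -> in_bracket D C i =
  (0 < k) && ~~ (k.-1 < r i <= E - k.-1).
Proof.
move=> iD; rewrite -(mem_bracket (Ordinal (iD : i < D.+1))).
apply/existsP/idP => [[j /andP[jb /eqP E]]|ib].
  by rewrite (_ : Ordinal _ = j) //; apply: val_inj.
by exists (Ordinal (iD : i < D.+1)); rewrite ib eqxx.
Qed.

Lemma in_bracket_bounds i : 0 < k -> i <= D -> in_bracket D C i =
  (i < nth 0 U k.-1) || (nth 0 U (E - k.-1) <= i).
Proof.
move=> k0 iD; rewrite in_bracketE // k0 /=.
have lt := @last_free_lt D B dB k ltac:(lia) Hk.
have := @nth_le_rank D B k.-1 i ltac:(lia).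
have := @nth_le_rank D B (E - k.-1) i ltac:(lia).
lia.
Qed.

Lemma bracket_lE : 0 < k -> bracket_l D C = (nth 0 U k.-1).-1.
Proof.
move=> k0; have lt := @last_free_lt D B dB k ltac:(lia) Hk.
have b1 := @nth_free_bounds D B k.-1 ltac:(lia).
have b2 := outer_arc_bounds dB Hk (ltac:(lia) : k.-1 < k).
have b3 := @nth_free_bounds D B (E - k.-1) ltac:(lia).
apply: (@bigmax_prefix D _ (fun m => all _ (index_iota 1 m.+1))) => [|m mD].
  lia.
apply/allP/idP => [al|le i].
  rewrite leqNgt; apply/negP => lt'.
  have /al : nth 0 U k.-1 \in index_iota 1 m.+1 by rewrite mem_index_iota; lia.
  by rewrite in_bracket_bounds //; lia.
rewrite mem_index_iota => Hi.
have : i < nth 0 U k.-1 by lia.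
by rewrite in_bracket_bounds // => [->|]; lia.
Qed.

Lemma bracket_l'E : 0 < k -> bracket_l' D C = nth 0 U (E - k.-1).
Proof.
move=> k0; have lt := @last_free_lt D B dB k ltac:(lia) Hk.
have b1 := @nth_free_bounds D B k.-1 ltac:(lia).
have b2 := outer_arc_bounds dB Hk (ltac:(lia) : k.-1 < k).
have b3 := @nth_free_bounds D B (E - k.-1) ltac:(lia).
rewrite /bracket_l'.
rewrite (@bigmax_prefix D (D.+1 - nth 0 U (E - k.-1))
  (fun m => all _ (index_iota (D.+1 - m) D.+1))) => [||m mD]; try by lia.
apply/allP/idP => [al|le i].
  rewrite leqNgt; apply/negP => lt'.
  have /al : (nth 0 U (E - k.-1)).-1 \in index_iota (D.+1 - m) D.+1.
    by rewrite mem_index_iota; lia.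
  by rewrite in_bracket_bounds //; lia.
rewrite mem_index_iota => Hi.
have : nth 0 U (E - k.-1) <= i by lia.
by rewrite in_bracket_bounds // => [->|]; rewrite ?orbT; lia.
Qed.

Local Notation m := (multiplicity D B k).

Lemma multiplicity0 : m 0 = k.
Proof.
have r0 : r 0 = 0.
  apply/eqP; rewrite -leqn0 leqNgt -has_count; apply/hasPn => x.
  by rewrite mem_free_edges => /andP[/andP[x0 _] _]; rewrite -ltnNge.
have d0 : depth B 0 = 0.
  apply/eqP; rewrite -leqn0 leqNgt -has_count; apply/hasPn => J.
  by move/(ad_bounds dB) => [J0 _ _]; rewrite /mem_nitv leqNgt J0.
by rewrite /multiplicity r0 d0 /level minn0 min0n subn0.
Qed.

(** At D + 1 no arc of B is left and all free edges are passed, so that the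
    vanishing coordinate there obeys the same formula as those in [1, D]. *)
Lemma multiplicity_end : m D.+1 = k.
Proof.
rewrite /multiplicity rank_end // (_ : depth B D.+1 = 0); last first.
  apply/eqP; rewrite -leqn0 leqNgt -has_count; apply/hasPn => J.
  by move/(ad_bounds dB) => [_ _ JD]; rewrite /mem_nitv ltnNge; apply/negP; lia.
rewrite /level add0n; case: (posnP k) => k0; first by rewrite k0.
have -> : E.+1 - size U = 0; last by rewrite minn0 subn0.
by rewrite (last_free_size dB Hk k0) subnDA subnn.
Qed.

Lemma odd_multiplicity j : j <= D.+1 ->
  odd (m j) = odd j (+) odd (r j) (+) odd (level D B k (r j)).
Proof. by move=> jD; rewrite oddD (depth_rank_parity dB jD). Qed.

(** The positions where the exceptional rule for odd D changes the parity of the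
    coefficient. *)
Definition tail (j : nat) : bool :=
  [&& odd D, odd k, E.+1 < r j & odd j].

Lemma rank_le_size j : 0 < k -> r j <= E.+1 + odd D.
Proof. by move=> k0; rewrite -(last_free_size dB Hk k0); apply: rank_le. Qed.

Hypothesis Hodd : odd D -> k = 0 \/ odd k.

(** The exceptional rule replaces n_j by n_j + 1, which matters only for n_j
    even.  By [odd_multiplicity] and the parities of l and l', n_j is odd where
    the rule applies, except to the right of the last free edge. *)
Lemma odd_eps_coef (j : 'I_D.+1) :
  odd (eps_coef C j) = odd (tri (m j)) (+) tail j.
Proof.
have jD : j <= D by rewrite -ltnS ltn_ord.
rewrite /eps_coef (n_memE dB Hk) -!/(tri _).
have [oD|eD] := boolP (odd D); last by rewrite /tail (negbTE eD) addbF.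
case: (Hodd oD) => [k0|ok].
  by rewrite mem_bracket /tail k0 /= !andbF addbF.
have k0 : 0 < k by case: (k) ok.
have lt := @last_free_lt D B dB k k0 Hk.
have Eev := odd_last_free D B.
have pA := @nth_free_parity D B dB k.-1 ltac:(lia).
have pZ := @nth_free_parity D B dB (E - k.-1) ltac:(lia).
have A0 := @nth_free_bounds D B k.-1 ltac:(lia).
have AZ := outer_arc_bounds dB Hk (ltac:(lia) : k.-1 < k).
have jA := @nth_le_rank D B k.-1 j ltac:(lia).
have jZ := @nth_le_rank D B (E - k.-1) j ltac:(lia).
have rE := rank_le_size j k0.
have pm := odd_multiplicity (ltac:(lia) : j <= D.+1).
have oZ : odd (nth 0 U (E - k.-1)) = true.
  by rewrite pZ; clear -ok Eev Hk k0; lia.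
have oA : odd (nth 0 U k.-1).-1 = false.
  by clear -pA A0 ok k0; lia.
rewrite /tail oD ok /=.
have -> : (j != ord0) = (0 < j).
  by rewrite lt0n; congr (~~ _); apply/eqP/eqP => [->|/val_inj].
rewrite mem_bracket k0 /bracket_u bracket_lE // bracket_l'E //=.
rewrite -jA [_ <= E - _]leqNgt -jZ negb_and negbK.
have [Zj|jltZ] := leqP (nth 0 U (E - k.-1)) j.
  rewrite oZ orbT /= eq_sym eqb_id.
  have -> : (0 < j) = true by clear -Zj AZ; lia.
  have [oj|ej] := boolP (odd j); last by rewrite /= andbF addbF.
  change (odd (tri (m j).+1) = odd (tri (m j)) (+) (E.+1 < r j) && true).
  rewrite andbT odd_triS; congr (_ (+) _).
  rewrite pm oj /level; have [rj|rj] := leqP (r j) E.+1.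
    have Zr : E - k.-1 < r j by rewrite -jZ.
    have -> : minn (minn k (r j)) (E.+1 - r j) = E.+1 - r j.
      by clear -rj Zr Hk k0; lia.
    by clear -rj Zr Hk k0 ok Eev; lia.
  have -> : minn (minn k (r j)) (E.+1 - r j) = 0 by clear -rj; lia.
  have -> : r j = E.+2 by move: rE; rewrite oD; clear -rj; lia.
  by rewrite subn0 ok /= Eev.
have rj : r j <= E - k.-1 by rewrite leqNgt -jZ -ltnNge.
have -> : (E.+1 < r j) = false by clear -rj; lia.
rewrite /= addbF oA orbF -ltnNge; case: ifP => // /and3P[j0 jltA ej].
have {}rj : r j < k by move: jA; rewrite leqNgt jltA => /esym; clear -k0; lia.
rewrite odd_triS pm /level.
have -> : minn (minn k (r j)) (E.+1 - r j) = r j by clear -rj Hk; lia.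
move: ej; rewrite eq_sym eqbF_neg => /negbTE ->.
by rewrite oddB 1?ltnW // ok; case: (odd (r j)); rewrite /= addbF.
Qed.

(** The summand odd (tri k) comes from the coefficient of e_a = e_[1,D].  The
    formula also holds at 0 and D + 1, where both sides are false. *)
Lemma supp_epsilon j : j <= D.+1 ->
  supp (epsilon D C) j = odd (tri k) (+) odd (tri (m j)) (+) tail j.
Proof.
have eps0 : odd (@eps_coef D C ord0) = odd (tri k).
  by rewrite odd_eps_coef /= multiplicity0 /tail /= !andbF addbF.
case: j => [|j] jD.
  rewrite suppE entry_out // eqxx multiplicity0 /tail /= !andbF addbF.
  by rewrite addbb.
have [E1|jD'] := eqVneq j D.
  rewrite suppE entry_out ?eqxx E1 ?multiplicity_end /tail; last by lia.
  by rewrite /= addbb /=; case: (odd D); rewrite /= ?andbF.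
have xD : j < D by lia.
rewrite suppE (entry_epsilon _ xD) F2_natr_neq0 oddD eps0 odd_eps_coef.
by rewrite /= /bump /= addbA.
Qed.

Definition jump (x : nat) : bool :=
  supp (epsilon D C) x.-1 (+) supp (epsilon D C) x.

Lemma jumpE x : 0 < x <= D.+1 -> jump x =
  odd (tri (m x.-1)) (+) tail x.-1 (+) (odd (tri (m x)) (+) tail x).
Proof.
move=> Hx; have [x1 x2] : x.-1 <= D.+1 /\ x <= D.+1 by lia.
rewrite /jump !supp_epsilon //.
by rewrite -!addbA (addbCA _ (odd (tri k))) (addbCA _ (odd (tri k))) addKb.
Qed.

(** The two positions just outside an arc of B have the same multiplicity, and
    so have the two positions just inside it. *)
Lemma jump_arc (J : nitv) : J \in B -> jump J.1 = jump J.2.+1.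
Proof.
move=> JB; have [J1 J12 JD] := ad_bounds dB JB.
have pJ := ad_parity dB JB.
have [h1 h2] : 0 < J.1 <= D.+1 /\ 0 < J.2.+1 <= D.+1 by lia.
rewrite !jumpE //= {h1 h2}.
have rk := rank_const dB JB.
have r1 := rk J.1.-1 J.2.+1 ltac:(lia) ltac:(lia).
have r2 := rk J.1 J.2 ltac:(lia) ltac:(lia).
have m1 : m J.1.-1 = m J.2.+1.
  by rewrite /multiplicity (depth_outside dB JB) r1.
have m2 : m J.1 = m J.2.
  by rewrite /multiplicity (depth_left dB JB) (depth_right dB JB)
             (depth_outside dB JB) r2.
have t1 : tail J.1.-1 = tail J.2.+1.
  by rewrite /tail r1 (_ : odd J.1.-1 = odd J.2.+1) //; lia.
have t2 : tail J.1 = tail J.2 by rewrite /tail r2 pJ.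
by rewrite m1 m2 t1 t2 addbC.
Qed.

(** No arc of B touches or covers a free edge, so only the added arcs matter. *)
Lemma jump_free c : c < size U -> jump (nth 0 U c) =
  odd (tri (level D B k c)) (+) odd (tri (level D B k c.+1)).
Proof.
move=> Hc; have b := nth_free_bounds Hc; have p := nth_free_parity dB Hc.
rewrite jumpE // /multiplicity rank_nth // rank_nth_pred //.
rewrite !(depth0 dB) ?prednK ?mem_nth ?orbT //; last by lia.
rewrite !add0n.
have t1 : tail (nth 0 U c).-1 = false.
  rewrite /tail rank_nth_pred //; case: (boolP (odd k)) => ok; rewrite ?andbF //.
  by have := last_free_size dB Hk (ltac:(by case: (k) ok)); lia.
have t2 : tail (nth 0 U c) = false.
  rewrite /tail rank_nth // p; case: (boolP (odd k)) => ok; rewrite ?andbF //.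
  have := last_free_size dB Hk (ltac:(by case: (k) ok)).
  by have := odd_last_free D B; case: (odd D) => //=; lia.
by rewrite t1 t2 !addbF.
Qed.

End Status.

(** * The values of u *)

(** In 2 u(v) a run [a, b] contributes 2 (-1)^a when b + 1 has the parity of a,
    and 0 otherwise, that is (-1)^a + (-1)^(b+1); its jumps are a and b + 1. *)
Lemma u_fun_jumps D (v : 'rV['F_2]_D) : (u_fun v *+ 2 =
  \sum_(x <- iota 1 D.+1) (supp v x.-1 (+) supp v x)%:R * (-1) ^+ x)%R.
Proof.
have s0 : supp v 0 = false by rewrite suppE entry_out ?eqxx.
have sout i : D < i -> supp v i = false.
  by move=> Di; rewrite suppE entry_out ?eqxx // [i <= D]leqNgt Di andbF.
transitivity (\sum_(J <- runs D (supp v))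
    ((-1) ^+ (J : nitv).1 + (-1) ^+ J.2.+1) : int)%R.
  rewrite /u_fun -sumrMnl big_mkcond; apply: eq_bigr => J _.
  rewrite -signr_odd -[in X in (_ + X)%R]signr_odd /=.
  by case: (odd J.1); case: (odd J.2); rewrite /= ?mulr2n ?addrN ?addNr.
rewrite big_split /=.
have -> : (\sum_(J <- runs D (supp v)) (-1) ^+ (J : nitv).1 =
    \sum_(x <- iota 1 D.+1 | ~~ supp v x.-1 && supp v x) (-1) ^+ x :> int)%R.
  rewrite -[RHS]big_filter -(perm_big _ (runs_starts s0 sout)) /=.
  by rewrite big_map.
have -> : (\sum_(J <- runs D (supp v)) (-1) ^+ (J : nitv).2.+1 =
    \sum_(x <- iota 1 D.+1 | supp v x.-1 && ~~ supp v x) (-1) ^+ x :> int)%R.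
  rewrite -[RHS]big_filter -(perm_big _ (runs_stops s0 sout)) /=.
  by rewrite big_map.
rewrite big_mkcond [in X in (_ + X)%R]big_mkcond -big_split /=.
apply: eq_bigr => x _.
by case: (supp v x.-1); case: (supp v x); rewrite /= ?mul0r ?mul1r ?addr0 ?add0r.
Qed.

Section Value.
Variables (D : nat) (B : {fset nitv}) (k : nat).
Hypothesis dB : arc_diagram D B.
Local Notation U := (free_edges D B).
Local Notation E := (last_free D B).
Local Notation C := (Bk D B k).
Hypothesis Hk : 2 * k <= E.
Hypothesis Hodd : odd D -> k = 0 \/ odd k.
Local Notation lv := (level D B k).

Lemma sum_edges (F : nat -> int) : (\sum_(x <- iota 1 D.+1) F x =
  \sum_(c <- iota 0 (size U)) F (nth 0%N U c) +
  \sum_(J <- B) (F (J : nitv).1 + F J.2.+1))%R.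
Proof.
rewrite (perm_big _ (edges_perm dB)) !big_cat /= !big_map -big_split /=.
congr (_ + _)%R.
by rewrite -[in LHS](take_size U) -(map_nth_iota0 0 (leqnn (size U))) big_map.
Qed.

(** From c to c + 1 the level decreases by one up to k, is then constant, and
    increases by one in the last k steps. *)
Lemma level_jump c : c <= E ->
  odd (tri (lv c)) (+) odd (tri (lv c.+1)) =
  if c < k then odd (k - c) else if E < c + k then odd (k - (E - c)) else false.
Proof.
move=> cE; have [ck|kc] := ltnP c k.
  have -> : lv c = (k - c.+1).+1 by rewrite /level; clear -ck Hk; lia.
  have -> : lv c.+1 = k - c.+1 by rewrite /level; clear -ck Hk; lia.
  have -> : k - c = (k - c.+1).+1 by clear -ck; lia.
  by rewrite odd_triS addbAC addbb.
have [lt|le] := ltnP E (c + k).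
  have -> : lv c.+1 = (lv c).+1 by rewrite /level; clear -cE kc lt Hk; lia.
  have -> : k - (E - c) = (lv c).+1 by rewrite /level; clear -cE kc lt Hk; lia.
  by rewrite odd_triS addbA addbb.
have -> : lv c = 0 by rewrite /level; clear -cE kc le Hk; lia.
by have -> : lv c.+1 = 0 by rewrite /level; clear -cE kc le Hk; lia.
Qed.

(** The terms with n - c odd all have the sign (-1)^n. *)
Lemma sum_first_jumps (n : nat) :
  (\sum_(c <- iota 0 n) (odd (n - c))%:R * (-1) ^+ c.+1 =
   (-1) ^+ n * (uphalf n)%:R :> int)%R.
Proof.
rewrite (eq_big_seq (fun c => (-1) ^+ n * (odd (n - c))%:R)%R); last first.
  move=> c; rewrite mem_iota /= add0n => cn; rewrite mulrC.
  rewrite -signr_odd -[in RHS]signr_odd /=.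
  rewrite oddB; last exact: ltnW.
  by case: (odd n); case: (odd c); rewrite /= ?mulr0.
rewrite -big_distrr /=; congr (_ * _)%R.
elim: n => [|n IH]; first by rewrite big_nil.
rewrite [iota _ _]/= big_cons subn0.
rewrite (iotaDl 1 0 n) big_map (eq_bigr (fun c => (odd (n - c))%:R)%R) //.
rewrite IH -natrD; congr (_%:R)%R.
by rewrite [in LHS]uphalf_half /= addnA; case: (odd n).
Qed.

(** The k left ends and the k right ends of the added arcs contribute equally
    by symmetry, and the other free edges contribute nothing. *)
Lemma sum_free_jumps : (\sum_(c <- iota 0 (size U))
    (jump D B k (nth 0%N U c))%:R * (-1) ^+ nth 0%N U c =
  ((-1) ^+ k * (uphalf k)%:R) *+ 2 :> int)%R.
Proof.
have -> : (\sum_(c <- iota 0 (size U))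
    (jump D B k (nth 0%N U c))%:R * (-1) ^+ nth 0%N U c =
    \sum_(c <- iota 0 (size U))
    (odd (tri (lv c)) (+) odd (tri (lv c.+1)))%:R * (-1) ^+ c.+1 :> int)%R.
  apply: eq_big_seq => c; rewrite mem_iota add0n => /andP[_ Hc].
  rewrite (jump_free dB Hk Hodd Hc) -signr_odd (nth_free_parity dB Hc).
  by rewrite -[in RHS]signr_odd.
case: (posnP k) => k0.
  rewrite big1 ?k0 ?mulr0 ?mul0rn // => c _.
  by rewrite /level !sub0n mul0r.
have sU := last_free_size dB Hk k0.
transitivity (\sum_(c <- iota 0 E.+1)
    (odd (tri (lv c)) (+) odd (tri (lv c.+1)))%:R * (-1) ^+ c.+1 : int)%R.
  rewrite sU iotaD big_cat /= [X in (_ + X)%R]big1_seq ?addr0 // => c /andP[_].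
  rewrite mem_iota add0n => /andP[Ec _].
  have -> : lv c = k.
    by rewrite /level (_ : E.+1 - c = 0) ?minn0 ?subn0 //; clear -Ec; lia.
  have -> : lv c.+1 = k.
    by rewrite /level (_ : E.+1 - c.+1 = 0) ?minn0 ?subn0 //; clear -Ec; lia.
  by rewrite addbb mul0r.
have -> : E.+1 = k + ((E.+1 - 2 * k) + k) by clear -Hk; lia.
rewrite iotaD big_cat iotaD big_cat /= mulr2n; congr (_ + _)%R.
  rewrite -sum_first_jumps; apply: eq_big_seq => c.
  rewrite mem_iota add0n => /andP[_ ck]; rewrite level_jump ?ck //.
  by clear -ck Hk; lia.
rewrite [X in (X + _)%R]big1_seq ?add0r; last first.
  move=> c /andP[_]; rewrite mem_iota add0n => Hc.
  rewrite level_jump; last by clear -Hc Hk; lia.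
  by rewrite !ifF ?mul0r //; clear -Hc Hk; lia.
have -> : iota (0 + k + (E.+1 - 2 * k)) k = [seq E - d | d <- rev (iota 0 k)].
  apply: (@eq_from_nth _ 0); first by rewrite size_map size_rev !size_iota.
  move=> i; rewrite size_iota => Hi.
  rewrite (nth_map 0) ?size_rev ?size_iota // nth_rev ?size_iota //.
  by rewrite !nth_iota; clear -Hi Hk; lia.
rewrite big_map (perm_big (iota 0 k)) /=; last by rewrite perm_rev.
rewrite -sum_first_jumps; apply: eq_big_seq => c.
rewrite mem_iota add0n => /andP[_ ck].
rewrite level_jump; last by clear; lia.
rewrite ifF; last by clear -ck Hk; lia.
rewrite ifT; last by clear -ck Hk; lia.
rewrite subKn; last by clear -ck Hk; lia.
rewrite -signr_odd -[in RHS]signr_odd /= [odd (E - c)]oddB ?odd_last_free //.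
by clear -ck Hk; lia.
Qed.

Lemma u_fun_epsilon : (u_fun (epsilon D C) = (-1) ^+ k * (uphalf k)%:R)%R.
Proof.
apply/eqP; rewrite -(@eqr_pMn2r _ 2) //; apply/eqP.
rewrite u_fun_jumps -sum_free_jumps sum_edges addrC.
rewrite big1_seq ?add0r // => J /andP[_ JB].
rewrite -!/(jump D B k _) (jump_arc dB Hk Hodd JB) -mulrDr.
rewrite -signr_odd -[in X in (_ + X)%R]signr_odd /= (ad_parity dB JB).
by case: (odd J.2); rewrite /= ?addrN ?addNr mulr0.
Qed.

(** The coordinate at D is the jump at the edge D + 1.  If this edge is free,
    it is the last one and the level does not change there; otherwise an arc
    of B ends there and the exceptional rule applies at D. *)
Lemma supp_last : odd D -> odd k || (D.+1 \in U) ->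
  supp (epsilon D C) D = (D.+1 \notin U).
Proof.
move=> oD ok.
have -> : supp (epsilon D C) D = jump D B k D.+1.
  by rewrite /jump [supp _ D.+1]suppE entry_out ?eqxx ?addbF //= ltnn.
have lvs c : (0 < k -> E < c) -> lv c = k.
  case: (posnP k) => [k0 _|k0 /(_ isT) Ec]; first by rewrite /level k0.
  by rewrite /level (_ : E.+1 - c = 0) ?minn0 ?subn0 //; clear -Ec; lia.
have [DU|DU] := boolP (D.+1 \in U).
  have Hc : index D.+1 U < size U by rewrite index_mem.
  have rc : (index D.+1 U).+1 = size U.
    by rewrite -(rank_nth Hc) nth_index // (rank_end B (ltnSn D)).
  rewrite -(nth_index 0 DU) (jump_free dB Hk Hodd Hc) !lvs ?addbb // => k0.
    by rewrite rc (last_free_size dB Hk k0) addSn ltnS leq_addr.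
  by rewrite -ltnS rc (last_free_size dB Hk k0) oD addn1.
have {}ok : odd k by move: ok; rewrite (negbTE DU) orbF.
have k0 : 0 < k by case: (k) ok.
have : is_end B D.+1 by move: DU; rewrite mem_free_edges leqnn /= negbK.
case/is_endP => J JB HJ; have [J0 J12 JD] := ad_bounds dB JB.
have {HJ} EJ : J.2 = D by clear -HJ J12 JD; lia.
have rD : rank D B D = size U.
  rewrite -(rank_end B (ltnSn D)); apply: (rank_const dB JB); rewrite EJ.
    by clear -J12 EJ; lia.
  by clear -J12 EJ; lia.
have sU := last_free_size dB Hk k0; rewrite oD addn1 in sU.
have mD : multiplicity D B k D = k.+1.
  rewrite /multiplicity rD sU (lvs E.+2) => [|_]; last by rewrite ltnW // ltnSn.
  have -> : depth B D = (depth B D.+1).+1 by rewrite -{1 2}EJ (depth_right dB JB).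
  have -> : depth B D.+1 = 0.
    apply/eqP; rewrite -leqn0 leqNgt -has_count; apply/hasPn => K.
    by move/(ad_bounds dB) => [_ _ KD]; rewrite /mem_nitv ltnNge; apply/negP; lia.
  by rewrite add1n.
rewrite (jumpE dB Hk Hodd) ?ltnS ?leqnn //= mD (multiplicity_end dB Hk).
have -> : tail D B k D = true by rewrite /tail oD ok rD sU ltnSn.
have -> : tail D B k D.+1 = false by rewrite /tail /= oD !andbF.
by rewrite odd_triS ok !addbF addbT addNb addbb.
Qed.

End Value.

(** * The subspaces E_B *)

Lemma addF2_eq0 (a b : 'F_2) : ((a + b)%R == 0%R) = (a == b).
Proof. by rewrite addr_eq0; case: a b => [[|[|[]]] ?] // [[|[|[]]] ?]. Qed.

Lemma span_ind (K : fieldType) (V : vectType K) (P : V -> Prop) (X : seq V) :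
  P 0%R -> (forall a u v, P u -> P v -> P (a *: u + v)%R) ->
  (forall x, x \in X -> P x) -> forall v, v \in <<X>>%VS -> P v.
Proof.
move=> P0 Plin; elim: X => [|x X IH] PX v.
  by rewrite span_nil memv0 => /eqP->.
rewrite span_cons => /memv_addP[u /vlineP[a ->] [w wX ->]].
apply: Plin; first by apply: PX; rewrite mem_head.
by apply: IH => // y yX; apply: PX; rewrite inE yX orbT.
Qed.

Definition boundary (D : nat) (v : 'rV['F_2]_D) (x : nat) : 'F_2 :=
  (entry v x.-1 + entry v x)%R.

Lemma boundary_lin D a (u v : 'rV['F_2]_D) x :
  boundary (a *: u + v)%R x = (a * boundary u x + boundary v x)%R.
Proof. by rewrite /boundary !entryD !entryZ mulrDr addrACA. Qed.

Lemma boundary0 D x : @boundary D 0%R x = 0%R.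
Proof. by rewrite /boundary !entry0 addr0. Qed.

Lemma entry_itv D (J : nitv) x : 0 < J.1 -> J.2 <= D ->
  entry (e_itv D J) x = (mem_nitv J x)%:R%R.
Proof.
move=> J1 JD; rewrite entry_e_itv; congr ((nat_of_bool _)%:R)%R.
by rewrite /mem_nitv; lia.
Qed.

Lemma addF2_bool (a b : bool) : (a%:R + b%:R = (a (+) b)%:R :> 'F_2)%R.
Proof. by case: a b => -[]; rewrite ?addr0 ?add0r //; apply/val_inj. Qed.

Lemma boundary_itv D (J : nitv) x : 0 < J.1 -> J.2 <= D ->
  boundary (e_itv D J) x = (mem_nitv J x.-1 (+) mem_nitv J x)%:R%R.
Proof. by move=> J1 JD; rewrite /boundary !entry_itv // addF2_bool. Qed.

Section Span.
Variables (D : nat) (B : {fset nitv}).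
Hypothesis dB : arc_diagram D B.
Local Notation U := (free_edges D B).

Lemma mem_arc_sides (J K : nitv) : J \in B -> K \in B -> J <> K ->
  mem_nitv K J.1.-1 = mem_nitv K J.2.+1 /\ mem_nitv K J.1 = mem_nitv K J.2.
Proof.
move=> JB KB ne; have [? ? ?] := ad_bounds dB JB; have [? ? ?] := ad_bounds dB KB.
by have := ad_apart dB JB KB ne; rewrite /mem_nitv => -[]; split; lia.
Qed.

Lemma mem_arc_start (J K : nitv) : J \in B -> K \in B -> J <> K ->
  mem_nitv K J.1.-1 = mem_nitv K J.1.
Proof.
move=> JB KB ne; have [? ? ?] := ad_bounds dB JB; have [? ? ?] := ad_bounds dB KB.
by have := ad_apart dB JB KB ne; rewrite /mem_nitv => -[]; lia.
Qed.

Lemma not_mem_free (K : nitv) x : K \in B -> x \in U ->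
  mem_nitv K x.-1 = false /\ mem_nitv K x = false.
Proof.
move=> KB xU; have [? ? ?] := ad_bounds dB KB.
by have := free_edge_outside dB KB xU; rewrite /mem_nitv; split; lia.
Qed.

Lemma mem_arc_ends (J : nitv) : J \in B ->
  [/\ mem_nitv J J.1.-1 = false, mem_nitv J J.1, mem_nitv J J.2 &
      mem_nitv J J.2.+1 = false].
Proof.
by move=> JB; have [? ? ?] := ad_bounds dB JB; rewrite /mem_nitv; split; lia.
Qed.

Lemma e_itv_in (J : nitv) : J \in B -> e_itv D J \in E_of D B.
Proof. by move=> JB; apply/memv_span/map_f. Qed.

(** The conditions are linear, and e_K jumps exactly at the ends of K. *)
Lemma boundary_of_E v : v \in E_of D B ->
  (forall J : nitv, J \in B -> boundary v J.1 = boundary v J.2.+1) /\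
  (forall x : nat, x \in U -> boundary v x = 0%R).
Proof.
pose P (w : 'rV['F_2]_D) :=
  (forall J : nitv, J \in B -> boundary w J.1 = boundary w J.2.+1) /\
  (forall x : nat, x \in U -> boundary w x = 0%R).
move: v; apply: (@span_ind _ _ P) => [|a u w [u1 u2] [w1 w2]|_ /mapP[K KB ->]].
- by split=> *; rewrite !boundary0.
- split=> [J JB|x xU]; rewrite !boundary_lin; first by rewrite u1 ?w1.
  by rewrite u2 ?w2 // mulr0 addr0.
have [K1 K12 KD] := ad_bounds dB KB.
split=> [J JB|x xU]; rewrite !boundary_itv //=; last first.
  by have [-> ->] := not_mem_free KB xU.
have [->|/eqP ne] := eqVneq K J; first by have [-> -> -> ->] := mem_arc_ends JB.
by have [-> ->] := mem_arc_sides JB KB (nesym ne); rewrite addbC.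
Qed.

(** Distinct arcs have distinct ends, so the boundaries of the e_K at J.1 vanish
    for K other than J. *)
Lemma boundary_sum (a : nitv -> 'F_2) (J : nitv) : J \in B ->
  boundary (\sum_(K <- B) a K *: e_itv D K)%R J.1 = a J.
Proof.
move=> JB; have [J1 J12 JD] := ad_bounds dB JB.
have bsum (r : seq nitv) : boundary (\sum_(K <- r) a K *: e_itv D K)%R J.1 =
    (\sum_(K <- r) a K * boundary (e_itv D K) J.1)%R.
  elim: r => [|K r IH]; first by rewrite !big_nil boundary0.
  by rewrite !big_cons boundary_lin IH.
rewrite bsum (bigD1_seq J) ?fset_uniq //= boundary_itv //.
have [-> -> _ _] := mem_arc_ends JB.
rewrite /= mulr1 big_seq_cond big1 ?addr0 // => K /andP[KB /eqP ne].
have [K1 K12 KD] := ad_bounds dB KB.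
by rewrite boundary_itv // (mem_arc_start JB KB (nesym ne)) addbb mulr0.
Qed.

(** The combination of the e_J with coefficients the jumps of v has the same
    jumps as v, and a vector is determined by its jumps. *)
Lemma mem_E_of_boundary v :
  (forall J : nitv, J \in B -> boundary v J.1 = boundary v J.2.+1) ->
  (forall x : nat, x \in U -> boundary v x = 0%R) -> v \in E_of D B.
Proof.
move=> v1 v2; set w := (\sum_(J <- B) boundary v (J : nitv).1 *: e_itv D J)%R.
have wE : w \in E_of D B.
  by rewrite /w big_seq; apply: memv_suml => J JB; rewrite memvZ ?e_itv_in.
suff -> : v = w by [].
have [w1 w2] := boundary_of_E wE.
have bE x : 0 < x <= D.+1 -> boundary v x = boundary w x.
  move=> Hx; have [xU|] := boolP (x \in U); first by rewrite v2 ?w2.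
  rewrite mem_free_edges Hx /= negbK => /is_endP[J JB HJ].
  have EJ : boundary v J.1 = boundary w J.1 by rewrite boundary_sum.
  by case: HJ => ->; rewrite // -v1 // -w1.
have cE x : x <= D -> entry v x = entry w x.
  elim: x => [_|x IH xD]; first by rewrite !entry_out.
  have := bE x.+1 (ltac:(lia)); rewrite /boundary /= IH; last exact: ltnW.
  by move/addrI.
by apply: entryP => x /andP[_ xD]; apply: cE.
Qed.

(** The interval jumps at its two ends only, so the arc of B that ends at J.1
    has the same two ends as J. *)
Lemma arc_of_E (J : nitv) : 0 < J.1 -> J.1 <= J.2 -> J.2 <= D ->
  e_itv D J \in E_of D B -> J \in B.
Proof.
move=> J1 J12 JD /boundary_of_E[b1 b2].
have bJ x : boundary (e_itv D J) x = ((x == J.1) || (x == J.2.+1))%:R%R.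
  rewrite boundary_itv //; congr ((nat_of_bool _)%:R)%R.
  by rewrite /mem_nitv; lia.
have nU : J.1 \notin U.
  by apply/negP => /b2; rewrite bJ eqxx => /eqP; rewrite oner_eq0.
have : is_end B J.1.
  by move: nU; rewrite mem_free_edges J1 leqW ?negbK //; lia.
case/is_endP => K KB HK; have [K1 K12 KD] := ad_bounds dB KB.
have := b1 K KB; rewrite !bJ => /(congr1 (fun a => a != 0%R)) /=.
rewrite !F2_natr_neq0 !oddb => HK'.
have [E1 E2] : J.1 = K.1 /\ J.2 = K.2.
  have lt : (J.1 == K.1) || (J.1 == K.2.+1) by lia.
  by clear -J12 K12 lt HK'; lia.
by case: J E1 E2 {J1 J12 JD b1 b2 bJ nU HK HK'} => a b /= -> ->; case: K KB {K1 K12 KD}.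
Qed.

End Span.

(** * Parity parts and orthogonals *)

Definition parity_part (D : nat) (rho : bool) (v : 'rV['F_2]_D) : 'rV['F_2]_D :=
  (\row_(i < D) if odd i.+1 == rho then v 0 i else 0)%R.

Lemma entry_parity_part D rho (v : 'rV['F_2]_D) x :
  entry (parity_part rho v) x = if odd x == rho then entry v x else 0%R.
Proof.
case: (boolP (0 < x <= D)) => H; last by rewrite !entry_out ?if_same.
case: x H => // x xD.
by rewrite -[x]/(nat_of_ord (Ordinal (xD : x < D))) !entry_ord mxE.
Qed.

Lemma parity_part_split D rho (v : 'rV['F_2]_D) :
  v = (parity_part rho v + parity_part (~~ rho) v)%R.
Proof.
apply: entryP => x _; rewrite entryD !entry_parity_part.
by case: rho; case: (odd x); rewrite /= ?addr0 ?add0r.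
Qed.

Lemma row_sum_e D (v : 'rV['F_2]_D) : v = (\sum_(i < D) v 0 i *: e D i.+1)%R.
Proof.
apply/rowP => j; rewrite summxE (bigD1 j) //= big1 => [|i ne].
  by rewrite addr0 !mxE eqxx mulr1.
by rewrite !mxE eqSS eq_sym val_eqE (negbTE ne) mulr0.
Qed.

Lemma memV_parity D rho v : (v \in V_parity D rho) <->
  (forall x, odd x != rho -> entry v x = 0%R).
Proof.
split.
  pose P (w : 'rV['F_2]_D) := forall x, odd x != rho -> entry w x = 0%R.
  move: v; apply: (@span_ind _ _ P) => [x _|a u w uP wP x Hx|w].
  - exact: entry0.
  - by rewrite entryD entryZ uP // wP // mulr0 addr0.
  - case/mapP => i; rewrite mem_filter => /andP[/eqP oi _] -> x Hx.
    rewrite entry_e; have [E|] := eqVneq x i; last by rewrite andbF.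
    by rewrite E oi eqxx in Hx.
move=> H; rewrite [v]row_sum_e; apply: memv_suml => i _.
have [oi|no] := boolP (odd i.+1 == rho); last first.
  by rewrite -entry_ord H // scale0r mem0v.
apply/memvZ/memv_span/map_f; rewrite mem_filter oi mem_iota /=.
by have := ltn_ord i; lia.
Qed.

Lemma parity_part_mem D rho (v : 'rV['F_2]_D) : parity_part rho v \in V_parity D rho.
Proof.
by apply/memV_parity => x /negbTE nx; rewrite entry_parity_part nx.
Qed.

(** The Gram matrix of the symplectic form in the basis of the e_i. *)
Definition nbr_mx (D : nat) : 'M['F_2]_D :=
  (\matrix_(j < D, i < D) ((i.+1 == j) || (j.+1 == i) :> nat)%N%:R)%R.

Lemma sformE D (x y : 'rV['F_2]_D) :
  sform x y = (\sum_(i < D) x 0 i * (y *m nbr_mx D) 0 i)%R.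
Proof.
apply: eq_bigr => i _; rewrite mxE big_distrr /= big_mkcond /=.
apply: eq_bigr => j _; rewrite mxE; case: (_ || _); first by rewrite mulr1.
by rewrite !mulr0.
Qed.

Lemma nbr_mxE D (y : 'rV['F_2]_D) (i : 'I_D) :
  (y *m nbr_mx D)%R 0%R i = (entry y i + entry y i.+2)%R.
Proof.
rewrite mxE /entry.
rewrite [X in _ = (X + _)%R]big_mkcond [X in _ = (_ + X)%R]big_mkcond -big_split.
apply: eq_bigr => j _ /=; rewrite mxE.
have [E1|n1] := eqVneq i.+1 (j : nat).
  have -> : (j.+1 == i) = false by lia.
  have -> : (j.+1 == i.+2) by lia.
  by rewrite mulr1 add0r.
have -> : (j.+1 == i.+2) = false by lia.
by case: (j.+1 == i); rewrite /= ?mulr1 ?mulr0 ?addr0.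
Qed.

Lemma sform_parity D rho (x y : 'rV['F_2]_D) : y \in V_parity D (~~ rho) ->
  sform (parity_part rho x) y = sform x y.
Proof.
move=> /memV_parity Hy; rewrite !sformE; apply: eq_bigr => i _.
rewrite nbr_mxE -[parity_part rho x _ _]entry_ord -[x _ _]entry_ord.
rewrite entry_parity_part; case: ifP => // /negbT ne.
by rewrite !Hy ?addr0 ?mulr0 //=; move: ne => /=; case: rho {Hy}; case: (odd i).
Qed.

(** The equations say that z_x = z_(x+2); start from z_0 = 0 for even positions
    and from z_(D+1) = 0 for odd positions when D is even. *)
Lemma nbr_mx_inj D rho (z : 'rV['F_2]_D) : (odd D -> rho = false) ->
  z \in V_parity D rho -> (z *m nbr_mx D = 0)%R -> z = 0%R.
Proof.
move=> HD /memV_parity Hz z0.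
have st x : x < D -> entry z x = entry z x.+2.
  move=> xD; have := nbr_mxE z (Ordinal xD); rewrite z0 mxE /= => /esym/eqP.
  by rewrite addF2_eq0 => /eqP.
apply: entryP => x Hx; rewrite entry0.
case: rho HD Hz => HD Hz; last first.
  have [ox|ex] := boolP (odd x); first by apply: Hz; rewrite ox.
  have -> : x = x./2.*2 by rewrite -[LHS]odd_double_half (negbTE ex).
  elim: (x./2) => [|n IH]; first by rewrite entry_out.
  have [lt|le] := ltnP n.*2 D; first by rewrite doubleS -st.
  by rewrite entry_out //; lia.
have eD : ~~ odd D by apply/negP => /HD.
have [ox|ex] := boolP (odd x); last by apply: Hz; rewrite (negbTE ex).
have -> : x = D.+1 - ((D.+1 - x)./2).*2 by lia.
elim: ((D.+1 - x)./2) => [|n IH]; first by rewrite subn0 entry_out //; lia.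
have [lt|le] := ltnP D (n.+1).*2; first by rewrite entry_out //; lia.
rewrite st; last by lia.
by have -> : (D.+1 - n.+1.*2).+2 = D.+1 - n.*2 by lia.
Qed.

(** Rows killed by the cokernel of a matrix belong to its row space; apply this
    to the functionals given by the form on a basis of F, then use
    nondegeneracy. *)
Lemma orth_sub D (delta : bool) (F F' : {vspace 'rV['F_2]_D}) : (odd D -> delta) ->
  (F <= V_parity D (~~ delta))%VS -> (F' <= V_parity D (~~ delta))%VS ->
  {subset orth delta [set x in F] <= orth delta [set x in F']} ->
  (F' <= F)%VS.
Proof.
move=> HD FV F'V sub; apply/subvP => y yF'.
pose A := (\matrix_(i < \dim F) (vbasis F)`_i)%R.
have Arow (i : 'I_(\dim F)) : row i A \in F.
  by rewrite rowK; apply: vbasis_mem; rewrite mem_nth ?size_tuple.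
have AF (w : 'rV['F_2]_(\dim F)) : (w *m A)%R \in F.
  by rewrite mulmx_sum_row; apply: memv_suml => i _; rewrite memvZ.
have FA f : f \in F -> exists w : 'rV['F_2]_(\dim F), f = (w *m A)%R.
  move=> fF; exists (\row_i vector.coord (vbasis F) i f)%R.
  rewrite mulmx_sum_row {1}(coord_vbasis fF); apply: eq_bigr => i _.
  by rewrite mxE rowK.
pose N := (A *m nbr_mx D)%R.
have sformM (x z : 'rV['F_2]_D) :
    sform x z = ((z *m nbr_mx D) *m x^T)%R 0%R 0%R.
  by rewrite sformE mxE; apply: eq_bigr => i _; rewrite [(x^T)%R _ _]mxE mulrC.
have : ((y *m nbr_mx D)%R <= N)%MS.
  rewrite submxE; apply/eqP/rowP => j; rewrite [in RHS]mxE.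
  pose x := ((col j (cokermx N))^T)%R.
  have xo f : f \in F -> sform x f = 0%R.
    move=> /FA[w ->]; rewrite sformM trmxK colE -[(w *m A *m _)%R]mulmxA -/N mulmxA.
    by rewrite -[(w *m N *m _)%R]mulmxA mulmx_coker mulmx0 mul0mx mxE.
  have /sub : parity_part delta x \in orth delta [set f in F].
    rewrite in_set parity_part_mem; apply/forall_inP => f; rewrite in_set => fF.
    by rewrite sform_parity ?xo // (subvP FV).
  rewrite in_set => /andP[_ /forall_inP/(_ y)]; rewrite in_set => /(_ yF')/eqP.
  rewrite sform_parity ?(subvP F'V) // sformM trmxK colE mulmxA -colE => <-.
  by rewrite [in RHS]mxE.
case/submxP => w Ew; have zV : (y - w *m A)%R \in V_parity D (~~ delta).
  by apply: memvB; [apply: (subvP F'V)|apply: (subvP FV)].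
have /eqP := nbr_mx_inj (rho := ~~ delta) (ltac:(by move=> /HD ->)) zV
  (ltac:(by rewrite mulmxBl Ew mulmxA subrr)).
by rewrite subr_eq0 => /eqP->.
Qed.

Section Parts.
Variables (D : nat) (B : {fset nitv}).
Hypothesis dB : arc_diagram D B.

(** A parity part of v jumps at an edge according to the coordinate of v at the
    adjacent position of that parity.  For the two ends of an arc these
    positions lie both inside or both outside it, and e_J takes equal values
    there. *)
Lemma parity_part_E rho (J : nitv) : J \in B ->
  parity_part rho (e_itv D J) \in E_of D B.
Proof.
move=> JB; have [J1 J12 JD] := ad_bounds dB JB.
apply: (mem_E_of_boundary dB) => [K KB|x xU];
  rewrite /boundary !entry_parity_part !entry_itv //.
  have [K1 K12 KD] := ad_bounds dB KB.
  have -> : odd K.1.-1 = odd K.2.+1 by have := ad_parity dB KB; lia.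
  rewrite (ad_parity dB KB) /=.
  have [->|/eqP ne] := eqVneq J K.
    by have [-> -> -> ->] := mem_arc_ends dB KB; rewrite addrC.
  by have [-> ->] := mem_arc_sides dB KB JB (nesym ne); rewrite addrC.
by have [-> ->] := not_mem_free dB JB xU; rewrite !if_same addr0.
Qed.

End Parts.

Definition E_parity_space (D : nat) (rho : bool) (B : {fset nitv}) :
    {vspace 'rV['F_2]_D} :=
  (E_of D B :&: V_parity D rho)%VS.

Lemma parity_part_E_space D rho (B : {fset nitv}) (J : nitv) : arc_diagram D B ->
  J \in B -> parity_part rho (e_itv D J) \in E_parity_space D rho B.
Proof.
by move=> dB JB; rewrite memv_cap parity_part_mem (parity_part_E dB).
Qed.

Lemma E_parity_space_orth D (delta : bool) (B B' : {fset nitv}) : (odd D -> delta) ->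
  orth delta (E_parity (E_of D B) (~~ delta)) =
  orth delta (E_parity (E_of D B') (~~ delta)) ->
  E_parity_space D (~~ delta) B = E_parity_space D (~~ delta) B'.
Proof.
move=> HD eqo; apply/eqP; rewrite eqEsubv.
by apply/andP; split; apply: (orth_sub HD); rewrite ?capvSr // => x;
   rewrite -[[set _ in _]]/(E_parity _ _) -[[set _ in _]]/(E_parity _ _) eqo.
Qed.

Lemma subgroup_pair_sub D delta (B B' : {fset nitv}) :
  arc_diagram D B -> arc_diagram D B' -> ~~ odd D ->
  subgroup_pair delta (E_of D B) = subgroup_pair delta (E_of D B') ->
  {subset B' <= B}.
Proof.
move=> dB dB' eD [eq1 eq2] J JB'.
have [J1 J12 JD] := ad_bounds dB' JB'.
apply: (arc_of_E dB) => //; rewrite [e_itv D J](parity_part_split delta).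
apply: memvD.
  have : parity_part delta (e_itv D J) \in E_parity (E_of D B') delta.
    by rewrite inE; apply: parity_part_E_space.
  by rewrite -eq1 inE memv_cap => /andP[].
have := parity_part_E_space (~~ delta) dB' JB'.
rewrite -(E_parity_space_orth _ eq2) ?(negbTE eD) //.
by rewrite memv_cap => /andP[].
Qed.

Lemma subgroup_pair_inj D delta (B B' : {fset nitv}) :
  arc_diagram D B -> arc_diagram D B' -> ~~ odd D ->
  subgroup_pair delta (E_of D B) = subgroup_pair delta (E_of D B') -> B = B'.
Proof.
move=> dB dB' eD eqs; apply/fsetP => J; apply/idP/idP.
  exact: (subgroup_pair_sub dB' dB eD (esym eqs)).
exact: (subgroup_pair_sub dB dB' eD eqs).
Qed.

Lemma ohead_filter (T : eqType) (P : pred T) (s : seq T) x :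
  ohead [seq y <- s | P y] = Some x -> P x /\ x \in s.
Proof.
move=> H; suff : x \in [seq y <- s | P y] by rewrite mem_filter => /andP.
by case: [seq _ <- _ | _] H => //= y t [->]; rewrite mem_head.
Qed.

Lemma u_tilde_even D (v : 'rV['F_2]_D) k : ~~ odd D ->
  u_fun v = ((-1) ^+ k * (uphalf k)%:R)%R -> u_tilde v = k.
Proof.
move=> eD uE; rewrite /u_tilde eD uE -signr_odd uphalf_half.
by have := odd_double_half k; case: (odd k) => /=; case: ifP; lia.
Qed.

(** * Types B and C *)

Lemma fibre_series_le1 (d : family_data) h gamma :
  (forall x y, x \in fd_M d -> y \in fd_M d ->
     fd_alpha x = Some h -> fd_alpha y = Some h ->
     x \in fd_HC d gamma -> y \in fd_HC d gamma -> x = y) ->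
  #|fd_fibre h :&: fd_HC d gamma| <= 1.
Proof.
move=> H; apply/card_le1_eqP => x y; rewrite !in_setI !in_set.
move=> /andP[/andP[xM /eqP ax] xs] /andP[/andP[yM /eqP ay] ys].
exact: H yM xM ay ax ys xs.
Qed.

Lemma mem_pairs (s : seq {fset nitv}) (t : {fset nitv} -> seq nat) B k :
  (B, k) \in [seq (B, k) | B <- s, k <- t B] -> B \in s /\ k \in t B.
Proof.
move=> H; have [B' [k' [Bs kt [-> ->]]]] := elimT
  (@allpairsPdep _ (fun=> nat) _ (fun B k => (B, k)) s t (B, k)) H.
by [].
Qed.

Lemma BC_transversal D (eD : ~~ odd D) delta gamma h :
  #|@fd_fibre (data_BC D delta) h :&: fd_HC (data_BC D delta) gamma| <= 1.
Proof.
have key v : alpha_BC delta v = Some h -> u_tilde v = gamma ->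
    exists B, [/\ B \in S_ D, subgroup_pair delta (E_of D B) = h &
                  v = epsilon D (Bk D B gamma)].
  rewrite /alpha_BC; case E : (ohead _) => [[B k]|//] [hE] uv.
  have [/eqP /= vE] := ohead_filter E.
  move/mem_pairs => [BS kk].
  have dB := S_arc_diagram BS.
  have Hk : 2 * k <= last_free D B.
    move: kk; rewrite mem_iota /last_free (negbTE eD) /Delta.
    have := size_free_edges dB; lia.
  exists B; split=> //; rewrite -uv -vE; congr (epsilon D (Bk D B _)).
  by rewrite (u_tilde_even eD (u_fun_epsilon dB Hk _)) // (negbTE eD).
apply: fibre_series_le1 => v w _ _ av aw; rewrite !in_set => /eqP uv /eqP uw.
have [B [BS hB ->]] := key v av uv; have [B' [BS' hB' ->]] := key w aw uw.
have -> // : B = B'.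
apply: (@subgroup_pair_inj D delta) => //; try exact: S_arc_diagram.
by rewrite hB hB'.
Qed.

(** * Type D *)

Lemma addvv_F2 D (v : 'rV['F_2]_D) : (v + v = 0)%R.
Proof.
apply/rowP => i; rewrite !mxE.
by apply/eqP; rewrite addF2_eq0.
Qed.

Lemma entry_eta D x : entry (eta D) x = ((0 < x <= D) && odd x)%N%:R%R.
Proof.
rewrite /eta entry_sum; case: (boolP (0 < x <= D)) => H /=; last first.
  by rewrite big1 // => i _; rewrite entry_out.
rewrite big_mkcond (bigD1_seq x) ?iota_uniq ?mem_index_iota //=.
rewrite entry_e H eqxx big1 ?addr0; first by case: (odd x).
by move=> i /negbTE ne; rewrite entry_e eq_sym ne andbF if_same.
Qed.

Lemma pi_D_eq D (a b : 'rV['F_2]_D) :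
  pi_D a = pi_D b <-> (a = b \/ a = b + eta D)%R.
Proof.
have nrm (v : 'rV['F_2]_D) : v \in 'N(<[eta D]>)%g.
  apply: (subsetP (sub_abelian_norm (FinRing.zmod_abelian [set: 'rV['F_2]_D]) _)).
    exact: subsetT.
  exact: in_setT.
have mem z : z \in <[eta D]>%g <-> (z = 0 \/ z = eta D)%R.
  split=> [/cycleP[i ->]|[->|->]]; last 2 first.
  - exact: group1.
  - exact: cycle_id.
  rewrite FinRing.zmodXgE -(odd_double_half i) mulrnDr -mul2n mulrnA mulr2n addvv_F2.
  by rewrite mul0rn addr0; case: (odd i); [right|left].
rewrite /pi_D; split=> [/(rcoset_kercosetP (nrm a) (nrm b))|H].
  rewrite mem_rcoset FinRing.zmodMgE FinRing.zmodVgE => /mem[|] E.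
    by left; apply/eqP; rewrite -subr_eq0 E.
  by right; rewrite -E addrC subrK.
apply/(rcoset_kercosetP (nrm a) (nrm b)).
rewrite mem_rcoset FinRing.zmodMgE FinRing.zmodVgE; apply/mem.
by case: H => ->; [left; rewrite subrr|right; rewrite addrAC subrr add0r].
Qed.

Lemma nbr_mx_sym D : ((nbr_mx D)^T = nbr_mx D)%R.
Proof. by apply/matrixP => i j; rewrite !mxE orbC. Qed.

Lemma sform_mx D (x y : 'rV['F_2]_D) :
  sform x y = (y *m nbr_mx D *m x^T)%R 0%R 0%R.
Proof.
by rewrite sformE mxE; apply: eq_bigr => i _; rewrite [(x^T)%R _ _]mxE mulrC.
Qed.

Lemma sformC D (x y : 'rV['F_2]_D) : sform x y = sform y x.
Proof.
rewrite !sform_mx; set M := (_ *m _)%R; have -> : M = M^T%R.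
  by apply/matrixP => i j; rewrite [RHS]mxE !ord1.
by rewrite !trmx_mul trmxK nbr_mx_sym mulmxA.
Qed.

(** The vector eta_D is in the radical of the form. *)
Lemma sform_eta D (x y : 'rV['F_2]_D) : odd D -> sform (x + eta D)%R y = sform x y.
Proof.
move=> oD; rewrite ![sform _ y]sformC !sform_mx mulmxDl.
suff -> : (eta D *m nbr_mx D)%R = 0%R by rewrite addr0.
apply/rowP => i; rewrite nbr_mxE !entry_eta mxE addF2_bool.
by have iD := ltn_ord i; rewrite (_ : _ (+) _ = false) //=; lia.
Qed.

Lemma eta_parity D : eta D \in V_parity D true.
Proof.
apply/memV_parity => x /negbTE nx; rewrite entry_eta; move: nx.
by case: (odd x); rewrite ?andbF.
Qed.

Section TypeD.
Variable D : nat.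
Hypothesis oD : odd D.

Lemma boundary_eta x : 0 < x <= D.+1 -> boundary (eta D) x = 1%R.
Proof.
move=> Hx; rewrite /boundary !entry_eta addF2_bool.
by rewrite (_ : _ (+) _ = true) //; lia.
Qed.

(** The vector eta_D jumps at every edge, so e_J + eta_D jumps at all edges but
    the ends of J, whereas vectors of E_B do not jump at free edges. *)
Lemma free_of_eta (B : {fset nitv}) (J : nitv) x : arc_diagram D B ->
  0 < J.1 -> J.2 <= D -> (e_itv D J + eta D)%R \in E_of D B ->
  x \in free_edges D B -> x = J.1 \/ x = J.2.+1.
Proof.
move=> dB J1 JD /(boundary_of_E dB)[_ b2] xU; have := b2 _ xU.
have Hx : 0 < x <= D.+1 by move: xU; rewrite mem_free_edges => /andP[].
rewrite -[e_itv D J]scale1r boundary_lin mul1r boundary_eta // boundary_itv //.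
rewrite -[X in (_ + X)%R]/(true%:R)%R addF2_bool => /eqP.
rewrite -[_ == _]negbK F2_natr_neq0 oddb addbT negbK /mem_nitv; lia.
Qed.

(** The second subgroup is the image of the orthogonal of E^0, which contains
    eta_D, so it still determines E^0; the first one gives E^1 up to eta_D. *)
Lemma subgroup_pair_D_sub (B B' : {fset nitv}) (J : nitv) :
  arc_diagram D B -> arc_diagram D B' ->
  subgroup_pair_D (E_of D B) = subgroup_pair_D (E_of D B') ->
  J \in B' -> J \in B \/
  (forall x, x \in free_edges D B -> x = J.1 \/ x = J.2.+1).
Proof.
move=> dB dB' [eq1 eq2] JB'; have [J1 J12 JD] := ad_bounds dB' JB'.
have orth_le (C C' : {fset nitv}) :
    pi_D (D := D) @: orth true (E_parity (E_of D C) false) =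
    pi_D (D := D) @: orth true (E_parity (E_of D C') false) ->
    orth true (E_parity (E_of D C) false) \subset
    orth true (E_parity (E_of D C') false).
  move=> eqC; apply/subsetP => x xC.
  have /imsetP[y yC' /pi_D_eq[->|->]] //: pi_D x \in
    pi_D (D := D) @: orth true (E_parity (E_of D C') false).
    by rewrite -eqC imset_f.
  move: yC'; rewrite !in_set => /andP[yV /forall_inP yo].
  rewrite memvD ?eta_parity //=; apply/forall_inP => f /yo.
  by rewrite sform_eta.
have eqo : orth true (E_parity (E_of D B) false) =
           orth true (E_parity (E_of D B') false).
  by apply/eqP; rewrite eqEsubset !orth_le.
have part0 : parity_part false (e_itv D J) \in E_of D B.
  have := parity_part_E_space false dB' JB'.
  by rewrite -(@E_parity_space_orth D true B B' _ eqo) // memv_cap => /andP[].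
have : pi_D (parity_part true (e_itv D J)) \in
    pi_D (D := D) @: E_parity (E_of D B) true.
  by rewrite eq1 imset_f // in_set; apply: parity_part_E_space.
case/imsetP => f; rewrite in_set memv_cap => /andP[fE _] /pi_D_eq[] E.
  left; apply: (arc_of_E dB) => //.
  by rewrite [e_itv D J](parity_part_split true) E memvD.
right=> x; apply: (free_of_eta dB) => //.
rewrite [e_itv D J](parity_part_split true) E.
by rewrite addrAC -(addrA f) addvv_F2 addr0 memvD.
Qed.

(** If B lies in [1, D-1], the edge D + 1 is free and is not an end of an
    interval of a second such diagram.  If B is small, it has at least three
    free edges, too many to be ends of one interval; then the inclusion of
    the other diagram follows from its cardinality. *)
Lemma subgroup_pair_D_inj (B B' : {fset nitv}) :
  arc_diagram D B -> arc_diagram D B' ->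
  arc_diagram D.-1 B \/ #|` B| < D.-1./2 ->
  arc_diagram D.-1 B' \/ #|` B'| < D.-1./2 ->
  subgroup_pair_D (E_of D B) = subgroup_pair_D (E_of D B') -> B = B'.
Proof.
move=> dB dB' oB oB' eqh.
have few (C : {fset nitv}) (J : nitv) : arc_diagram D C -> #|` C| < D.-1./2 ->
    ~ (forall x, x \in free_edges D C -> x = J.1 \/ x = J.2.+1).
  move=> dC cC H; have sU := size_free_edges dC.
  suff : size (free_edges D C) <= size [:: J.1; J.2.+1] by rewrite /=; lia.
  apply: uniq_leq_size; first exact: free_edges_uniq.
  by move=> x /H[]->; rewrite !inE eqxx ?orbT.
have narrow (C C' : {fset nitv}) (J : nitv) : arc_diagram D.-1 C ->
    arc_diagram D.-1 C' -> J \in C' ->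
    ~ (forall x, x \in free_edges D C -> x = J.1 \/ x = J.2.+1).
  move=> dC dC' JC' H; have [J1 J12 JD] := ad_bounds dC' JC'.
  have /H : D.+1 \in free_edges D C.
    rewrite mem_free_edges leqnn /=; apply/negP => /is_endP[K KC].
    by have [] := ad_bounds dC KC; lia.
  lia.
have sub (C C' : {fset nitv}) : arc_diagram D C -> arc_diagram D C' ->
    subgroup_pair_D (E_of D C) = subgroup_pair_D (E_of D C') ->
    (#|` C| < D.-1./2 \/ arc_diagram D.-1 C /\ arc_diagram D.-1 C') ->
    C' `<=` C.
  move=> dC dC' eqC H; apply/fsubsetP => J JC'.
  have [//|F] := subgroup_pair_D_sub dC dC' eqC JC'.
  by case: H => [/(few _ _ dC)/(_ F)|[nC nC']] //; case: (narrow _ _ _ nC nC' JC').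
case: oB oB' => [nB|cB] [nB'|cB'].
- by apply/eqP; rewrite eqEfsubset !sub //; right.
- have BB' : B `<=` B' by apply: (sub _ _ dB' dB (esym eqh)); left.
  have cB := leq_ltn_trans (fsubset_leq_card BB') cB'.
  by apply/eqP; rewrite eqEfsubset BB' sub //; left.
- have B'B : B' `<=` B by apply: (sub _ _ dB dB' eqh); left.
  have cB' := leq_ltn_trans (fsubset_leq_card B'B) cB.
  by apply/eqP; rewrite eqEfsubset B'B sub //; left.
- by apply/eqP; rewrite eqEfsubset !sub //; left.
Qed.

(** Adding eta_D exchanges jumps and non-jumps, and the signs of the D + 1 edges
    add up to zero. *)
Lemma u_fun_eta (v : 'rV['F_2]_D) : (u_fun (v + eta D) = - u_fun v)%R.
Proof.
apply/eqP; rewrite -(@eqr_pMn2r _ 2) // mulNrn; apply/eqP.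
rewrite !u_fun_jumps; apply/eqP; rewrite -subr_eq0 opprK -big_split.
have alt n : (\sum_(x <- iota 1 n) (-1) ^+ x = - (odd n)%:R :> int)%R.
  elim: n => [|n IH]; first by rewrite big_nil oppr0.
  rewrite -(addn1 n) iotaD big_cat big_seq1 IH add1n addn1.
  by rewrite -signr_odd /=; case: (odd n).
rewrite (eq_big_seq (fun x : nat => (-1) ^+ x)%R) => [|x].
  by rewrite alt /= oD oppr0.
rewrite mem_iota => Hx /=; rewrite -mulrDl.
have := boundary_eta (Hx : 0 < x <= D.+1); rewrite /boundary => be.
rewrite !suppE !entryD.
have -> : entry (eta D) x = (1 + entry (eta D) x.-1)%R.
  by rewrite -be addrAC (_ : entry (eta D) x.-1 + _ = 0)%R ?add0r //; apply/eqP;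
     rewrite addF2_eq0.
move: (entry v x) (entry v x.-1) (entry (eta D) x.-1).
case=> [[|[|[]]] ?] // [[|[|[]]] ?] // [[|[|[]]] ?] //=; exact: mul1r.
Qed.

End TypeD.

Lemma mem_span_pred D (w : 'rV['F_2]_D) : 0 < D ->
  (w \in <<[seq e D i | i <- iota 1 D.-1]>>%VS) = (entry w D == 0%R).
Proof.
move=> D0; apply/idP/eqP => [|w0].
  move: w; apply: (@span_ind _ _ (fun w => entry w D = 0%R)) => [|a u w u0 w0|w].
  - exact: entry0.
  - by rewrite entryD entryZ u0 w0 mulr0 addr0.
  - case/mapP => i; rewrite mem_iota => Hi ->; rewrite entry_e.
    by have [E|] := eqVneq D i; [lia|rewrite andbF].
rewrite [w]row_sum_e; apply: memv_suml => i _.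
have [E|ne] := eqVneq i.+1 D; first by rewrite -entry_ord E w0 scale0r mem0v.
apply/memvZ/memv_span/map_f; rewrite mem_iota.
by have := ltn_ord i; lia.
Qed.

Lemma pi_D_sectionP D (v : 'rV['F_2]_D) : odd D ->
  pi_D_section (pi_D v) =
  (if entry v D == 0 then v else v + eta D)%R.
Proof.
move=> oD; have D0 : 0 < D by case: D oD v.
have eD : entry (eta D) D = 1%R by rewrite entry_eta D0 leqnn oD.
rewrite /pi_D_section; case: pickP => [w|none] /=.
  rewrite mem_span_pred // => /andP[/eqP wD /eqP/pi_D_eq[E|E]].
    by rewrite -E wD eqxx.
  have vD : entry v D = 1%R.
    by apply/eqP; rewrite -addF2_eq0 -eD -entryD -E wD.
  by rewrite vD oner_eq0.
have [v0|v1] := eqVneq (entry v D) 0%R.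
  by have := none v; rewrite mem_span_pred // v0 !eqxx.
have := none (v + eta D)%R; rewrite mem_span_pred // entryD eD addF2_eq0.
have -> : entry v D = 1%R.
  by move: (entry v D) v1; case=> [[|[|[]]] ?] //= _; apply: val_inj.
rewrite eqxx /= => /negP[]; apply/eqP/pi_D_eq; by right.
Qed.

Lemma u_tilde_neg D (v : 'rV['F_2]_D) k : odd D -> k = 0 \/ odd k ->
  u_fun v = ((-1) ^+ k * (uphalf k)%:R)%R ->
  u_tilde v = if k == 0 then 0 else k.+2.
Proof.
move=> oD ok uE; rewrite /u_tilde oD uE -signr_odd uphalf_half /=.
case: ok => [-> //|ok]; rewrite ok.
have := odd_double_half k; rewrite ok; case: eqP => [->|] //= k0.
by case: ifP; [lia|case: ifP; lia].
Qed.

Lemma u_tilde_pos D (v : 'rV['F_2]_D) k : odd D -> odd k ->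
  u_fun v = (uphalf k)%:R%R -> u_tilde v = k.
Proof.
move=> oD ok uE; rewrite /u_tilde oD uE uphalf_half ok /=.
by have := odd_double_half k; rewrite ok; case: ifP; [lia|case: ifP; lia].
Qed.

Lemma pairs_DP D (B : {fset nitv}) k : odd D -> (B, k) \in pairs_D D ->
  [/\ arc_diagram D B, arc_diagram D.-1 B \/ #|` B| < D.-1./2,
      2 * k <= last_free D B, k = 0 \/ odd k &
      odd k || (D.+1 \in free_edges D B)].
Proof.
move=> oD; have lastE (dB : arc_diagram D B) : 0 < k ->
    k <= (D - 2 * #|` B| - 1)./2 -> 2 * k <= last_free D B.
  by rewrite /last_free oD /Delta; lia.
rewrite mem_cat => /orP[]; rewrite mem_filter => /andP[Hk].
  move/mem_pairs => [/S_arc_diagram dB' _]; rewrite /= in Hk.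
  have dB : arc_diagram D B by apply: arc_diagram_widen dB'; apply: leq_pred.
  have DU : D.+1 \in free_edges D B.
    rewrite mem_free_edges leqnn /=; apply/negP => /is_endP[K KB].
    by have [] := ad_bounds dB' KB; lia.
  rewrite DU orbT; case/orP: Hk => [/eqP->|/andP[ok kle]].
    by split; rewrite ?muln0 //; left.
  by split=> //; [left|apply: lastE => //; case: (k) ok|right].
move/mem_pairs => [/S_arc_diagram dB _]; rewrite /= in Hk.
case/and3P: Hk => _ cB /andP[ok kle].
by split=> //; [right|apply: lastE => //; case: (k) ok|right|rewrite ok].
Qed.

Lemma u_tilde'_epsilon D (B : {fset nitv}) k : odd D -> (B, k) \in pairs_D D ->
  u_tilde' (pi_D (epsilon D (Bk D B k))) =
  if D.+1 \in free_edges D B then (if k == 0 then 0 else k.+2) else k.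
Proof.
move=> oD /(pairs_DP oD)[dB _ Hk ok okU]; rewrite /u_tilde' pi_D_sectionP //.
have := supp_last dB Hk (fun=> ok) oD okU; rewrite suppE.
have uE := u_fun_epsilon dB Hk (fun=> ok).
case: (boolP (D.+1 \in _)) => DU /= => [/negbFE ->|/negbTE ->].
  exact: u_tilde_neg.
have {}ok : odd k by move: okU; rewrite (negbTE DU) orbF.
apply: u_tilde_pos => //; rewrite u_fun_eta // uE -signr_odd ok.
by rewrite mulN1r opprK.
Qed.

Lemma D_transversal D (oD : odd D) gamma h :
  #|@fd_fibre (data_D D) h :&: fd_HC (data_D D) gamma| <= 1.
Proof.
have key x : alpha_D x = Some h -> exists B k, [/\ (B, k) \in pairs_D D,
    subgroup_pair_D (E_of D B) = h & x = pi_D (epsilon D (Bk D B k))].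
  rewrite /alpha_D; case E : (ohead _) => [[B k]|//] [hE].
  by have [/eqP /= xE BkD] := ohead_filter E; exists B, k.
apply: fibre_series_le1 => x y _ _ ax ay; rewrite !in_set => /eqP ux /eqP uy.
have [B [k [BkD hB xE]]] := key x ax; have [B' [k' [BkD' hB' yE]]] := key y ay.
have [dB oB _ ok okU] := pairs_DP oD BkD.
have [dB' oB' _ ok' okU'] := pairs_DP oD BkD'.
have EB : B = B' by apply: (subgroup_pair_D_inj oD) => //; rewrite hB hB'.
rewrite -{}EB in BkD' yE.
have : u_tilde' x = u_tilde' y by rewrite ux uy.
rewrite xE yE !u_tilde'_epsilon // => Ek.
suff Ekk : k = k' by rewrite Ekk.
by move: Ek; case: ifP => // _; case: eqP; case: eqP => //; lia.
Qed.

(** * The set M(Gamma) *)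

Section MGammaTheory.
Variables (gT : finGroupType) (G : {group gT}).
Implicit Types p q r : Mpair G.
Local Open Scope group_scope.

Lemma Mpair_conjP p q : reflect
  (exists g, [/\ g \in G, tag q = tag p ^ g & forall y, y \in 'C_G[tag p] ->
     ('chi[_]_(tagged q))%R (y ^ g) = ('chi[_]_(tagged p))%R y])
  (Mpair_conj p q).
Proof.
apply: (iffP exists_inP) => [[g gG /andP[/eqP eqt /forall_inP H]]|[g [gG eqt H]]].
  by exists g; split=> // y yC; apply/eqP/H.
exists g => //; apply/andP; split; first exact/eqP.
by apply/forall_inP => y yC; apply/eqP/H.
Qed.

Lemma mem_centraliserJ x y g : g \in G -> y \in 'C_G[x] -> y ^ g \in 'C_G[x ^ g].
Proof.
move=> gG /setIP[yG /cent1P cyx]; apply/setIP; split; first by rewrite groupJ.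
by apply/cent1P; rewrite /commute -!conjMg cyx.
Qed.

Lemma Mpair_conj_refl : reflexive (@Mpair_conj _ G).
Proof.
move=> p; apply/Mpair_conjP; exists 1.
by split=> [||y _]; rewrite ?group1 ?conjg1.
Qed.

Lemma Mpair_conj_sym p q : Mpair_conj p q -> Mpair_conj q p.
Proof.
case/Mpair_conjP => g [gG eqt H]; apply/Mpair_conjP; exists g^-1.
split=> [||y yC]; rewrite ?groupV ?eqt ?conjgK // -H ?conjgKV //.
by have := mem_centraliserJ (groupVr gG) yC; rewrite eqt conjgK.
Qed.

Lemma Mpair_conj_trans : transitive (@Mpair_conj _ G).
Proof.
move=> q p r /Mpair_conjP[g [gG eqt H]] /Mpair_conjP[h [hG eqt' H']].
apply/Mpair_conjP; exists (g * h).
split=> [||y yC]; rewrite ?groupM ?eqt' ?eqt ?conjgM // H' ?H //.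
by rewrite eqt mem_centraliserJ.
Qed.

Lemma Mpair_conj_equiv :
  {in [set p : Mpair G | tag p \in G] & &, equivalence_rel (@Mpair_conj _ G)}.
Proof.
move=> p q r _ _ _; split; first exact: Mpair_conj_refl.
move=> pq; apply/idP/idP; last exact: Mpair_conj_trans pq.
exact: Mpair_conj_trans (Mpair_conj_sym pq).
Qed.

Lemma MGamma_conj m p q : m \in MGamma G -> p \in m -> (q \in m) ->
  Mpair_conj p q.
Proof.
have partM := equivalence_partitionP Mpair_conj_equiv.
have /and3P[/eqP cov triv _] := partM => mM pm qm.
have pD : p \in [set p : Mpair G | tag p \in G].
  by rewrite -cov; apply/bigcupP; exists m.
have qD : q \in [set p : Mpair G | tag p \in G].
  by rewrite -cov; apply/bigcupP; exists m.
by rewrite -(pblock_equivalence_partition Mpair_conj_equiv) // (def_pblock triv mM pm).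
Qed.

Lemma MGamma_eq m m' p : m \in MGamma G -> m' \in MGamma G ->
  p \in m -> p \in m' -> m = m'.
Proof.
have /and3P[_ triv _] := equivalence_partitionP Mpair_conj_equiv => mM mM' pm pm'.
by rewrite -(def_pblock triv mM pm) (def_pblock triv mM' pm').
Qed.

Lemma MclassP m x f : reflect
  (m \in MGamma G /\ exists2 i : Iirr 'C_G[x], Tagged _ i \in m &
     {in 'C_G[x], ('chi_i)%R =1 f})
  (m \in Mclass G (x, f)).
Proof.
rewrite inE; apply: (iffP andP) => [[mM ex]|[mM [i im H]]]; split=> //.
  case/exists_inP: ex => -[x' i] pm /andP[/eqP /= E /forall_inP /= H]; subst x'.
  by exists i => // y yC; apply/eqP/H.
apply/exists_inP; exists (existT (fun x => Iirr 'C_G[x]) x i) => //.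
apply/andP; split; first exact/eqP.
by apply/forall_inP => y yC; apply/eqP/H.
Qed.

Lemma Mclass_eq m m' l : m \in Mclass G l -> m' \in Mclass G l -> m = m'.
Proof.
case: l => x f /MclassP[mM [i im H]] /MclassP[mM' [j jm H']].
have Eij : i = j by apply/irr_inj/cfun_inP => y yC; rewrite H ?H'.
by apply: (MGamma_eq mM mM' im); rewrite Eij.
Qed.

Lemma Mclass_conj m x x' f f' : m \in Mclass G (x, f) ->
  m \in Mclass G (x', f') -> exists2 g, g \in G & x' = x ^ g.
Proof.
move=> /MclassP[mM [i im _]] /MclassP[_ [j jm _]].
by have /Mpair_conjP[g [gG /= E _]] := MGamma_conj mM im jm; exists g.
Qed.

(** Two pairs over the same x in one class are conjugate by an element of the
    centraliser of x, which fixes its characters. *)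
Lemma Mclass_same m x f f' y : m \in Mclass G (x, f) ->
  m \in Mclass G (x, f') -> y \in 'C_G[x] -> f y = f' y.
Proof.
move=> /MclassP[mM [i im H]] /MclassP[_ [j jm H']] yC.
have /Mpair_conjP[g [gG /= E chi]] := MGamma_conj mM im jm.
have gC : g \in 'C_G[x].
  rewrite inE gG; apply/cent1P; rewrite /commute.
  by rewrite [RHS]conjgC -E.
by rewrite -H // -chi // cfunJ // H'.
Qed.

End MGammaTheory.

Section Classes.
Variable m : nat.
Local Notation Sn := [set: 'S_m.+1]%G.

Lemma in_classes_of (L : seq (label m)) x :
  (x \in classes_of L) = has (fun l => x \in Mclass Sn l) L.
Proof.
rewrite /classes_of /Mclasses; elim: L => [|l L IH]; first by rewrite big_nil inE.
by rewrite big_cons in_setU IH.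
Qed.

Lemma alpha_table_cons (r : table_row m) T x :
  alpha_table (r :: T) x =
  if x \in classes_of r.2 then Some r.1 else alpha_table T x.
Proof. by rewrite /alpha_table /=; case: ifP. Qed.

Lemma alpha_table_row (T : seq (table_row m)) x h r0 : uniq (unzip1 T) ->
  alpha_table T x = Some h -> index h (unzip1 T) < size T /\
  x \in classes_of (nth r0 T (index h (unzip1 T))).2.
Proof.
elim: T => // r T IH /= /andP[nr uT]; rewrite alpha_table_cons.
case: ifP => [xr [<-]|_ /(IH uT)[lt xh]]; first by rewrite eqxx.
case: eqP => [E|_] //=; move: lt; rewrite -(size_map fst) index_mem => hT.
by rewrite E hT in nr.
Qed.

End Classes.

(** * Computing in the symmetric groups *)

Definition swap (i j k : nat) : nat :=
  if k == i then j else if k == j then i else k.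

Section Acts.
Variable m : nat.
Implicit Types (x y : 'S_m.+1) (f g : nat -> nat).

(** Permutations of 'I_m.+1 do not compute; a function on nat giving their
    values does. *)
Definition acts x f : Prop :=
  forall k, k <= m -> f k <= m /\ x (inord k) = inord (f k).

Lemma inord_eq (i j : nat) : i <= m -> j <= m ->
  ((inord i : 'I_m.+1) == inord j) = (i == j).
Proof. by move=> im jm; rewrite -val_eqE /= !inordK. Qed.

Lemma acts1 : acts 1%g id.
Proof. by move=> k km; rewrite perm1. Qed.

Lemma acts_tr i j : i <= m -> j <= m -> acts (tr m i j) (swap i j).
Proof.
move=> im jm k km; rewrite /swap; split; first by case: ifP => // _; case: ifP.
rewrite /tr permE /= !inord_eq //.
by case: ifP => // _; case: ifP.
Qed.

Lemma actsM x y f g : acts x f -> acts y g -> acts (x * y)%g (g \o f).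
Proof.
by move=> ax ay k km; have [fm xE] := ax k km; rewrite permM xE; apply: ay.
Qed.

Lemma acts_eqE x y f g : acts x f -> acts y g ->
  (x == y) = all (fun k => f k == g k) (iota 0 m.+1).
Proof.
move=> ax ay; apply/eqP/allP => [E k|H].
  rewrite mem_iota add0n ltnS => /andP[_ km].
  have [fm xE] := ax k km; have [gm yE] := ay k km.
  by rewrite -inord_eq // -xE -yE E.
apply/permP => i; rewrite -(inord_val i).
have im : i <= m by rewrite -ltnS.
have [fm ->] := ax i im; have [gm ->] := ay i im.
by have /eqP -> := H i ltac:(by rewrite mem_iota).
Qed.

Lemma card_inord (P : pred 'I_m.+1) (Q : pred nat) :
  (forall k, k <= m -> P (inord k) = Q k) ->
  #|[set i | P i]| = count Q (iota 0 m.+1).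
Proof.
move=> PQ; rewrite cardE /enum_mem -enumT size_filter -val_enum_ord count_map.
apply: eq_count => i; rewrite -[LHS]/(i \in [set i | P i]) inE /=.
by rewrite -PQ ?inord_val // -ltnS.
Qed.

(** The number of fixed points and the sign separate the conjugacy classes that
    occur in the tables of S_2, S_4 and S_5. *)
Definition cycle_invariant x : nat * bool := (#|[set i | x i == i]|, odd_perm x).

Lemma cycle_invariantJ x y : cycle_invariant (x ^ y)%g = cycle_invariant x.
Proof.
congr pair; last by rewrite /conjg !odd_permM odd_permV addbCA addbb addbF.
rewrite -(card_preimset _ (@perm_inj _ y)); congr #|pred_of_set _|.
by apply/setP => i; rewrite !inE permJ (inj_eq perm_inj).
Qed.

Lemma cycle_invariant_acts x f b : acts x f -> odd_perm x = b ->
  cycle_invariant x = (count (fun k => f k == k) (iota 0 m.+1), b).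
Proof.
move=> ax <-; congr pair; apply: card_inord => k km.
by have [fm ->] := ax k km; rewrite inord_eq.
Qed.

Lemma odd_tr i j : i <= m -> j <= m -> odd_perm (tr m i j) = (i != j).
Proof. by move=> im jm; rewrite odd_tperm inord_eq. Qed.

Lemma in_points (s : seq nat) k : k <= m -> all (fun i => i <= m) s ->
  ((inord k : 'I_m.+1) \in points m s) = (k \in s).
Proof.
move=> km /allP sm; rewrite inE; apply/mapP/idP => [[i /[dup] iS /sm im]|kS].
  by move/eqP; rewrite inord_eq // => /eqP ->.
by exists k.
Qed.

Lemma mem_H k x f : acts x f ->
  (x \in H_ k) = all (fun i => (f i == i) || (i < k)) (iota 0 m.+1).
Proof.
move=> ax; rewrite inE; apply/subsetP/allP => [H i|H i].
  rewrite mem_iota add0n ltnS => /andP[_ im].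
  have [fm xE] := ax i im; have := H (inord i).
  rewrite !inE xE !inord_eq // inordK // => Hi.
  by case: eqP Hi => //= _ /(_ isT).
rewrite inE; have im : i <= m by rewrite -ltnS.
have [fm xE] := ax i im; rewrite inord_val in xE.
rewrite inE /=; have := H i (ltac:(by rewrite mem_iota)).
by case/orP => [/eqP E|//]; rewrite xE E inord_val eqxx.
Qed.

Lemma mem_points_prod (s t : seq nat) x f : acts x f ->
  all (fun i => i <= m) s -> all (fun i => i <= m) t ->
  all (fun i => i \notin t) s ->
  x \in (perm.Sym (points m s) * perm.Sym (points m t))%g ->
  all (fun i => f i \in s) s && all (fun i => f i \in t) t.
Proof.
move=> ax sm tm /allP st /mulsgP[u v]; rewrite !inE => us vt xE.
have out i : i \in s -> (inord i : 'I_m.+1) \notin points m t.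
  by move=> iS; rewrite in_points ?st ?(allP sm).
apply/andP; split; apply/allP => i iS.
  have im := allP sm i iS; have [fm xi] := ax i im.
  rewrite -(in_points fm sm) -xi xE permM.
  have ui : u (inord i) \in points m s by rewrite perm_closed // in_points.
  rewrite (out_perm vt) //; move: ui; rewrite inE => /mapP[j js ->].
  exact: out.
have im := allP tm i iS; have [fm xi] := ax i im.
rewrite -(in_points fm tm) -xi xE permM.
have -> : u (inord i) = inord i.
  apply: (out_perm us); rewrite in_points //.
  by apply: contraL iS => /st.
by rewrite perm_closed // in_points.
Qed.

Lemma prod_left (A B : {set 'I_m.+1}) x : x \in perm.Sym A ->
  x \in (perm.Sym A * perm.Sym B)%g.
Proof. by move=> xA; rewrite -[x]mulg1 mem_mulg ?group1. Qed.

Lemma prod_right (A B : {set 'I_m.+1}) x : x \in perm.Sym B ->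
  x \in (perm.Sym A * perm.Sym B)%g.
Proof. by move=> xB; rewrite -[x]mul1g mem_mulg ?group1. Qed.

Lemma tr_Sym i j (s : seq nat) : i \in s -> j \in s ->
  tr m i j \in perm.Sym (points m s).
Proof.
move=> iS jS; rewrite inE; apply/subsetP => k; rewrite inE.
by case: tpermP => [-> _|-> _|]; rewrite ?eqxx // inE map_f.
Qed.

Lemma tr_conj_Sym i j u : i <= m -> j <= m -> i != j ->
  perm_on (points m [:: i; j]) u -> (tr m i j ^ u = tr m i j)%g.
Proof.
move=> im jm ne uij; rewrite /tr tpermJ.
have cl k : k \in [:: i; j] -> u (inord k) = inord i \/ u (inord k) = inord j.
  move=> kij; have km : k <= m by move: kij; rewrite !inE => /orP[]/eqP->.
  have : u (inord k) \in points m [:: i; j].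
    by rewrite perm_closed // in_points //= im jm.
  by rewrite inE !inE => /orP[]/eqP->; [left|right].
have une : u (inord i) != u (inord j) by rewrite (inj_eq perm_inj) inord_eq.
have [Ei|Ei] := cl i (mem_head _ _); have [Ej|Ej] := cl j ltac:(by rewrite !inE eqxx orbT);
  rewrite ?Ei ?Ej // in une *; rewrite ?eqxx // in une.
exact: tpermC.
Qed.

Lemma tr_conj_fix i j (s : seq nat) u : i <= m -> j <= m ->
  all (fun i => i <= m) s -> i \notin s -> j \notin s ->
  perm_on (points m s) u -> (tr m i j ^ u = tr m i j)%g.
Proof.
by move=> im jm sm iS jS us; rewrite /tr tpermJ !(out_perm us) // in_points.
Qed.

Hypothesis m3 : 3 <= m.

(** The group H8 is the centraliser of g2' in S_4; one inclusion is enough to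
    see which transpositions it omits. *)
Lemma H8_commute x : x \in @H8 m -> commute x g2'.
Proof.
have [m0 m1 m2] : [/\ 0 <= m, 1 <= m & 2 <= m] by split; lia.
suff /subsetP H : @H8 m \subset 'C[g2']%g by move/H/cent1P.
have cent (z : 'S_m.+1) : commute z g2' -> z \in 'C[g2']%g by move/cent1P.
rewrite gen_subG; apply/subsetP => y; rewrite in_setU in_set1.
case/orP => [/mulsgP[u v]|/eqP->].
  move=> us vt ->; rewrite inE in us; rewrite inE in vt; apply: cent.
  apply: commute_sym; apply/commgP/conjg_fixP.
  rewrite /g2' conjMg !conjgM; congr (_ * _)%g.
    rewrite (@tr_conj_Sym 0 1) //; apply: tr_conj_fix vt => //=.
    by rewrite m2 m3.
  rewrite (@tr_conj_fix 2 3 [:: 0; 1]) //=; last by rewrite m1.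
  exact: tr_conj_Sym.
apply/cent/eqP.
have a02 := acts_tr m0 m2; have a13 := acts_tr m1 m3.
have a01 := acts_tr m0 m1; have a23 := acts_tr m2 m3.
rewrite (acts_eqE (actsM (actsM a02 a13) (actsM a01 a23))
                  (actsM (actsM a01 a23) (actsM a02 a13))).
by apply/allP => k _; apply/eqP; case: k => [|[|[|[|k]]]].
Qed.

End Acts.

Section Transversal.
Variable m : nat.
Local Notation Sn := [set: 'S_m.+1]%G.
Implicit Types (l : label m) (L : seq (label m)) (T : seq (table_row m)).

(** * Labels and rows of the tables *)

(** A reason why two labels describe different elements of M(S_n): the group
    elements are not conjugate, or they are equal and the characters differ
    at an element of the centraliser. *)
Definition separated l l' : Prop :=
  cycle_invariant l.1 <> cycle_invariant l'.1 \/
  (l.1 = l'.1 /\ exists2 y, commute y l.1 & l.2 y <> l'.2 y).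

Lemma separated_Mclass l l' x : separated l l' ->
  x \in Mclass Sn l -> (x \in Mclass Sn l') = false.
Proof.
case: l l' => g f [g' f'] sep xl; apply/negP => xl'.
case: sep => [ne|[/= E [y yg ne]]].
  have [h _ E] := Mclass_conj xl xl'.
  by apply: ne; rewrite /= E cycle_invariantJ.
rewrite -{}E in xl'; apply: ne; apply: (Mclass_same xl xl').
by rewrite inE in_setT; apply/cent1P/commute_sym.
Qed.

Fixpoint all_separated l L : Prop :=
  if L is l' :: L' then separated l l' /\ all_separated l L' else True.

Definition row_labels T : seq (label m) := flatten [seq r.2 | r <- T].

Lemma all_separated_cat l L L' :
  all_separated l (L ++ L') <-> all_separated l L /\ all_separated l L'.
Proof. by elim: L => [|l' L IH] /=; tauto. Qed.

Lemma all_separated_has l L x : all_separated l L -> x \in Mclass Sn l ->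
  has (fun l => x \in Mclass Sn l) L = false.
Proof.
by elim: L => //= l' L IH [s sL] xl; rewrite (separated_Mclass s xl) IH.
Qed.

Lemma has_nth L j x l0 : j < size L -> x \in Mclass Sn (nth l0 L j) ->
  has (fun l => x \in Mclass Sn l) L.
Proof. by move=> jL xl; apply/(has_nthP l0); exists j. Qed.

(** The label in column j of row i is sent to the head of that row as soon as it
    is separated from all labels of the rows above. *)
Lemma alpha_first T i j l x r0 l0 h0 : i < size T -> j < size (nth r0 T i).2 ->
  nth l0 (nth r0 T i).2 j = l -> x \in Mclass Sn l ->
  all_separated l (row_labels (take i T)) ->
  alpha_table T x = Some (nth h0 (unzip1 T) i).
Proof.
move=> + + + xl; elim: T i => // r T IH [|i] /= iT jr lE.
  by move=> _; rewrite alpha_table_cons in_classes_of (has_nth (l0 := l0) jr) ?lE.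
move=> /all_separated_cat[sr sT].
by rewrite alpha_table_cons in_classes_of (all_separated_has sr xl) (IH i).
Qed.

(** The indices js locate in L all labels of the table that are not the first of
    their row, so an element outside L can only be described by the first
    label of its row. *)
Lemma others_transversal T L (js : seq nat) l0 h x y :
  x \in others L -> y \in others L ->
  alpha_table T x = Some h -> alpha_table T y = Some h ->
  uniq (unzip1 T) -> all (fun j => j < size L) js ->
  flatten [seq behead r.2 | r <- T] = [seq nth l0 L j | j <- js] -> x = y.
Proof.
move=> xs ys ax ay uT /allP jL tails; move: xs ys ax ay.
rewrite !in_setD !in_classes_of => /andP[nx _] /andP[ny _].
pose r0 : table_row m := (h, [::]).
move=> /(alpha_table_row r0 uT)[iT] + /(alpha_table_row r0 uT)[_].
move: (index _ _) iT => i iT; rewrite !in_classes_of.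
have {jL}tails z : has (fun l => z \in Mclass Sn l)
    (flatten [seq behead r.2 | r <- T]) -> has (fun l => z \in Mclass Sn l) L.
  by rewrite tails has_map => /hasP[j /jL jL' zl]; exact: has_nth jL' zl.
have sub z : has (fun l => z \in Mclass Sn l) (behead (nth r0 T i).2) ->
    has (fun l => z \in Mclass Sn l) L.
  move=> H; apply: tails; elim: T i iT H {uT} => // r T IH [|i] /= iT H.
    by rewrite has_cat H.
  by rewrite has_cat (IH i iT H) orbT.
case: (nth r0 T i).2 sub => // l s sub /= /orP[xl|/sub]; last by rewrite (negbTE nx).
by case/orP => [yl|/sub]; [exact: Mclass_eq xl yl|rewrite (negbTE ny)].
Qed.

(** The list idx gives the row of each label of the series. *)
Lemma listed_transversal T L (idx : seq nat) h0 l0 h x y :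
  x \in classes_of L -> y \in classes_of L ->
  alpha_table T x = Some h -> alpha_table T y = Some h ->
  uniq (unzip1 T) -> uniq idx -> size idx = size L ->
  all (fun i => i < size T) idx ->
  (forall i z, i < size L -> z \in Mclass Sn (nth l0 L i) ->
     alpha_table T z = Some (nth h0 (unzip1 T) (nth 0 idx i))) -> x = y.
Proof.
move=> xs ys ax ay uT uI sI /allP bI H; move: xs ys ax ay.
rewrite !in_classes_of => /(has_nthP l0)[i iL xi] /(has_nthP l0)[j jL yj].
rewrite (H i) // (H j) // => -[Ei] [Ej].
suff Eij : i = j by rewrite -Eij in yj; exact: Mclass_eq xi yj.
have bi : nth 0 idx i < size T by apply/bI/mem_nth; rewrite sI.
have bj : nth 0 idx j < size T by apply/bI/mem_nth; rewrite sI.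
apply/eqP; rewrite -(nth_uniq 0 _ _ uI) ?sI //.
by rewrite -(nth_uniq h0 _ _ uT) ?size_map // Ei Ej.
Qed.

Lemma alone_transversal L i x y :
  x \in nth set0 (alone L) i -> y \in nth set0 (alone L) i -> x = y.
Proof.
elim: L i => [|l L IH] [|i] /=; rewrite ?inE //; last exact: IH.
by rewrite !in_classes_of /= !orbF; apply: Mclass_eq.
Qed.

Lemma single_transversal (l : label m) x y :
  x \in classes_of [:: l] -> y \in classes_of [:: l] -> x = y.
Proof. by rewrite !in_classes_of /= !orbF; apply: Mclass_eq. Qed.

Lemma separated_value g f f' y : commute y g -> f y <> f' y ->
  separated (g, f) (g, f').
Proof. by move=> yg ne; right; split=> //; exists y. Qed.

Lemma separated_degree g (f f' : 'S_m.+1 -> algC) :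
  (f 1%g = 2)%R -> (f' 1%g = 1)%R -> separated (g, f) (g, f').
Proof.
move=> f2 f1; apply: (@separated_value _ _ _ 1%g); first exact: commute_sym (commute1 _).
rewrite f2 f1 => /eqP; rewrite -subr_eq0 (_ : 2 - 1 = 1)%R ?oner_eq0 //.
by rewrite mulr2n addrK.
Qed.

End Transversal.

Section Values.
Variable m : nat.
Local Notation acts := (@acts m).

Lemma acts_g2 : 1 <= m -> acts g2 (swap 0 1).
Proof. by move=> h; apply: acts_tr. Qed.

Lemma acts_g2' : 3 <= m -> acts g2' (swap 2 3 \o swap 0 1).
Proof. by move=> h; apply: actsM; apply: acts_tr => //; lia. Qed.

Lemma acts_g3 : 2 <= m -> acts g3 (swap 1 2 \o swap 0 1).
Proof. by move=> h; apply: actsM; apply: acts_tr => //; lia. Qed.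

Lemma acts_g4 : 3 <= m -> acts g4 (swap 2 3 \o (swap 1 2 \o swap 0 1)).
Proof. by move=> h; apply: actsM; [apply: acts_g3|apply: acts_tr] => //; lia. Qed.

Lemma acts_g5 : 4 <= m ->
  acts g5 (swap 3 4 \o (swap 2 3 \o (swap 1 2 \o swap 0 1))).
Proof. by move=> h; apply: actsM; [apply: acts_g4|apply: acts_tr] => //; lia. Qed.

Lemma acts_g6 : 4 <= m -> acts g6 (swap 3 4 \o (swap 1 2 \o swap 0 1)).
Proof. by move=> h; apply: actsM; [apply: acts_g3|apply: acts_tr] => //; lia. Qed.

Lemma odd_g2 : 1 <= m -> odd_perm (g2 : 'S_m.+1) = true.
Proof. by move=> h; rewrite odd_tr. Qed.

Lemma odd_g2' : 3 <= m -> odd_perm (g2' : 'S_m.+1) = false.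
Proof. by move=> h; rewrite odd_permM !odd_tr //; lia. Qed.

Lemma odd_g3 : 2 <= m -> odd_perm (g3 : 'S_m.+1) = false.
Proof. by move=> h; rewrite odd_permM !odd_tr //; lia. Qed.

Lemma odd_g4 : 3 <= m -> odd_perm (g4 : 'S_m.+1) = true.
Proof. by move=> h; rewrite odd_permM odd_g3 ?odd_tr //; lia. Qed.

Lemma odd_g5 : 4 <= m -> odd_perm (g5 : 'S_m.+1) = false.
Proof. by move=> h; rewrite odd_permM odd_g4 ?odd_tr //; lia. Qed.

Lemma odd_g6 : 4 <= m -> odd_perm (g6 : 'S_m.+1) = true.
Proof. by move=> h; rewrite odd_permM odd_g3 ?odd_tr //; lia. Qed.

Lemma algC_1N1 : (1 <> -1 :> algC)%R.
Proof.
by move=> /eqP; rewrite -subr_eq0 opprK -mulr2n pnatr_eq0.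
Qed.

Lemma c_rot_fix (g y : 'S_m.+1) a : y (inord 0) = inord 0 -> (c_rot g a y = 1)%R.
Proof. by move=> y0; rewrite /c_rot y0 findex0 expr0. Qed.

Lemma c_rot_self (g : 'S_m.+1) a : g (inord 0) != inord 0 -> (c_rot g a g = a)%R.
Proof.
move=> g0; rewrite /c_rot; suff -> : findex g (inord 0) (g (inord 0)) = 1 by [].
apply: (@findex_iter _ g (inord 0) 1).
have o0 := fingraph.order_gt0 g (inord 0); rewrite ltn_neqAle o0 andbT.
apply: contraNneq g0 => E.
by have := iter_order (@perm_inj _ g) (inord 0); rewrite -E /= => ->.
Qed.

Lemma degree_c_sgn : (@c_sgn m 1%g = 1)%R.
Proof. by rewrite /c_sgn odd_perm1. Qed.

Lemma degree_c_s2 : (@c_s2 m 1%g = 1)%R.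
Proof. by rewrite /c_s2 perm1 eqxx. Qed.

Lemma degree_c_H22 : 1 <= m -> (@c_H22 m 1%g = 1)%R.
Proof. by move=> m1; rewrite /c_H22 perm1 in_points //= m1. Qed.

Lemma degree_c_r8 : (@c_r8 m 1%g = 2)%R.
Proof. by rewrite /c_r8 eqxx. Qed.

Lemma degree_c_r3 : 4 <= m -> (@c_r3 m 1%g = 2)%R.
Proof.
move=> m4; rewrite /c_r3; set A := [set i in _ | _].
have -> : A = [set:: [seq inord i | i <- [:: 2; 3; 4]]].
  by apply/setP => i; rewrite !inE perm1 eqxx andbT.
rewrite cardsE; have /card_uniqP -> : uniq
    [seq inord i : 'I_m.+1 | i <- [:: 2; 3; 4]].
  by rewrite /= !inE !inord_eq //; lia.
by rewrite /= mulrSr addrK.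
Qed.

End Values.

Section SeparatedLabels.
Variable m : nat.

(** * Separation of labels with the same group element *)

Lemma separated_g4 (a : algC) : 3 <= m -> a <> (-1)%R ->
  separated (g4 : 'S_m.+1, c_rot g4 (-1)%R) (g4, c_rot g4 a).
Proof.
move=> m3 ne; apply: (@separated_value _ _ _ _ g4) => //.
have [_ g0] := acts_g4 m3 (leq0n m).
rewrite !c_rot_self ?g0 ?inord_eq //; exact: nesym.
Qed.

Lemma separated_g2'_1 : 3 <= m -> separated (g2' : 'S_m.+1, c_r8) (g2', Defs.c1).
Proof. by move=> m3; apply: separated_degree => //; exact: degree_c_r8. Qed.

Lemma separated_g2'_sgn : 3 <= m ->
  separated (g2' : 'S_m.+1, c_r8) (g2', c_sgn).
Proof.
by move=> m3; apply: separated_degree; rewrite ?degree_c_r8 ?degree_c_sgn.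
Qed.

Lemma separated_g2'_eps : 3 <= m ->
  separated (g2' : 'S_m.+1, c_r8) (g2', c_mul c_sgn c_H22).
Proof.
move=> m3; apply: separated_degree; first exact: degree_c_r8.
by rewrite /c_mul degree_c_sgn degree_c_H22 ?mul1r //; lia.
Qed.

Lemma separated_g2_1 : 4 <= m ->
  separated (g2 : 'S_m.+1, c_mul c_s2 c_r3) (g2, Defs.c1).
Proof.
move=> m4; apply: separated_degree => //.
by rewrite /c_mul degree_c_s2 degree_c_r3 ?mul1r.
Qed.

Lemma separated_g2_s2 : 4 <= m ->
  separated (g2 : 'S_m.+1, c_mul c_s2 c_r3) (g2, c_s2).
Proof.
move=> m4; apply: separated_degree; last exact: degree_c_s2.
by rewrite /c_mul degree_c_s2 degree_c_r3 ?mul1r.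
Qed.

Hypothesis m4 : 4 <= m.

(** The transposition of 3 and 4 is the cube of g6: it commutes with g6 and fixes
    0, so all [c_rot] are 1 there, and its sign is -1. *)
Lemma tr34_facts : let y := tr m 3 4 in
  [/\ commute y g6, y (inord 0) = inord 0 & c_sgn y = (-1)%R].
Proof.
have a34 := @acts_tr m 3 4 (ltac:(lia)) m4.
split.
- apply/eqP; rewrite (acts_eqE (actsM a34 (acts_g6 m4)) (actsM (acts_g6 m4) a34)).
  by apply/allP => k _; case: k => [|[|[|[|[|k]]]]].
- by have [_ ->] := a34 0 (leq0n m).
- by rewrite /c_sgn odd_tr ?expr1 //; lia.
Qed.

Lemma separated_g6_rot (a b : algC) :
  separated (g6 : 'S_m.+1, c_rot g6 a) (g6, c_mul c_sgn (c_rot g6 b)).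
Proof.
have [c y0 s] := tr34_facts; apply: (separated_value c).
by rewrite /c_mul s !c_rot_fix // mulr1; apply: algC_1N1.
Qed.

Lemma separated_g6_sgn (a : algC) :
  separated (g6 : 'S_m.+1, c_sgn) (g6, c_rot g6 a).
Proof.
have [c y0 s] := tr34_facts; apply: (separated_value c).
by rewrite s c_rot_fix //; apply/nesym/algC_1N1.
Qed.

Lemma separated_g6_mul (a : algC) : a <> 1%R ->
  separated (g6 : 'S_m.+1, c_sgn) (g6, c_mul c_sgn (c_rot g6 a)).
Proof.
move=> ne; apply: (@separated_value _ _ _ _ g6) => //.
have [_ g0] := acts_g6 m4 (leq0n m).
have n0 : (g6 : 'S_m.+1) (inord 0) != inord 0.
  by rewrite g0 -[_ 0]/2 inord_eq //; lia.
rewrite /c_mul /c_sgn odd_g6 // c_rot_self //.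
by rewrite expr1 mulN1r => /oppr_inj E; apply: ne.
Qed.

End SeparatedLabels.

Section Codes.
Variables (m : nat) (ys : seq 'S_m.+1).

(** * The heads of the rows are distinct *)

(** Membership of the permutations ys, to be chosen so that it distinguishes the
    subgroups of a table. *)
Definition code (A : {set 'S_m.+1}) : seq bool := [seq y \in A | y <- ys].

Lemma uniq_heads (T : seq (table_row m)) :
  uniq [seq (code r.1.1, code r.1.2) | r <- T] -> uniq (unzip1 T).
Proof.
have -> : [seq (code r.1.1, code r.1.2) | r <- T] =
  [seq (code h.1, code h.2) | h <- unzip1 T] by rewrite -map_comp.
exact: map_uniq.
Qed.

End Codes.
Arguments code : simpl never.

Lemma tr_neq1 m i j : i <= m -> j <= m -> i != j -> (tr m i j == 1%g) = false.
Proof.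
move=> im jm ne; apply/negbTE/eqP => E; have := odd_tr im jm.
by rewrite E odd_perm1 ne.
Qed.

Lemma heads_S2 : uniq (unzip1 table_S2).
Proof.
apply: (@uniq_heads _ [:: tr 1 0 1]).
have e1 : code [:: tr 1 0 1] H1 = [:: false].
  by rewrite /code /= in_set1 tr_neq1.
have e2 : code [:: tr 1 0 1] (H_ 2) = [:: true].
  by congr [:: _]; exact: (mem_H _ (@acts_tr 1 0 1 isT isT)).
by rewrite /= !e1 !e2.
Qed.

Lemma heads_S3 theta : uniq (unzip1 (table_S3 theta)).
Proof.
pose ys := [:: tr 2 0 1; tr 2 1 2].
apply: (@uniq_heads _ ys).
have e1 : code ys H1 = [:: false; false].
  by rewrite /code /= !in_set1 !tr_neq1.
have eH k : code ys (H_ k) =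
    [seq all (fun i => (f i == i) || (i < k)) (iota 0 3) |
      f <- [:: swap 0 1; swap 1 2]].
  by congr [:: _; _]; apply: mem_H; apply: acts_tr.
by rewrite /= !e1 !eH.
Qed.

Definition probes (m : nat) : seq 'S_m.+1 :=
  [:: tr m 0 1; tr m 1 2; tr m 2 3; (tr m 0 2 * tr m 1 3)%g].

Section Subgroups.
Variable m : nat.
Hypothesis m3 : 3 <= m.

Lemma acts_double : acts (tr m 0 2 * tr m 1 3)%g (swap 1 3 \o swap 0 2).
Proof. by apply: actsM; apply: acts_tr; lia. Qed.

Lemma code_H k : code (probes m) (H_ k) =
  [seq all (fun i => (f i == i) || (i < k)) (iota 0 m.+1) |
    f <- [:: swap 0 1; swap 1 2; swap 2 3; swap 1 3 \o swap 0 2]].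
Proof.
congr [:: _; _; _; _]; apply: mem_H; try by apply: acts_tr; lia.
exact: acts_double.
Qed.

Lemma code_H1 : code (probes m) H1 = [:: false; false; false; false].
Proof.
rewrite /code /= !in_set1 !tr_neq1; try lia.
by rewrite (acts_eqE acts_double (@acts1 m)).
Qed.

Lemma not_in_prod (x : 'S_m.+1) f t : acts x f ->
  all (fun i => 1 < i <= m) t ->
  ~~ (all (fun i => f i \in [:: 0; 1]) [:: 0; 1] && all (fun i => f i \in t) t) ->
  (x \in (perm.Sym (points m [:: 0; 1]%N) * perm.Sym (points m t))%g) = false.
Proof.
move=> ax /allP ht; apply: contraNF; apply: mem_points_prod ax _ _ _.
- by rewrite /= !andbT; lia.
- by apply/allP => i /ht /andP[].
- by rewrite /= andbT; apply/andP; split; apply/negP => /ht.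
Qed.

Lemma code_prod t : 2 \in t -> 3 \in t -> all (fun i => 1 < i <= m) t ->
  code (probes m) (perm.Sym (points m [:: 0; 1]%N) * perm.Sym (points m t))%g =
  [:: true; false; true; false].
Proof.
move=> t2 t3 ht; congr [:: _; _; _; _].
- by apply/prod_left/tr_Sym; rewrite !inE.
- by apply: (not_in_prod (acts_tr _ _) ht) => //; lia.
- exact/prod_right/tr_Sym.
- exact: (not_in_prod acts_double ht).
Qed.

Lemma code_H22 : code (probes m) H22 = [:: true; false; true; false].
Proof. by apply: code_prod => //=; rewrite m3; lia. Qed.

Lemma code_H23 : 4 <= m -> code (probes m) H23 = [:: true; false; true; false].
Proof. by move=> m4; apply: code_prod => //=; rewrite m3 m4; lia. Qed.

Lemma not_in_H8 (x : 'S_m.+1) f : acts x f ->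
  ~~ all (fun k => (swap 2 3 \o swap 0 1 \o f) k ==
                   (f \o (swap 2 3 \o swap 0 1)) k) (iota 0 m.+1) ->
  (x \in @H8 m) = false.
Proof.
move=> ax; apply: contraNF => /(H8_commute m3) /eqP.
have ag := acts_g2' m3.
by rewrite (acts_eqE (actsM ax ag) (actsM ag ax)).
Qed.

Lemma code_H8 : code (probes m) H8 = [:: true; false; true; true].
Proof.
have sub x : x \in @H22 m -> x \in @H8 m.
  by move=> xH; rewrite mem_gen // in_setU xH.
have [h0 h1 h2 h3] := code_H22.
congr [:: _; _; _; _].
- exact: sub.
- apply: (not_in_H8 (acts_tr _ _)); [lia|lia|].
  by apply/negP => /allP /(_ 0); rewrite mem_iota => /(_ isT).
- exact: sub.
- by rewrite mem_gen // in_setU in_set1 eqxx orbT.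
Qed.

End Subgroups.

Lemma heads_S4 im theta : uniq (unzip1 (table_S4 im theta)).
Proof.
apply: (@uniq_heads _ (probes 3)).
by rewrite /= !(code_H1 (m := 3)) // !(code_H22 (m := 3)) //
   !(code_H8 (m := 3)) // !(code_H (m := 3)).
Qed.

Lemma heads_S5 im theta zeta : uniq (unzip1 (table_S5 im theta zeta)).
Proof.
have a34 := @acts_tr 4 3 4 isT isT.
have mH k := @mem_H 4 k _ _ a34.
have m1 : (tr 4 3 4 \in @H1 4) = false by rewrite in_set1 tr_neq1.
have m22 : (tr 4 3 4 \in @H22 4) = false by exact: (not_in_prod _ a34).
have m23 : tr 4 3 4 \in @H23 4 by apply/prod_right/tr_Sym; rewrite !inE.
have m8 : (tr 4 3 4 \in @H8 4) = false by exact: (not_in_H8 _ a34).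
apply: (@uniq_heads _ (tr 4 3 4 :: probes 4)).
have cons A : code (tr 4 3 4 :: probes 4) A =
  (tr 4 3 4 \in A) :: code (probes 4) A by [].
by rewrite /= !cons !mH m1 m22 m23 m8 !(code_H1 (m := 4)) //
   !(code_H22 (m := 4)) // !(code_H23 (m := 4)) //
   !(code_H8 (m := 4)) // !(code_H (m := 4)).
Qed.

(** * The exceptional families *)

Lemma cycle_invariants_S2 :
  (cycle_invariant (@g1 1) = (2, false)) * (cycle_invariant (@g2 1) = (0, true)).
Proof.
split; first exact: cycle_invariant_acts (@acts1 1) (odd_perm1 _).
exact: cycle_invariant_acts (@acts_g2 1 isT) (@odd_g2 1 isT).
Qed.

Lemma cycle_invariants_S4 :
  ((cycle_invariant (@g1 3) = (4, false)) *
   (cycle_invariant (@g2 3) = (2, true)) *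
   (cycle_invariant (@g2' 3) = (0, false)) *
   (cycle_invariant (@g3 3) = (1, false)) *
   (cycle_invariant (@g4 3) = (0, true)))%type.
Proof.
do !split.
- exact: cycle_invariant_acts (@acts1 3) (odd_perm1 _).
- exact: cycle_invariant_acts (@acts_g2 3 isT) (@odd_g2 3 isT).
- exact: cycle_invariant_acts (@acts_g2' 3 isT) (@odd_g2' 3 isT).
- exact: cycle_invariant_acts (@acts_g3 3 isT) (@odd_g3 3 isT).
- exact: cycle_invariant_acts (@acts_g4 3 isT) (@odd_g4 3 isT).
Qed.

Lemma cycle_invariants_S5 :
  ((cycle_invariant (@g1 4) = (5, false)) *
   (cycle_invariant (@g2 4) = (3, true)) *
   (cycle_invariant (@g2' 4) = (1, false)) *
   (cycle_invariant (@g3 4) = (2, false)) *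
   (cycle_invariant (@g4 4) = (1, true)) *
   (cycle_invariant (@g5 4) = (0, false)) *
   (cycle_invariant (@g6 4) = (0, true)))%type.
Proof.
do !split.
- exact: cycle_invariant_acts (@acts1 4) (odd_perm1 _).
- exact: cycle_invariant_acts (@acts_g2 4 isT) (@odd_g2 4 isT).
- exact: cycle_invariant_acts (@acts_g2' 4 isT) (@odd_g2' 4 isT).
- exact: cycle_invariant_acts (@acts_g3 4 isT) (@odd_g3 4 isT).
- exact: cycle_invariant_acts (@acts_g4 4 isT) (@odd_g4 4 isT).
- exact: cycle_invariant_acts (@acts_g5 4 isT) (@odd_g5 4 isT).
- exact: cycle_invariant_acts (@acts_g6 4 isT) (@odd_g6 4 isT).
Qed.

Ltac by_class invs := by left; rewrite /= !invs.

Section Tables.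
Variables im theta zeta : algC.
Hypothesis im_prim : (4.-primitive_root im)%R.
Hypothesis theta_prim : (3.-primitive_root theta)%R.

Lemma S1_series gamma h x y :
  x \in nth set0 series_S1 gamma -> y \in nth set0 series_S1 gamma ->
  alpha_table table_S1 x = Some h -> alpha_table table_S1 y = Some h -> x = y.
Proof.
move=> _ _; rewrite !alpha_table_cons !in_classes_of /= !orbF.
by case: ifP => // xl _; case: ifP => // yl _; apply: Mclass_eq xl yl.
Qed.

Lemma sgn_g2 : (@c_sgn 1 g2 = -1)%R.
Proof. by rewrite /c_sgn odd_g2 // expr1. Qed.

Lemma separated_sgn (y : 'S_2) : commute g2 y ->
  separated (y, Defs.c1) (y, c_sgn) /\ separated (y, c_sgn) (y, Defs.c1).
Proof.
move=> cy; split; apply: (separated_value cy); rewrite sgn_g2.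
  exact: algC_1N1.
exact/nesym/algC_1N1.
Qed.

Lemma alpha_S2 h0 i x : i < 3 ->
  x \in Mclass [set: 'S_2]%G (nth (g1, Defs.c1)
    [:: (g1, Defs.c1); (g2, Defs.c1); (g1, c_sgn)] i) ->
  alpha_table table_S2 x = Some (nth h0 (unzip1 table_S2) i).
Proof.
have [s1 _] := separated_sgn (erefl : commute g2 g2).
have [_ s2] := separated_sgn (commute1 g2).
pose r0 : table_row 1 := ((H1, H1), [::]); pose l0 : label 1 := (g1, Defs.c1).
pose at_row i j := @alpha_first 1 table_S2 i j _ x r0 l0 h0.
case: i => [|[|[|]]] // _ xl; rewrite /= in xl.
- exact: (at_row _ 0 0 isT isT erefl xl I).
- apply: (at_row _ 1 0 isT isT erefl xl).
  by split; [by_class cycle_invariants_S2|split].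
- apply: (at_row _ 2 0 isT isT erefl xl).
  by split; [|split; [|split]] => //; by_class cycle_invariants_S2.
Qed.

Lemma S2_card3_series gamma h x y :
  x \in nth set0 series_S2_card3 gamma -> y \in nth set0 series_S2_card3 gamma ->
  alpha_table table_S2 x = Some h -> alpha_table table_S2 y = Some h -> x = y.
Proof.
case: gamma => [|[|gamma]] /=; last by rewrite nth_nil inE.
  move=> xs ys ax ay; apply: (@listed_transversal _ _ _ [:: 0; 1; 2] h
    (g1, Defs.c1) h x y xs ys ax ay heads_S2 isT erefl isT).
  move=> i z iL zl; rewrite (_ : nth 0 [:: 0; 1; 2] i = i); last first.
    by case: i iL {zl} => [|[|[|]]].
  exact: alpha_S2 zl.
by move=> xl yl _ _; apply: single_transversal xl yl.
Qed.

Lemma S2_card2_series gamma h x y :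
  x \in nth set0 series_S2_card2 gamma -> y \in nth set0 series_S2_card2 gamma ->
  alpha_table table_S2 x = Some h -> alpha_table table_S2 y = Some h -> x = y.
Proof.
case: gamma => [|[|[|gamma]]] /=; last by rewrite nth_nil inE.
  move=> xs ys ax ay; apply: (@listed_transversal _ _ _ [:: 0; 1] h
    (g1, Defs.c1) h x y xs ys ax ay heads_S2 isT erefl isT).
  move=> i z iL zl; rewrite (_ : nth 0 [:: 0; 1] i = i); last first.
    by case: i iL {zl} => [|[|]].
  have {}zl : z \in Mclass [set: 'S_2]%G (nth (g1, Defs.c1)
      [:: (g1, Defs.c1); (g2, Defs.c1); (g1, c_sgn)] i).
    case: i iL zl => [|[|i]] iL zl; [exact: zl|exact: zl|discriminate iL].
  exact: alpha_S2 (ltnW iL) zl.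
all: by move=> xl yl _ _; apply: single_transversal xl yl.
Qed.

Lemma S3_series (L : seq (label 2)) gamma h x y :
  flatten [seq behead r.2 | r <- table_S3 theta] =
    [seq nth (g1, Defs.c1) L j | j <- [:: 0; 1; 2]] -> 3 <= size L ->
  x \in nth set0 (others L :: alone L) gamma ->
  y \in nth set0 (others L :: alone L) gamma ->
  alpha_table (table_S3 theta) x = Some h ->
  alpha_table (table_S3 theta) y = Some h -> x = y.
Proof.
move=> tails sL; case: gamma => [|gamma] xs ys ax ay.
  apply: others_transversal xs ys ax ay (heads_S3 theta) _ tails.
  by rewrite /= (ltn_trans _ sL) // (ltn_trans _ sL) // sL.
exact: alone_transversal xs ys.
Qed.

Lemma S3_card5_series gamma h x y :
  x \in nth set0 (series_S3_card5 theta) gamma ->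
  y \in nth set0 (series_S3_card5 theta) gamma ->
  alpha_table (table_S3 theta) x = Some h ->
  alpha_table (table_S3 theta) y = Some h -> x = y.
Proof.
exact: (@S3_series [:: (g3, c_rot g3 (theta ^+ 1)%R);
  (g3, c_rot g3 (theta ^+ 2)%R); (g2, c_sgn)]).
Qed.

Lemma S3_card4_series gamma h x y :
  x \in nth set0 (series_S3_card4 theta) gamma ->
  y \in nth set0 (series_S3_card4 theta) gamma ->
  alpha_table (table_S3 theta) x = Some h ->
  alpha_table (table_S3 theta) y = Some h -> x = y.
Proof.
exact: (@S3_series [:: (g3, c_rot g3 (theta ^+ 1)%R);
  (g3, c_rot g3 (theta ^+ 2)%R); (g2, c_sgn); (g1, c_sgn)]).
Qed.

Lemma im_values : [/\ im <> -1, - im <> -1 & (1 : algC) <> -1]%R.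
Proof.
have im2 : (im ^+ 2)%R <> 1%R.
  by move/eqP; rewrite -(prim_order_dvd im_prim).
split; last exact: algC_1N1.
  by move=> E; apply: im2; rewrite E sqrrN expr1n.
by move/oppr_inj => E; apply: im2; rewrite E expr1n.
Qed.

Lemma theta_values : ((theta ^+ 1)%R <> 1%R) /\ ((theta ^+ 2)%R <> 1%R).
Proof. by split; move/eqP; rewrite -(prim_order_dvd theta_prim). Qed.

(** The labels of the listed series of three elements; the rows count from 0. *)
Lemma alpha_S4 h0 i x : i < 3 ->
  x \in Mclass [set: 'S_4]%G (nth (g1, Defs.c1)
    [:: (g2, c_s2); (g2', c_r8); (g4, c_rot g4 (-1)%R)] i) ->
  alpha_table (table_S4 im theta) x =
  Some (nth h0 (unzip1 (table_S4 im theta)) (nth 0 [:: 4; 5; 2] i)).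
Proof.
have [i1 i2 i3] := im_values.
pose r0 : table_row 3 := ((H1, H1), [::]); pose l0 : label 3 := (g1, Defs.c1).
pose at_row i j := @alpha_first 3 (table_S4 im theta) i j _ x r0 l0 h0.
case: i => [|[|[|]]] // _ xl; rewrite /= in xl.
- apply: (at_row _ 4 1 isT isT erefl xl).
  repeat (split; [by_class cycle_invariants_S4|]); exact: I.
- apply: (at_row _ 5 1 isT isT erefl xl).
  repeat (split; [first [by_class cycle_invariants_S4
    | exact: separated_g2'_1 | exact: separated_g2'_sgn
    | exact: separated_g2'_eps]|]); exact: I.
- apply: (at_row _ 2 1 isT isT erefl xl).
  repeat (split; [first [by_class cycle_invariants_S4
    | exact: separated_g4]|]); exact: I.
Qed.

Lemma S4_series gamma h x y :
  x \in nth set0 (series_S4 im theta) gamma ->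
  y \in nth set0 (series_S4 im theta) gamma ->
  alpha_table (table_S4 im theta) x = Some h ->
  alpha_table (table_S4 im theta) y = Some h -> x = y.
Proof.
case: gamma => [|[|gamma]] xs ys ax ay; last exact: alone_transversal xs ys.
  exact: (@others_transversal _ _ _ [:: 0; 1; 9; 7; 4; 8; 2; 3; 5]
    (g1, Defs.c1) _ _ _ xs ys ax ay (heads_S4 im theta) isT erefl).
apply: (@listed_transversal _ _ _ [:: 4; 5; 2] h (g1, Defs.c1) h x y
  xs ys ax ay (heads_S4 im theta) isT erefl isT).
exact: alpha_S4.
Qed.

(** The two listed series indexed by j = 1, 2. *)
Lemma alpha_S5_theta h0 j i x : i < 2 -> (j == 1) || (j == 2) ->
  x \in Mclass [set: 'S_5]%G (nth (g1, Defs.c1)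
    [:: (g3, c_rot g3 (theta ^+ j)%R); (g6, c_rot g6 (theta ^+ j)%R)] i) ->
  alpha_table (table_S5 im theta zeta) x =
  Some (nth h0 (unzip1 (table_S5 im theta zeta)) (nth 0 [:: 4; 5] i)).
Proof.
pose r0 : table_row 4 := ((H1, H1), [::]); pose l0 : label 4 := (g1, Defs.c1).
pose at_row i j := @alpha_first 4 (table_S5 im theta zeta) i j _ x r0 l0 h0.
have sep4 (l : algC) : all_separated (g3, c_rot g3 l)
    (row_labels (take 4 (table_S5 im theta zeta))).
  repeat (split; [by_class cycle_invariants_S5|]); exact: I.
have sep5 (l : algC) : all_separated (g6, c_rot g6 l)
    (row_labels (take 5 (table_S5 im theta zeta))).
  repeat (split; [first [by_class cycle_invariants_S5
    | exact: separated_g6_rot]|]); exact: I.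
case: i => [|[|]] // _ /orP[]/eqP-> xl; rewrite [nth _ _ _]/= in xl.
- exact: (at_row _ 4 2 isT isT erefl xl (sep4 _)).
- exact: (at_row _ 4 3 isT isT erefl xl (sep4 _)).
- exact: (at_row _ 5 1 isT isT erefl xl (sep5 _)).
- exact: (at_row _ 5 2 isT isT erefl xl (sep5 _)).
Qed.

(** The listed series of five elements. *)
Lemma alpha_S5 h0 i x : i < 5 ->
  x \in Mclass [set: 'S_5]%G (nth (g1, Defs.c1)
    [:: (g2, c_s2); (g2, c_mul c_s2 c_r3); (g2', c_r8);
        (g4, c_rot g4 (-1)%R); (g6, c_sgn)] i) ->
  alpha_table (table_S5 im theta zeta) x =
  Some (nth h0 (unzip1 (table_S5 im theta zeta)) (nth 0 [:: 4; 10; 11; 8; 6] i)).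
Proof.
have [i1 i2 i3] := im_values; have [t1 t2] := theta_values.
pose r0 : table_row 4 := ((H1, H1), [::]); pose l0 : label 4 := (g1, Defs.c1).
pose at_row i j := @alpha_first 4 (table_S5 im theta zeta) i j _ x r0 l0 h0.
case: i => [|[|[|[|[|]]]]] // _ xl; rewrite [nth _ _ _]/= in xl.
- apply: (at_row _ 4 1 isT isT erefl xl).
  repeat (split; [by_class cycle_invariants_S5|]); exact: I.
- apply: (at_row _ 10 1 isT isT erefl xl).
  repeat (split; [first [by_class cycle_invariants_S5
    | exact: separated_g2_s2 | exact: separated_g2_1]|]); exact: I.
- apply: (at_row _ 11 1 isT isT erefl xl).
  repeat (split; [first [by_class cycle_invariants_S5
    | exact: separated_g2'_1 | exact: separated_g2'_sgn
    | exact: separated_g2'_eps]|]); exact: I.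
- apply: (at_row _ 8 1 isT isT erefl xl).
  repeat (split; [first [by_class cycle_invariants_S5
    | exact: separated_g4]|]); exact: I.
- apply: (at_row _ 6 1 isT isT erefl xl).
  repeat (split; [first [by_class cycle_invariants_S5
    | exact: separated_g6_sgn | exact: separated_g6_mul]|]); exact: I.
Qed.

Lemma S5_series gamma h x y :
  x \in nth set0 (series_S5 im theta zeta) gamma ->
  y \in nth set0 (series_S5 im theta zeta) gamma ->
  alpha_table (table_S5 im theta zeta) x = Some h ->
  alpha_table (table_S5 im theta zeta) y = Some h -> x = y.
Proof.
have heads := heads_S5 im theta zeta.
case: gamma => [|[|[|[|gamma]]]] xs ys ax ay; last exact: alone_transversal xs ys.
- exact: (@others_transversal _ _ _ [:: 0; 1; 2; 3; 4; 5; 17; 13; 15; 6; 7;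
    14; 16; 21; 20; 18; 10; 19; 8; 9; 11] (g1, Defs.c1) _ _ _ xs ys ax ay
    heads isT erefl).
- apply: (@listed_transversal _ _ _ [:: 4; 5] h (g1, Defs.c1) h x y
    xs ys ax ay heads isT erefl isT) => i z iL zl.
  exact: (@alpha_S5_theta h 1 i z iL isT zl).
- apply: (@listed_transversal _ _ _ [:: 4; 5] h (g1, Defs.c1) h x y
    xs ys ax ay heads isT erefl isT) => i z iL zl.
  exact: (@alpha_S5_theta h 2 i z iL isT zl).
- apply: (@listed_transversal _ _ _ [:: 4; 10; 11; 8; 6] h (g1, Defs.c1) h x y
    xs ys ax ay heads isT erefl isT).
  exact: alpha_S5.
Qed.

End Tables.

Lemma exceptional_transversal m (T : seq (table_row m))
    (series : seq {set {set Mpair [set: 'S_m.+1]%G}}) :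
  (forall gamma h x y, x \in nth set0 series gamma ->
     y \in nth set0 series gamma ->
     alpha_table T x = Some h -> alpha_table T y = Some h -> x = y) ->
  forall gamma h, #|@fd_fibre (data_exc T series) h :&:
                    fd_HC (data_exc T series) gamma| <= 1.
Proof.
move=> H gamma h; apply: fibre_series_le1 => x y _ _ ax ay xs ys.
exact: H xs ys ax ay.
Qed.

Theorem mainTheorem2 (im theta zeta : algC)
    (im_prim : (4.-primitive_root im)%R)
    (theta_prim : (3.-primitive_root theta)%R)
    (zeta_prim : (5.-primitive_root zeta)%R)
    (c : family_case) (gamma : nat)
    (h : {set fd_group (data_of im theta zeta c)} *
         {set fd_group (data_of im theta zeta c)})
    (h_in_Hbar : h \in fd_Hbar (data_of im theta zeta c)) :
  #|fd_fibre h :&: fd_HC (data_of im theta zeta c) gamma| <= 1.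
Proof.
case: c h {h_in_Hbar} => [|D eD delta|D oD|||||||] h.
- exact: (exceptional_transversal S1_series).
- exact: BC_transversal.
- exact: D_transversal.
- exact: (exceptional_transversal S1_series).
- exact: (exceptional_transversal S2_card3_series).
- exact: (exceptional_transversal S2_card2_series).
- exact: (exceptional_transversal (@S3_card5_series theta)).
- exact: (exceptional_transversal (@S3_card4_series theta)).
- exact: (exceptional_transversal (S4_series im_prim)).
- exact: (exceptional_transversal (S5_series (zeta := zeta) im_prim theta_prim)).
Qed.
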